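(* Let $\mathcal{Z}$ be the class of finite cyclic groups, $\mathcal{A}_p$ the class of finite abelian $p$-groups ($p$ a positive prime), $\mathcal{I}$ the class of finite abelian indecomposable groups, and $\mathcal{A}$ the class of finite abelian groups, each taken up to isomorphism. Then the realizable densities of these classes exist and satisfy \[ \delta(\mathcal{Z}) = \frac14, \qquad \delta(\mathcal{A}_p) = \begin{cases} 0 & \text{if } p \text{ is odd} \\ 1 & \text{if } p = 2, \end{cases} \qquad \delta(\mathcal{I}) = 0, \qquad \delta(\mathcal{A}) = \frac12 . \]
   Context: All rings are associative with a multiplicative identity (not necessarily commutative), and $R^\times$ denotes the multiplicative group of units of a ring $R$. A group $G$ is realizable if there exists a ring $R$ with $G \cong R^\times$. For a class $\mathcal{C}$ of finite groups (considered up to isomorphism) and a positive real number $x$, let $\mathcal{C}(x)$ denote the number of (isomorphism classes of) groups in $\mathcal{C}$ of order at most $x$, and let $\mathcal{C}_r(x)$ denote the number of those that are realizable. The realizable density of $\mathcal{C}$ is $\delta(\mathcal{C}) = \lim_{x \to \infty} \mathcal{C}_r(x)/\mathcal{C}(x)$, if the limit exists. The indecomposable finite abelian groups are the cyclic groups of prime power order. *)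

(* Defs.v *)
From mathcomp Require Import all_boot all_order all_algebra all_fingroup all_solvable.
From mathcomp Require Import all_classical all_reals all_analysis.

Set Implicit Arguments.
Unset Strict Implicit.
Unset Printing Implicit Defensive.

Import Order.TTheory GRing.Theory Num.Theory.
Import numFieldNormedType.Exports.
Local Open Scope ring_scope.

Definition two_sided_unit (A : pzRingType) (a : A) : Prop :=
  exists b : A, a * b = 1 /\ b * a = 1.

(* G is isomorphic to the unit group of some ring; the ring may be infinite or
   noncommutative, so its unit group is not an instance of finGroupType and the
   isomorphism is spelled out as a map from G. *)
Definition realizable (gT : finGroupType) (G : {group gT}) : Prop :=
  exists (A : pzRingType) (f : gT -> A),
    [/\ {in G &, injective f},
        {in G &, forall x y, f (x * y)%g = f x * f y} &
        forall a : A, two_sided_unit a <-> exists2 x, x \in G & f x = a].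

Definition group_class := forall gT : finGroupType, {group gT} -> Prop.

Definition cyclic_groups : group_class := fun gT G => cyclic G.

Definition abelian_pgroups (p : nat) : group_class :=
  fun gT G => abelian G /\ (p.-group G)%g.

Definition abelian_groups : group_class := fun gT G => abelian G.

Definition indecomposable (gT : finGroupType) (G : {group gT}) : Prop :=
  G :!=: 1%g /\
  forall H K : {group gT}, (H \x K)%g = G -> H :=: 1%g \/ K :=: 1%g.

Definition abelian_indecomposable_groups : group_class :=
  fun gT G => abelian G /\ indecomposable G.

Definition realizable_in (C : group_class) : group_class :=
  fun gT G => C gT G /\ realizable G.

Section Count.
Variable R : realType.

(* G 0, ..., G (n-1) are representatives of the isomorphism classes of the
   groups in C of order at most x. *)
Definition iso_class_count (C : group_class) (x : R) (n : nat) : Prop :=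
  exists (gT : 'I_n -> finGroupType) (G : forall i, {group gT i}),
    [/\ forall i, C (gT i) (G i) /\ #|G i|%:R <= x,
        forall i j, (G i \isog G j)%g -> i = j &
        forall (hT : finGroupType) (H : {group hT}),
          C hT H -> #|H|%:R <= x -> exists i, (H \isog G i)%g].

(* The default value 0 is never used: see num_iso_classesP. *)
Definition num_iso_classes (C : group_class) (x : R) : nat :=
  xget 0%N [set n | iso_class_count C x n]%classic.

Definition realizable_density (C : group_class) (d : R) : Prop :=
  (((num_iso_classes (realizable_in C) x)%:R / (num_iso_classes C x)%:R : R)
    @[x --> +oo] --> d)%classic.

End Count.

Section MultiplicationTable.
Variable N : nat.

Let table_type := ('I_N.+1 * {ffun 'I_N.+1 * 'I_N.+1 -> 'I_N.+1})%type.

Let table (gT : finGroupType) (G : {group gT}) : table_type :=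
  (inord #|G|,
   [ffun ij : 'I_N.+1 * 'I_N.+1 => inord (index (nth 1%g (enum G) ij.1 * nth 1%g (enum G) ij.2)%g
                            (enum G))]).

Let table_isog (gT hT : finGroupType) (G : {group gT}) (H : {group hT}) :
  (#|G| <= N)%N -> (#|H| <= N)%N -> table G = table H -> (G \isog H)%g.
Proof.
move=> GN HN [/(congr1 val)]; rewrite /= !inordK ?ltnS // => eGH /ffunP tGH.
pose f x := nth 1%g (enum H) (index x (enum G)).
have ltG x : x \in G -> (index x (enum G) < #|G|)%N.
  by move=> Gx; rewrite cardE index_mem mem_enum.
have fH x : x \in G -> f x \in H.
  by move=> Gx; rewrite -mem_enum mem_nth // -cardE -eGH ltG.
have iK x : x \in G -> index (f x) (enum H) = index x (enum G).
  by move=> Gx; rewrite index_uniq ?enum_uniq // -cardE -eGH ltG.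
have fK x : x \in G -> nth 1%g (enum G) (index (f x) (enum H)) = x.
  by move=> Gx; rewrite iK // nth_index // mem_enum.
have ltN x : x \in G -> (index x (enum G) < N.+1)%N.
  by move=> Gx; rewrite ltnS ltnW // (leq_trans (ltG _ Gx)).
have fM : {in G &, {morph f : x y / (x * y)%g}}.
  move=> x y Gx Gy.
  have /(congr1 val) := tGH (inord (index x (enum G)), inord (index y (enum G))).
  rewrite !ffunE /= (inordK (ltN x Gx)) (inordK (ltN y Gy)).
  rewrite !(nth_index, mem_enum) // -/(f x) -/(f y).
  have ltH : (index (f x * f y)%g (enum H) < N.+1)%N.
    rewrite ltnS ltnW // (leq_trans _ HN) // [X in (_ < X)%N]cardE index_mem.
    by rewrite mem_enum groupM ?fH.
  rewrite inordK ?ltN ?groupM // inordK // => E.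
  by rewrite {1}/f E nth_index // mem_enum groupM ?fH.
apply/isogP; exists (Morphism fM).
  apply/injmP => x y Gx Gy /= fxy.
  by rewrite -(fK x Gx) -(fK y Gy) fxy.
apply/eqP; rewrite eqEcard; apply/andP; split.
  by apply/fintype.subsetP => _ /morphimP[x _ Gx ->]; exact: fH.
rewrite card_injm ?eGH //.
apply/injmP => x y Gx Gy /= fxy.
by rewrite -(fK x Gx) -(fK y Gy) fxy.
Qed.

Lemma bounded_representatives (C : group_class) :
  (forall (gT : finGroupType) (G : {group gT}), C gT G -> (#|G| <= N)%N) ->
  exists (n : nat) (gT : 'I_n -> finGroupType) (G : forall i, {group gT i}),
    [/\ forall i, C (gT i) (G i),
        forall i j, (G i \isog G j)%g -> i = j &
        forall (hT : finGroupType) (H : {group hT}),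
          C hT H -> exists i, (H \isog G i)%g].
Proof.
move=> CN.
pose has_table (t : table_type) (gT : finGroupType) (G : {group gT}) :=
  C gT G /\ table G = t.
pose S := [set t | `[< exists gT G, @has_table t gT G >]].
pose r (t u : table_type) := `[< exists gT hT (G : {group gT}) (H : {group hT}),
  [/\ has_table t gT G, has_table u hT H & (G \isog H)%g] >].
have r_eqv : {in S & &, equivalence_rel r}.
  move=> t u v; rewrite !inE => _ _ /asboolP[gT [G GP]]; split.
    by apply/asboolP; exists gT, gT, G, G; split => //; exact: isog_refl.
  move=> /asboolP[g1 [g2 [G1 [G2 [[C1 T1] [C2 T2] I12]]]]].
  have I21 : (G2 \isog G1)%g by rewrite isog_sym.
  apply/asboolP/asboolP => -[g3 [g4 [G3 [G4 [[C3 T3] [C4 T4] I34]]]]].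
    exists g2, g4, G2, G4; split => //; apply: (isog_trans I21).
    by apply: isog_trans I34; apply: table_isog; rewrite ?T1 //; exact: CN.
  exists g1, g4, G1, G4; split => //; apply: (isog_trans I12).
  by apply: isog_trans I34; apply: table_isog; rewrite ?T2 //; exact: CN.
have partS := equivalence_partitionP r_eqv.
set P := equivalence_partition r S in partS.
have trX := transversalP partS.
set X := transversal P S in trX.
have pick (i : 'I_#|X|) :
    exists s : {gT : finGroupType & {group gT}}, has_table (enum_val i) _ (projT2 s).
  have := fintype.subsetP (transversal_sub trX) _ (enum_valP i).
  by rewrite inE => /asboolP[gT [G GP]]; exists (existT _ gT G).
have [s sP] := choice pick.
exists #|X|, (fun i => projT1 (s i)), (fun i => projT2 (s i)); split.
- by move=> i; case: (sP i).
- move=> i j ij; apply: enum_val_inj.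
  have Xi := enum_valP i; have Xj := enum_valP j.
  have Si := fintype.subsetP (transversal_sub trX) _ Xi.
  have Sj := fintype.subsetP (transversal_sub trX) _ Xj.
  apply: (pblock_inj trX) => //; apply/eqP.
  rewrite eq_pblock; first last.
  + by rewrite (cover_partition partS).
  + by case/and3P: partS.
  rewrite pblock_equivalence_partition //.
  by apply/asboolP; exists _, _, (projT2 (s i)), (projT2 (s j)); split.
- move=> hT H CH.
  have SH : table H \in S by rewrite inE; apply/asboolP; exists hT, H.
  have PB : finset.pblock P (table H) \in P.
    by rewrite finset.pblock_mem // (cover_partition partS).
  pose t := transversal_repr (table H) X (finset.pblock P (table H)).
  have Xt : t \in X by exact: (repr_mem_transversal trX).
  have St := fintype.subsetP (transversal_sub trX) _ Xt.
  have := repr_mem_pblock trX (table H) PB; rewrite -/t.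
  rewrite pblock_equivalence_partition // => /asboolP.
  case=> [g1 [g2 [G1 [G2 [[C1 T1] [C2 T2] I12]]]]].
  exists (enum_rank_in Xt t).
  have [C3 T3] := sP (enum_rank_in Xt t).
  rewrite enum_rankK_in // in T3.
  apply: (@isog_trans _ _ _ _ G1); first by apply: table_isog; rewrite ?T1 //; exact: CN.
  apply: (isog_trans I12).
  by apply: table_isog; rewrite ?T2 //; exact: CN.
Qed.

End MultiplicationTable.

Section CountTheory.
Variable R : realType.
Implicit Types (C : group_class) (x : R).

Let iso_class_count_le C x m n :
  iso_class_count C x m -> iso_class_count C x n -> (m <= n)%N.
Proof.
move=> [gT [G [GP Ginj _]]] [hT [H [_ _ HP]]].
have /choice[f fP] (i : 'I_m) : exists j, (G i \isog H j)%g.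
  by have [CG Gx] := GP i; exact: HP.
rewrite -[m]card_ord -[n]card_ord; apply: (@leq_card _ _ f) => i j fij.
by apply: Ginj; apply: (isog_trans (fP i)); rewrite fij isog_sym.
Qed.

Lemma iso_class_count_unique C x m n :
  iso_class_count C x m -> iso_class_count C x n -> m = n.
Proof.
by move=> mP nP; apply/eqP; rewrite eqn_leq !(@iso_class_count_le C x).
Qed.

Lemma num_iso_classesP C x : iso_class_count C x (num_iso_classes C x).
Proof.
apply: (@xgetPex _ 0%N [set n | iso_class_count C x n]%classic).
pose D : group_class := fun gT G => C gT G /\ #|G|%:R <= x.
have [|n [gT [G [GP Ginj Gall]]]] := @bounded_representatives (Num.bound `|x|) D.
  move=> gT G [_ Gx]; rewrite -(ler_nat R) (le_trans Gx) //.
  exact: le_trans (ler_norm x) (ltW (archi_boundP (normr_ge0 x))).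
by exists n, gT, G; split => // hT H CH Hx; exact: Gall.
Qed.

End CountTheory.

(* Main.v *)
Require Import Defs.
From mathcomp Require Import all_boot all_order all_algebra all_fingroup all_solvable.
From mathcomp Require Import all_classical all_reals all_analysis.
From mathcomp Require Import all_field.
From mathcomp Require Import zify ring lra.
From HB Require Import structures.

Set Implicit Arguments.
Unset Strict Implicit.
Unset Printing Implicit Defensive.

Import Order.TTheory GRing.Theory Num.Theory.
Local Open Scope ring_scope.

(** A finite abelian group is encoded by its invariant factors, a decreasing
chain of divisors t, and its order is the product of t. Each density is thus a
question about how many such chains of product at most X are types of
realizable groups.

Many groups are realizable: if M is abelian, the units of the square-zero
extension of the integers by M form C_2 x M (realizable_dprod_card2). A group
has such a factor C_2 exactly when some invariant factor is 2 modulo 4.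

Few others are. If there is no such factor, every involution of G is a square;
let then R be a ring with unit group G. Either 1 + 1 = 0 in R, or -1 = a ^ 2 for
a unit a. In the latter case let g be a unit of odd order m, and y = a h with
h ^ 2 = g, so that y ^ 2m = -1. The sum 1 + y + ... + y ^ 2m is a unit, hence of
finite order; but at a complex number z with z ^ 2m = -1 the same sum has
absolute value 1 only if z ^ 2 = -1. Eliminating, an integer multiple of
y ^ 2 + 1 = 1 - g vanishes (geometric_sum_torsion): g - 1 is additively torsion.
So the ideal spanned by those g - 1 is finite, and its structure as a finite
commutative ring gives |G| = d * (q_1 - 1) ... (q_r - 1) with prime powers q_i,
where d is a power of 2 times the order of a module over the Gaussian integers;
such an order has even valuation at the primes that are 3 modulo 4
(realizable_unit_order).

Numbers of this form have density 0 (negligible_unit_order). Those d are as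
rare as sums of two squares, X / sqrt (log X) of them. A factor q - 1 with q
odd costs only a power of log log X, and r such factors make the number
divisible by 2 ^ r, so that r may be taken bounded. The factors with q even are
Mersenne numbers, whose products have a convergent sum of reciprocals.

For cyclic groups, what remains is the condition n = 2 modulo 4, whence 1/4.
For all abelian groups, G |-> C_2 x G is a bijection from the types of product
at most X / 2 to the types with an invariant factor 2 modulo 4 of product at
most X (add_two), whence 1/2. For a 2-group, having no invariant factor equal
to 2 is rare, because almost all types have many distinct parts
(sum_distinct_parts). For odd p, the order of a realizable p-group is a product
of numbers 2 ^ k - 1, which forces exponent p (odd_realizable_pgroup); hence
also the realizable indecomposable groups have order 2 ^ k or 2 ^ k - 1, which
is a logarithmic number of orders against the primes supplied by Chebyshev
(cnt_prime_lower). *)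

(** * Unit groups and finite ideals *)

(** The group of units lives in an arbitrary ring, where nothing is finite; this
transports a finitely generated torsion subgroup to a finite group, for which
counting, Cauchy and Lagrange are available. *)
Lemma fin_span (A : zmodType) (J : finType) (w : J -> A) (c : nat) :
  (0 < c)%N -> (forall j, w j *+ c = 0) ->
  exists (hT : finGroupType) (b : hT -> A),
    [/\ injective b, forall x y, b (x * y)%g = b x + b y &
        forall u, (exists x, b x = u) <->
          exists a : J -> nat, u = \sum_j w j *+ a j].
Proof.
move=> c0 cw.
pose s := undup (codom (fun a : {ffun J -> 'I_c} => \sum_j w j *+ nat_of_ord (a j))).
have sP u : u \in s <-> exists a : J -> nat, u = \sum_j w j *+ a j.
  rewrite mem_undup; split=> [/codomP[a ->]|[a ->]]; first by exists (fun j => nat_of_ord (a j)).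
  apply/codomP; exists [ffun j => Ordinal (ltn_pmod (a j) c0)].
  apply: eq_bigr => j _; rewrite ffunE /= {1}(divn_eq (a j) c) mulrnDr.
  by rewrite mulnC mulrnA cw mul0rn add0r.
have s0 : 0 \in s.
  by apply/sP; exists (fun=> 0%N); rewrite big1 // => j _; rewrite mulr0n.
have sD u v : u \in s -> v \in s -> u + v \in s.
  move=> /sP[a ->] /sP[d ->]; apply/sP; exists (fun j => (a j + d j)%N).
  by rewrite -big_split; apply: eq_bigr => j _; rewrite mulrnDr.
have sN u : u \in s -> - u \in s.
  move=> /sP[a ->]; apply/sP; exists (fun j => (a j * c.-1)%N).
  rewrite -sumrN; apply: eq_bigr => j _; apply/eqP.
  by rewrite eq_sym -subr_eq0 opprK -mulrnDr -mulnSr prednK // mulnC mulrnA cw mul0rn.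
pose mul (x y : seq_sub s) := SeqSub (sD _ _ (ssvalP x) (ssvalP y)).
pose one := SeqSub s0.
pose inv (x : seq_sub s) := SeqSub (sN _ (ssvalP x)).
have mulA : associative mul by move=> x y z; apply: val_inj; rewrite /= addrA.
have mul1 : left_id one mul by move=> x; apply: val_inj; rewrite /= add0r.
have mulV : left_inverse one inv mul by move=> x; apply: val_inj; rewrite /= addNr.
pose hT : finGroupType :=
  HB.pack (seq_sub s) (Finite_isGroup.Build (seq_sub s) mulA mul1 mulV).
exists hT, (fun x : hT => ssval x); split=> //; first exact: val_inj.
move=> u; split=> [[x <-]|/sP us]; first exact/sP/ssvalP.
by exists (SeqSub us).
Qed.

Definition prime_power (q : nat) : bool := ((1 < q) && (pdiv q).-nat q)%N.

Lemma pgroup_prime_power (p q : nat) : prime p -> (1 < q)%N -> (p.-nat q)%N -> prime_power q.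
Proof.
move=> pp q1 pq; rewrite /prime_power q1 /=.
have pdp : pdiv q = p.
  by apply/eqP; have := pnatPpi pq (_ : pdiv q \in \pi(q)); rewrite pi_pdiv q1; apply.
by rewrite pdp.
Qed.

(** In the binomial expansion each term has a high power of x or of y. *)
Lemma commr_nilpotentD (A : pzRingType) (x y : A) (m n : nat) :
  GRing.comm x y -> x ^+ m.+1 = 0 -> y ^+ n.+1 = 0 -> (x + y) ^+ (m + n).+1 = 0.
Proof.
move=> cxy x0 y0; rewrite exprDn_comm // big1 // => i _.
have [ni|ni] := ltnP n i.
  by rewrite -(subnKC ni) exprD y0 mul0r mulr0 mul0rn.
have -> : ((m + n).+1 - i = m.+1 + (n - i))%N by lia.
by rewrite exprD x0 !mul0r mul0rn.
Qed.

Section UnitGroup.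
Variables (A : pzRingType) (gT : finGroupType) (G : {group gT}) (f : gT -> A).
Hypothesis cGG : abelian G.
Hypothesis fI : {in G &, injective f}.
Hypothesis fM : {in G &, forall x y, f (x * y)%g = f x * f y}.
Hypothesis fU : forall a : A, two_sided_unit a <-> exists2 x, x \in G & f x = a.

Lemma unit_map1 : f 1%g = 1.
Proof.
have /fU[x Gx fx] : two_sided_unit (1 : A) by exists 1; rewrite mulr1.
by rewrite -[LHS]mulr1 -{1}fx -fM ?group1 // mul1g.
Qed.

Lemma unit_mapC : {in G &, forall x y, f x * f y = f y * f x}.
Proof. by move=> x y Gx Gy; rewrite -!fM // (centsP cGG x Gx y Gy). Qed.

Lemma unit_mapX x n : x \in G -> f (x ^+ n)%g = f x ^+ n.
Proof.
move=> Gx; elim: n => [|n IH]; first by rewrite expg0 expr0 unit_map1.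
by rewrite expgS exprS fM ?groupX // IH.
Qed.

Lemma unit_mapV x : x \in G -> f x * f x^-1%g = 1.
Proof. by move=> Gx; rewrite -fM ?groupV // mulgV unit_map1. Qed.

Section StableSubgroups.
Variables (hT : finGroupType) (b : hT -> A).
Hypothesis bI : injective b.
Hypothesis bD : forall x y, b (x * y)%g = b x + b y.
Hypothesis bGC : forall g x, g \in G -> f g * b x = b x * f g.
Hypothesis bM : forall x y, exists z, b z = b x * b y.
Hypothesis bC : forall x y, b x * b y = b y * b x.

(** The image of b is an additive subgroup, closed under products, on which G acts;
the stable subgroups are its ideals. *)
Definition stable (X : {set hT}) :=
  forall x y, x \in X ->
    (forall g, g \in G -> b y = f g * b x -> y \in X) /\
    (forall z, b y = b z * b x -> y \in X).

Lemma add_map1 : b 1%g = 0.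
Proof. by apply: (addrI (b 1%g)); rewrite -bD mulg1 addr0. Qed.

Lemma add_mapV x : b x^-1%g = - b x.
Proof. by apply/eqP; rewrite -addr_eq0 -bD mulVg add_map1. Qed.

Lemma add_mapX x n : b (x ^+ n)%g = b x *+ n.
Proof.
by elim: n => [|n IH]; rewrite ?expg0 ?add_map1 // expgS mulrS bD IH.
Qed.

Lemma add_map_eq0 x : (b x == 0) = (x == 1%g).
Proof. by rewrite -add_map1 (inj_eq bI). Qed.

Lemma subset_group_set (X : {group hT}) (P : pred hT) :
  P 1%g -> {in X &, forall x y, P x -> P y -> P (x * y)%g} ->
  group_set [set x in X | P x].
Proof.
move=> P1 PM; apply/group_setP; split; first by rewrite inE group1.
by move=> x y /setIdP[Xx Px] /setIdP[Xy Py]; rewrite inE groupM //= PM.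
Qed.

Lemma stable_pow (X : {set hT}) x n :
  stable X -> x \in X -> exists2 z, z \in X & b z = b x ^+ n.+1.
Proof.
move=> sX Xx; elim: n => [|n [z Xz bz]]; first by exists x.
have [y by_] := bM x z; exists y; last by rewrite exprS -bz.
exact: (sX z y Xz).2 by_.
Qed.

(** The powers of x repeat, since the ideal is finite; along the period there is
an idempotent. *)
Lemma stable_idempotent (X : {set hT}) x :
  stable X -> x \in X ->
  exists m z, [/\ z \in X, b z = b x ^+ m.+1 & b z * b z = b z].
Proof.
move=> sX Xx.
pose s := [seq b x ^+ i.+1 | i <- iota 0 #|hT|.+1].
have /(uniqPn 0)[i [j []]] : ~~ uniq s.
  apply/negP => us; suff: (size s <= size (codom b))%N.
    by rewrite size_map size_iota size_codom ltnn.
  apply: uniq_leq_size us _ => _ /mapP[i _ ->].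
  by have [z _ <-] := stable_pow i sX Xx; exact: codom_f.
rewrite size_map size_iota => ij jn.
rewrite !(nth_map 0%N) ?size_iota ?(ltn_trans ij) // !nth_iota ?(ltn_trans ij) //.
rewrite !add0n => E.
pose k := (j - i)%N; have k0 : (0 < k)%N by rewrite subn_gt0.
have per t r : b x ^+ (i.+1 + r + k * t) = b x ^+ (i.+1 + r).
  elim: t => [|t IH]; first by rewrite muln0 addn0.
  rewrite mulnS addnCA addnA -[in RHS]IH.
  have -> : (k + (i.+1 + r) + k * t = j.+1 + (r + k * t))%N.
    by rewrite !addnA addnS subnK // ltnW.
  by rewrite exprD -E -exprD addnA.
(* m + 1 is a multiple of the period k, beyond the preperiod i. *)
pose m := (i.+1 * k).-1.
have mE : m.+1 = (i.+1 * k)%N by rewrite prednK // muln_gt0 k0.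
have [z Xz bz] := stable_pow m sX Xx; exists m, z; split=> //.
rewrite bz -exprD mE.
have im : (i.+1 <= i.+1 * k)%N by rewrite leq_pmulr.
by rewrite -{1}(subnKC im) [X in (_ + X)%N]mulnC per subnKC.
Qed.

Definition cong_units (X : {set hT}) :=
  [set g in G | [exists x in X, f g == 1 + b x]].

Lemma cong_unitsP (X : {set hT}) g :
  reflect (g \in G /\ exists2 x, x \in X & f g = 1 + b x) (g \in cong_units X).
Proof.
rewrite inE; apply: (iffP andP) => -[Gg].
  by move=> /exists_inP[x Xx /eqP]; split=> //; exists x.
by case=> x Xx E; split=> //; apply/exists_inP; exists x => //; apply/eqP.
Qed.

Lemma cong_units_group_set (X : {group hT}) : stable X -> group_set (cong_units X).
Proof.
move=> sX; apply/group_setP; split.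
  by apply/cong_unitsP; split=> //; exists 1%g; rewrite ?group1 // unit_map1 add_map1 addr0.
move=> g h /cong_unitsP[Gg [x Xx fg]] /cong_unitsP[Gh [y Xy fh]].
apply/cong_unitsP; split; first by rewrite groupM.
have [z bz] := bM x y; exists (x * y * z)%g.
  by rewrite !groupM // ((sX y z Xy).2 x bz).
by rewrite fM // fg fh !bD bz mulrDl !mulrDr !mul1r mulr1 !addrA (addrAC 1).
Qed.

(** An inverse anywhere in the ring will do: membership in the group only asks
for the unit itself to lie in 1 + X. *)
Lemma cong_units_mem (X : {set hT}) x w : x \in X ->
  (1 + b x) * w = 1 -> w * (1 + b x) = 1 ->
  exists2 g, g \in cong_units X & f g = 1 + b x.
Proof.
move=> Xx xw wx; have /fU[g Gg fg] : two_sided_unit (1 + b x) by exists w.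
by exists g => //; apply/cong_unitsP; split=> //; exists x.
Qed.

Section Decomposition.
Variable Q : nat -> Prop.
Hypothesis QM : forall m n, Q m -> Q n -> Q (m * n)%N.
Hypothesis QX : forall X : {group hT}, stable X -> Q #|X|.

(** Q is the property of the orders of ideals that is tracked; the last clause
bounds the exponent of K, as it would be for a product of a group of order d and
of cyclic groups of orders q - 1. *)
Definition unit_structure (K : {set gT}) := exists (d : nat) (qs : seq nat),
  [/\ #|K| = (d * \prod_(q <- qs) q.-1)%N, Q d, all prime_power qs &
      forall e, (d %| e)%N -> all (fun q => q.-1 %| e)%N qs ->
        forall g, g \in K -> (g ^+ e = 1)%g].

(** If X is nil then 1 + x is invertible for every x in X, by the geometric series. *)
Lemma nil_structure (X : {group hT}) : stable X ->
  (forall x, x \in X -> exists n, b x ^+ n.+1 = 0) ->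
  unit_structure (cong_units X).
Proof.
move=> sX nilX; have KX := cong_units_group_set sX.
have cardK : #|cong_units X| = #|X|.
  have fKX : {in cong_units X, forall g, exists x, x \in X /\ f g = 1 + b x}.
    by move=> g /cong_unitsP[_ [x Xx fg]]; exists x.
  pose k g := odflt 1%g [pick x | (x \in X) && (f g == 1 + b x)].
  have kP g : g \in cong_units X -> k g \in X /\ f g = 1 + b (k g).
    move=> /fKX[x [Xx fg]]; rewrite /k; case: pickP => [y /andP[Xy /eqP]|/(_ x)] //.
    by rewrite Xx fg eqxx.
  rewrite -(card_in_imset (f := k)); last first.
    move=> g h Kg Kh kgh; have [_ fg] := kP g Kg; have [_ fh] := kP h Kh.
    apply: fI; [by case/cong_unitsP: Kg|by case/cong_unitsP: Kh|].
    by rewrite fg fh kgh.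
  congr #|pred_of_set _|; apply/setP => x; apply/imsetP/idP => [[g Kg ->]|Xx].
    by have [] := kP g Kg.
  have [n x0] := nilX x Xx.
  have [w [xw wx]] : exists w, (1 + b x) * w = 1 /\ w * (1 + b x) = 1.
    exists (\sum_(i < n.+1) (- b x) ^+ i).
    have E := subrX1 (- b x) n.+1.
    have cx : GRing.comm (1 + b x) (\sum_(i < n.+1) (- b x) ^+ i).
      apply: commr_sum => i _; apply: commrX; apply: commrN.
      by apply/commr_sym; apply: commrD => //; exact: commr1.
    rewrite -cx; suff -> : (1 + b x) * \sum_(i < n.+1) (- b x) ^+ i = 1 by [].
    apply: oppr_inj; rewrite -mulNr opprD addrC -E exprNn x0 mulr0.
    by rewrite add0r.
  have [g Kg fg] := cong_units_mem Xx xw wx; exists g => //.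
  have [_] := kP g Kg; rewrite fg => /addrI/bI ->; by [].
exists #|X|, [::]; split=> //.
- by rewrite big_nil muln1 cardK.
- exact: QX.
- move=> e de _ g Kg; apply/eqP; rewrite -order_dvdn (dvdn_trans _ de) //.
  by rewrite -cardK (order_dvdG (G := Group KX)).
Qed.

(** X is here a finite local ring with identity e. Its nilpotent elements form the
maximal ideal N, an element outside N is a unit of X, and X / N is a field of
order q; so there are |X| - |N| = |N| (q - 1) units. Replacing 1 - e + y by y
identifies the units of X with those of the ambient ring congruent to 1. *)
Lemma local_structure (X : {group hT}) e : stable X -> e \in X ->
  b e * b e = b e -> e != 1%g -> (forall x, x \in X -> b e * b x = b x) ->
  (forall z, z \in X -> b z * b z = b z -> z = 1%g \/ b z = b e) ->
  unit_structure (cong_units X).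
Proof.
move=> sX Xe ee e1 eX idX; have KX := cong_units_group_set sX.
have be0 : b e != 0 by rewrite add_map_eq0.
have Xe' x : x \in X -> b x * b e = b x by move=> Xx; rewrite bC eX.
pose nil x := `[< exists n, b x ^+ n.+1 = 0 >].
have nilN x : x \in X -> ~~ nil x -> exists m, b x ^+ m.+1 = b e.
  move=> Xx; have [m [z [Xz bz zz]]] := stable_idempotent sX Xx.
  case: (idX z Xz zz) => [z1|ze] nx; last by exists m; rewrite -bz.
  by case/negP: nx; apply/asboolP; exists m; rewrite -bz z1 add_map1.
have nilP x m : b x ^+ m.+1 = b e -> ~~ nil x.
  move=> xe; apply/negP => /asboolP[n x0].
  have eX' k : b e ^+ k.+1 = b e by elim: k => [//|k IH]; rewrite exprS IH.
  case/eqP: be0; rewrite -(eX' n) -xe -exprM mulnC exprM x0 expr0n /=.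
  by [].
have Ngr : group_set [set x in X | nil x].
  apply: subset_group_set.
    by apply/asboolP; exists 0%N; rewrite add_map1 expr1.
  move=> x y Xx Xy /asboolP[m x0] /asboolP[n y0]; apply/asboolP.
  exists (m + n)%N; rewrite bD; apply: commr_nilpotentD x0 y0.
  exact: bC.
pose N := Group Ngr.
have NP x : (x \in N) = (x \in X) && nil x by rewrite inE.
have sNX : N \subset X by apply/fintype.subsetP => x; rewrite NP => /andP[].
have sN : stable N.
  move=> x y; rewrite NP => /andP[Xx /asboolP[n x0]]; split=> [g Gg|z] by_.
    rewrite NP ((sX x y Xx).1 g Gg by_) /=; apply/asboolP; exists n.
    by rewrite by_ exprMn_comm ?x0 ?mulr0 //; exact: bGC.
  rewrite NP ((sX x y Xx).2 z by_) /=; apply/asboolP; exists n.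
  by rewrite by_ exprMn_comm ?x0 ?mulr0 //; exact: bC.
have cardK : #|cong_units X| = #|X :\: N|.
  pose k g := odflt 1%g [pick x | (x \in X) && (f g == 1 + b x)].
  have kP g : g \in cong_units X -> k g \in X /\ f g = 1 + b (k g).
    move=> /cong_unitsP[_ [x Xx fg]]; rewrite /k.
    by case: pickP => [y /andP[Xy /eqP]|/(_ x)] //; rewrite Xx fg eqxx.
  rewrite -(card_in_imset (f := fun g => (e * k g)%g)); last first.
    move=> g h Kg Kh /mulgI kgh; have [_ fg] := kP g Kg; have [_ fh] := kP h Kh.
    apply: fI; [by case/cong_unitsP: Kg|by case/cong_unitsP: Kh|].
    by rewrite fg fh kgh.
  congr #|pred_of_set _|; apply/setP => y; apply/imsetP/idP => [[g Kg ->]|].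
    have [Xx fg] := kP g Kg; set x := k g in Xx fg *.
    have Gg : g \in G by case/cong_unitsP: Kg.
    apply/finset.setDP; split; rewrite ?NP groupM //=; apply/negP => /asboolP[n y0].
    have E : f g * b e = b (e * x)%g by rewrite fg mulrDl mul1r Xe' // bD.
    suff E0 : f g ^+ n.+1 * b e = 0.
      case/eqP: be0; have := unit_mapV (groupVr (groupX n.+1 Gg)).
      by rewrite invgK unit_mapX // => V1; rewrite -[b e]mul1r -V1 -mulrA E0 mulr0.
    rewrite -y0 -E exprMn_comm; last exact: bGC.
    congr (_ * _); elim: (n) => [//|m IH]; by rewrite exprS -IH ee.
  case/finset.setDP => Xy; rewrite NP Xy /= => ny.
  have [m ym] := nilN y Xy ny.
  pose x := (e^-1 * y)%g; have Xx : x \in X by rewrite groupM ?groupV.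
  have bx : 1 + b x = (1 - b e) + b y by rewrite bD add_mapV addrA.
  have pp : (1 - b e) * (1 - b e) = 1 - b e.
    by rewrite mulrBr mulr1 mulrBl mul1r ee subrr subr0.
  have py : (1 - b e) * b y = 0 by rewrite mulrBl mul1r eX // subrr.
  have yp : b y * (1 - b e) = 0 by rewrite mulrBr mulr1 Xe' // subrr.
  have E j : b y ^+ j.+2 = b e -> (1 - b e + b y) * (1 - b e + b y ^+ j.+1) = 1.
    move=> yk; rewrite mulrDl (mulrDr (1 - b e)) (mulrDr (b y)) pp yp -exprS yk.
    by rewrite exprS mulrA py mul0r addr0 add0r subrK.
  have E' j : b y ^+ j.+2 = b e -> (1 - b e + b y ^+ j.+1) * (1 - b e + b y) = 1.
    move=> yk; rewrite mulrDl (mulrDr (1 - b e)) (mulrDr (b y ^+ _)) pp py -exprSr yk.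
    by rewrite exprSr -mulrA yp mulr0 addr0 add0r subrK.
  have ym2 : b y ^+ (m + m).+2 = b e.
    by rewrite -addnS -addSn exprD ym ee.
  have [g Kg fg] : exists2 g, g \in cong_units X & f g = 1 + b x.
    by apply: (cong_units_mem Xx (w := 1 - b e + b y ^+ (m + m).+1));
      rewrite bx ?E ?E'.
  exists g => //; have [_] := kP g Kg; rewrite fg => /addrI/bI <-.
  by rewrite mulKVg.
pose o := #[e]%g; pose l := pdiv o.
have o1 : (1 < o)%N by rewrite order_gt1.
have lp : prime l by rewrite pdiv_prime.
have lo : (l %| o)%N := pdiv_dvd o.
have beo : b e *+ o = 0 by rewrite -add_mapX expg_order add_map1.
(* l e is nilpotent: otherwise a power of it, a multiple of l e, would be e, against
   the order of e being divisible by l. *)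
have [k lk] : exists k, b e *+ (l ^ k) = 0.
  have Xl : (e ^+ l)%g \in X by rewrite groupX.
  have eX' n : b e ^+ n.+1 = b e by elim: n => [//|n IH]; rewrite exprS IH.
  have [/asboolP[n]|/(nilN _ Xl)[n]] := boolP (nil (e ^+ l)%g).
    by rewrite add_mapX exprMn_n eX' => ?; exists n.+1.
  rewrite add_mapX exprMn_n eX' => E; exfalso.
  have : (o %| o %/ l)%N.
    rewrite order_dvdn -add_map_eq0 add_mapX -E -mulrnA expnS mulnAC.
    by rewrite [(l * _)%N]mulnC divnK // mulrnA beo mul0rn.
  move=> /dvdn_leq; rewrite divn_gt0 ?prime_gt0 // dvdn_leq ?(ltnW o1) //.
  by move=> /(_ isT); rewrite leqNgt ltn_Pdiv ?prime_gt1 // ltnW.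
have lX : (l.-group X)%g.
  apply/pgroupP => p pp /(Cauchy pp)[x Xx ox].
  have : (#[x]%g %| l ^ k)%N.
    rewrite order_dvdn -add_map_eq0 add_mapX -(eX x Xx) -mulrnAl lk.
    by rewrite mul0r.
  by rewrite ox Euclid_dvdX // => /andP[]; rewrite dvdn_prime2 // inE.
pose q := #|X : N|%g.
have NqX : (#|N| * q = #|X|)%N by rewrite Lagrange.
have lq : (l.-nat q)%N by apply: pnat_dvd lX; rewrite -NqX dvdn_mull.
have q1 : (1 < q)%N.
  rewrite indexg_gt1; apply/negP => /fintype.subsetP/(_ e Xe); rewrite NP => /andP[_].
  by apply/negP; apply: (nilP e 0%N); rewrite expr1.
have lN : (l.-nat #|N|)%N by apply: pnat_dvd lX; rewrite -NqX dvdn_mulr.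
have cardK' : #|cong_units X| = (#|N| * q.-1)%N.
  rewrite cardK cardsD (finset.setIidPr sNX) -NqX -subn1 mulnBr muln1.
  by [].
exists #|N|, [:: q]; split.
- by rewrite big_cons big_nil muln1.
- exact: QX.
- by rewrite /= andbT (pgroup_prime_power lp).
- move=> n Nn; rewrite /= andbT => qn g Kg; apply/eqP.
  rewrite -order_dvdn; apply: dvdn_trans (order_dvdG (G := Group KX) Kg) _.
  rewrite /= cardK' Gauss_dvd ?Nn ?qn // (pnat_coprime lN) //.
  apply/pnatP; first by rewrite -subn1 subn_gt0.
  move=> p pp pq; apply/negP; rewrite !inE => /eqP pl; move: pq; rewrite pl => pq.
  have [j qj] := p_natP lq; have : (l %| q)%N.
    by rewrite qj; case: j qj q1 => [->|j qj _]; rewrite ?ltnn // expnS dvdn_mulr.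
  rewrite -{1}(prednK (ltnW q1)) -addn1 dvdn_addr // dvdn1 => /eqP l1.
  by rewrite l1 in lp.
Qed.

(** A finite commutative ring is a product of local rings and a nil one: as long
as some idempotent e is not an identity, X splits into e X and (1 - e) X, and the
units split accordingly. *)
Lemma cong_units_structure (X : {group hT}) : stable X -> unit_structure (cong_units X).
Proof.
have [n] := ubnP #|X|; elim: n X => // n IH X; rewrite ltnS => Xn sX.
have [[e [x [Xe [ee [Xx ex]]]]]|noS] := pselect (exists e x,
    e \in X /\ b e * b e = b e /\ x \in X /\ b e * b x <> b x /\ e <> 1%g); last first.
  have idX z : z \in X -> b z * b z = b z -> z <> 1%g -> forall x, x \in X -> b z * b x = b x.
    by move=> Xz zz z1 x Xx; apply: contrapT => zx; apply: noS; exists z, x.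
  have [[e [Xe [ee e1]]]|noE] :=
      pselect (exists e, e \in X /\ b e * b e = b e /\ e <> 1%g).
    apply: (local_structure (e := e)) => //; [exact/eqP|exact: idX|].
    move=> z Xz zz; have [->|/eqP z1] := eqVneq z 1%g; [by left|right].
    by rewrite -(idX e Xe ee e1 z Xz) bC (idX z Xz zz z1 e Xe).
  apply: nil_structure => // x Xx.
  have [m [z [Xz bz zz]]] := stable_idempotent sX Xx; exists m.
  rewrite -bz; have [->|/eqP z1] := eqVneq z 1%g; first exact: add_map1.
  by case: noE; exists z.
case: ex => ex e1.
have gr1 : group_set [set y in X | b e * b y == b y].
  apply: subset_group_set; first by rewrite add_map1 mulr0.
  by move=> y z _ _ /eqP ey /eqP ez; rewrite bD mulrDr ey ez.
have gr2 : group_set [set y in X | b e * b y == 0].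
  apply: subset_group_set; first by rewrite add_map1 mulr0.
  by move=> y z _ _ /eqP ey /eqP ez; rewrite bD mulrDr ey ez addr0.
pose X1 := Group gr1; pose X2 := Group gr2.
have X1P y : (y \in X1) = (y \in X) && (b e * b y == b y) by rewrite inE.
have X2P y : (y \in X2) = (y \in X) && (b e * b y == 0) by rewrite inE.
have eG g y : g \in G -> b e * (f g * b y) = f g * (b e * b y).
  by move=> Gg; rewrite mulrA -bGC // mulrA.
have eM z y : b e * (b z * b y) = b z * (b e * b y).
  by rewrite mulrA (bC e) mulrA.
have sX1 : stable X1.
  move=> y z; rewrite X1P => /andP[Xy /eqP ey]; split=> [g Gg|v] bz.
    by rewrite X1P ((sX y z Xy).1 g Gg bz) bz eG // ey /=.
  by rewrite X1P ((sX y z Xy).2 v bz) bz eM // ey /=.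
have sX2 : stable X2.
  move=> y z; rewrite X2P => /andP[Xy /eqP ey]; split=> [g Gg|v] bz.
    by rewrite X2P ((sX y z Xy).1 g Gg bz) bz eG // ey mulr0 /=.
  by rewrite X2P ((sX y z Xy).2 v bz) bz eM // ey mulr0 /=.
have lt1 : (#|X1| < #|X|)%N.
  apply: proper_card; apply/properP; split.
    by apply/fintype.subsetP => y; rewrite X1P => /andP[].
  by exists x; rewrite // X1P Xx /=; apply/eqP.
have lt2 : (#|X2| < #|X|)%N.
  apply: proper_card; apply/properP; split.
    by apply/fintype.subsetP => y; rewrite X2P => /andP[].
  by exists e; rewrite // X2P Xe /= ee add_map_eq0; apply/eqP.
have [d1 [q1 [E1 Qd1 pp1 ex1]]] := IH X1 (leq_trans lt1 Xn) sX1.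
have [d2 [q2 [E2 Qd2 pp2 ex2]]] := IH X2 (leq_trans lt2 Xn) sX2.
pose K1 := Group (cong_units_group_set sX1).
pose K2 := Group (cong_units_group_set sX2).
pose K := Group (cong_units_group_set sX).
have KE : (K1 * K2)%g = K.
  apply/setP => g; apply/mulsgP/idP => [[h1 h2 K1h K2h ->]|Kg].
    rewrite groupM //.
      case/cong_unitsP: K1h => G1 [y]; rewrite X1P => /andP[Xy _] fy.
      by apply/cong_unitsP; split=> //; exists y.
    case/cong_unitsP: K2h => G2 [y]; rewrite X2P => /andP[Xy _] fy.
    by apply/cong_unitsP; split=> //; exists y.
  have /cong_unitsP[Gg [y Xy fg]] := Kg.
  have /cong_unitsP[Gg' [y' Xy' fg']] := groupVr Kg.
  have split_el z : z \in X -> exists z1 z2, [/\ z1 \in X1, z2 \in X2,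
      b z1 = b e * b z, b z2 = b z - b e * b z & (z1 * z2)%g = z].
    move=> Xz; have [z1 bz1] := bM e z.
    have Xz1 := (sX z z1 Xz).2 e bz1.
    have X1z : z1 \in X1 by rewrite X1P Xz1 bz1 mulrA ee /=.
    exists z1, (z1^-1 * z)%g; split=> //.
    - rewrite X2P groupM ?groupV //= bD add_mapV mulrDr mulrN bz1 mulrA ee.
      by rewrite addNr.
    - by rewrite bD add_mapV bz1 addrC.
    - by rewrite mulKVg.
  have [y1 [y2 [X1y X2y by1 by2 yE]]] := split_el y Xy.
  have [z1 [z2 [X1z X2z bz1 bz2 zE]]] := split_el y' Xy'.
  (* Invertibility of 1 + u is expressed inside the ideal, so that e can be applied. *)
  have circ u u' : 1 + (b u + b u' + b u * b u') = (1 + b u) * (1 + b u').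
    by rewrite mulrDl !mulrDr !mul1r mulr1 !addrA (addrAC 1).
  have yy : b y + b y' + b y * b y' = 0.
    by apply: (addrI 1); rewrite circ -fg -fg' unit_mapV // addr0.
  have inv1 u u' : b u + b u' + b u * b u' = 0 -> (1 + b u) * (1 + b u') = 1.
    by rewrite -circ => ->; rewrite addr0.
  have ey u : b e * (b y * u) = b y * (b e * u) by rewrite mulrA (bC e) mulrA.
  have F1 : b y1 + b z1 + b y1 * b z1 = 0.
    rewrite by1 bz1 -mulrA -ey (mulrA (b e) (b e)) ee -!mulrDr yy.
    by rewrite mulr0.
  pose p := 1 - b e; have pp : p * p = p.
    by rewrite /p mulrBr mulr1 mulrBl mul1r ee subrr subr0.
  have py u : p * (b y * u) = b y * (p * u).
    by rewrite /p !mulrBl !mul1r mulrBr ey.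
  have F2 : b y2 + b z2 + b y2 * b z2 = 0.
    have pE u : b u - b e * b u = p * b u by rewrite /p mulrBl mul1r.
    by rewrite by2 bz2 !pE -mulrA -py (mulrA p p) pp -!mulrDr yy mulr0.
  have F1' : b z1 + b y1 + b z1 * b y1 = 0 by rewrite (addrC (b z1)) (bC z1).
  have F2' : b z2 + b y2 + b z2 * b y2 = 0 by rewrite (addrC (b z2)) (bC z2).
  have [g1 K1g fg1] := cong_units_mem X1y (inv1 _ _ F1) (inv1 _ _ F1').
  have [g2 K2g fg2] := cong_units_mem X2y (inv1 _ _ F2) (inv1 _ _ F2').
  exists g1 g2 => //; have [G1 _] := cong_unitsP _ _ K1g.
  have [G2 _] := cong_unitsP _ _ K2g.
  apply: fI; rewrite ?groupM // fM // fg fg1 fg2 mulrDl !mulrDr !mul1r mulr1.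
  have -> : b y1 * b y2 = 0.
    by rewrite by1 by2 mulrBr -!mulrA -ey (mulrA (b e) (b e)) ee subrr.
  by rewrite addr0 -yE bD -addrA (addrC (b y2)).
have TI : K1 :&: K2 = 1%g.
  apply/trivgP/fintype.subsetP => g /finset.setIP[/cong_unitsP[Gg [y]]].
  rewrite X1P => /andP[Xy /eqP ey] fy /cong_unitsP[_ [z]].
  rewrite X2P fy => /andP[Xz /eqP ez] /addrI yz.
  rewrite inE; apply/eqP/fI; rewrite ?group1 // fy unit_map1 -ey yz ez.
  by rewrite addr0.
exists (d1 * d2)%N, (q1 ++ q2); split.
- have -> : cong_units X = K :> {set gT} by [].
  by rewrite -KE TI_cardMg //= E1 E2 big_cat /= mulnACA.
- exact: QM.
- by rewrite all_cat pp1.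
- move=> k dk; rewrite all_cat => /andP[k1 k2] g Kg.
  have : g \in (K1 * K2)%g by rewrite KE.
  case/mulsgP=> h1 h2 K1h K2h ->; rewrite expgMn; last first.
    have [G1 _] := cong_unitsP _ _ K1h; have [G2 _] := cong_unitsP _ _ K2h.
    exact: (centsP cGG _ G1 _ G2).
  rewrite (ex1 k (dvdn_trans (dvdn_mulr _ (dvdnn _)) dk) k1 _ K1h).
  by rewrite (ex2 k (dvdn_trans (dvdn_mull _ (dvdnn _)) dk) k2 _ K2h) mulg1.
Qed.

End Decomposition.
End StableSubgroups.
(** The ideal to which the analysis applies is spanned by the elements
h (g - 1) with g of odd order. It is killed by c, hence finite, and it contains
g - 1 for every g of odd order; so the units congruent to 1 modulo it contain
the odd part of G. *)
Lemma torsion_structure (Q : nat -> Prop) (c : nat) :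
  (forall m n, Q m -> Q n -> Q (m * n)%N) ->
  (forall (hT : finGroupType) (b : hT -> A) (X : {group hT}),
    injective b -> (forall x y, b (x * y)%g = b x + b y) ->
    (forall g x, g \in G -> x \in X -> exists2 y, y \in X & b y = f g * b x) ->
    Q #|X|) ->
  (0 < c)%N -> (forall g, g \in G -> odd #[g]%g -> (f g - 1) *+ c = 0) ->
  exists K : {group gT}, [/\ K \subset G, (2.-nat #|G : K|%g)%N,
    forall g, g \in G -> odd #[g]%g -> g \in K & unit_structure Q K].
Proof.
move=> QM QX c0 tors.
pose w (j : gT * gT) :=
  if [&& j.1 \in G, j.2 \in G & odd #[j.2]%g] then f j.1 * (f j.2 - 1) else 0.
have wc j : w j *+ c = 0.
  rewrite /w; case: ifP => [/and3P[Gh Gg og]|_]; last by rewrite mul0rn.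
  by rewrite -mulrnAr tors // mulr0.
have wG g j : g \in G -> f g * w j = w ((g * j.1)%g, j.2).
  move=> Gg; rewrite /w /= groupMl //; case: ifP => [/and3P[Gh Gk _]|_].
    by rewrite mulrA fM.
  by rewrite mulr0.
have [hT [b [bI bD bP]]] := fin_span c0 wc.
pose sp u := exists x, b x = u.
have b1 : b 1%g = 0 := add_map1 bD.
have spD u v : sp u -> sp v -> sp (u + v).
  by move=> [x <-] [y <-]; exists (x * y)%g.
have spX u n : sp u -> sp (u *+ n).
  by move=> [x <-]; exists (x ^+ n)%g; rewrite (add_mapX bD).
have spG g u : g \in G -> sp u -> sp (f g * u).
  move=> Gg /bP[a ->]; apply/bP; exists (fun j => a ((g^-1 * j.1)%g, j.2)).
  rewrite mulr_sumr [RHS](reindex_inj (h := fun j : gT * gT => ((g * j.1)%g, j.2))) /=.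
    by apply: eq_bigr => j _; rewrite mulrnAr wG // mulKg -surjective_pairing.
  by move=> [x y] [x' y'] [/mulgI-> ->].
have sp_ind (P : A -> Prop) : P 0 -> (forall u v, P u -> P v -> P (u + v)) ->
    (forall h k, h \in G -> k \in G -> P (f h * (f k - 1))) -> forall x, P (b x).
  move=> P0 PD Pw x; have [a ->] : exists a, b x = \sum_j w j *+ a j by apply/bP; exists x.
  apply: (big_ind P) => // j _; elim: (a j) => [|n IH]; first by rewrite mulr0n.
  rewrite mulrS; apply: PD => //; rewrite /w; case: ifP => // /and3P[Gh Gk _].
  exact: Pw.
have bG g x : g \in G -> exists y, b y = f g * b x.
  by move=> Gg; apply: spG => //; exists x.
have bGC g x : g \in G -> f g * b x = b x * f g.
  move=> Gg; move: x; apply: (sp_ind (fun u => f g * u = u * f g)).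
  - by rewrite mulr0 mul0r.
  - by move=> u v; rewrite mulrDr mulrDl => -> ->.
  - move=> h k Gh Gk; have C := unit_mapC.
    by rewrite mulrA (C g h) // -!mulrA mulrBr mulrBl mulr1 mul1r (C g k).
have bM x y : exists z, b z = b x * b y.
  move: x; apply: (sp_ind (fun u => sp (u * b y))).
  - by exists 1%g; rewrite mul0r.
  - by move=> u v; rewrite mulrDl; exact: spD.
  - move=> h k Gh Gk; rewrite -mulrA mulrBl mul1r; apply: spG => //.
    have [z <-] := bG k y Gk; exists (z * y^-1)%g.
    by rewrite bD (add_mapV bD).
have bC x y : b x * b y = b y * b x.
  move: x; apply: (sp_ind (fun u => u * b y = b y * u)).
  - by rewrite mulr0 mul0r.
  - by move=> u v; rewrite mulrDr mulrDl => -> ->.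
  - move=> h k Gh Gk; rewrite -mulrA mulrBl mul1r bGC // -{2}[b y]mulr1 -mulrBr.
    by rewrite mulrA bGC // -mulrA.
have sT : stable b [set: hT] by move=> x y _; split=> *; rewrite inE.
pose K := Group (cong_units_group_set bD bM (X := [set: hT]%G) sT).
have KP g : g \in G -> odd #[g]%g -> g \in K.
  move=> Gg og; apply/cong_unitsP; split=> //.
  have [x bx] : sp (f g - 1).
    apply/bP; exists (fun j => (j == (1%g, g)) : nat); rewrite (bigD1 (1%g, g)) //=.
    rewrite eqxx mulr1n /w /= group1 Gg og unit_map1 mul1r big1 ?addr0 // => j /negbTE->.
    by rewrite mulr0n.
  by exists x => //; rewrite bx addrC subrK.
have sKG : K \subset G by apply/fintype.subsetP => g /cong_unitsP[].
exists K; split=> //.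
- have hallH := nilpotent_pcore_Hall 2%N^' (abelian_nil cGG).
  have sHK : pcore 2%N^' G \subset K.
    apply/fintype.subsetP => g Hg; apply: KP; first exact: (fintype.subsetP (pcore_sub _ _) g Hg).
    have := mem_p_elt (pcore_pgroup 2%N^' G) Hg.
    by rewrite /p_elt p'natE // dvdn2 negbK.
  have /and3P[_ _] := hallH; rewrite pnatNK; apply: pnat_dvd.
  by rewrite -(Lagrange_index sKG sHK) dvdn_mulr.
- apply: (cong_units_structure bI bD bGC bM bC QM _ (X := [set: hT]%G) sT).
  move=> X sX; apply: (QX hT b X bI bD) => g x Gg Xx.
  by have [y by_] := bG g x Gg; exists y => //; exact: (sX x y Xx).1 g Gg by_.
Qed.
End UnitGroup.
(** * Units made of geometric sums *)

Section GeometricSum.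
Variables (R : comNzRingType) (m : nat).

Definition geometric_sum : {poly R} := \sum_(i < (m + m).+1) 'X^i.

Lemma geometric_sumP : ('X - 1) * geometric_sum = 'X^((m + m).+1) - 1.
Proof. by rewrite -subrX1. Qed.

(** For m odd, -1 is a zero of X ^ m + 1. *)
Lemma odd_cofactor : odd m ->
  'X^(m + m) + 1 = ('X^2 + 1) * \sum_(i < m) (- 'X^2) ^+ i :> {poly R}.
Proof.
move=> om; apply: oppr_inj; rewrite -mulNr [- ('X^2 + 1)]opprD -subrX1 exprNn -signr_odd om expr1.
by rewrite mulN1r -exprM mul2n -addnn opprD.
Qed.
End GeometricSum.

(** Modulo X ^ 2m + 1 the sum 1 + X + ... + X ^ 2m is inverse to the one at -X:
with x ^ 2m = -1 these are (x ^ (2m + 1) - 1) / (x - 1) = (x + 1) / (1 - x) and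
its image under x |-> -x. *)
Lemma geometric_sum_unit (R : idomainType) (m : nat) :
  geometric_sum R m * (geometric_sum R m \Po (- 'X)) =
    1 + 'X^2 * ('X^(m + m) + 1) * \sum_(i < m) ('X^2) ^+ i.
Proof.
have n0 : ('X^2 - 1 : {poly R}) != 0 by rewrite monic_neq0 // monicXnsubC.
apply: (mulfI n0); rewrite mulrDr mulr1.
have -> : ('X^2 - 1) * ('X^2 * ('X^(m + m) + 1) * \sum_(i < m) 'X^2 ^+ i) =
   'X^2 * ('X^(m + m) + 1) * ('X^(m + m) - 1) :> {poly R}.
  have -> : 'X^(m + m) - 1 = 'X^2 ^+ m - 1 :> {poly R} by rewrite -exprM mul2n addnn.
  by rewrite [RHS](_ : _ = 'X^2 * ('X^(m + m) + 1) * (('X^2 - 1) * \sum_(i < m) 'X^2 ^+ i)); [ring|rewrite subrX1].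
have E1 := geometric_sumP R m.
have E2 : (- 'X - 1) * (geometric_sum R m \Po (- 'X)) = - 'X^((m + m).+1) - 1.
  have /(congr1 (fun p => p \Po (- 'X))) := E1.
  rewrite comp_polyM !comp_polyB comp_polyX comp_polyC comp_Xn_poly => ->.
  by rewrite exprNn -signr_odd /= oddD addbb /= expr1 mulN1r.
have -> : ('X^2 - 1) * (geometric_sum R m * (geometric_sum R m \Po - 'X)) =
   - (('X - 1) * geometric_sum R m) * ((- 'X - 1) * (geometric_sum R m \Po - 'X)).
  by ring.
rewrite E1 E2 exprS; ring.
Qed.

(** Over the rationals, X ^ 2 + 1 is the part of X ^ 2m + 1 on which the unit
above can have finite order. Indeed at a complex zero z of X ^ 2m + 1 the unit is
(1 + z) / (1 - z); if its absolute value is 1 then z is equidistant from 1 and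
-1, so z is purely imaginary, of absolute value 1, and z ^ 2 = -1. As X ^ 2 + 1
is a simple factor, the cofactor C is coprime to the n-th power of the unit
minus 1, and denominators in the Bezout relation are cleared. *)
Lemma geometric_sum_torsion (m n : nat) : odd m -> (0 < n)%N ->
  exists (c : int) (u v : {poly int}), c != 0 /\
    c *: ('X^2 + 1) = u * (geometric_sum int m ^+ n - 1) + v * ('X^(m + m) + 1).
Proof.
move=> om n0.
pose P : {poly rat} := geometric_sum rat m ^+ n - 1.
pose C : {poly rat} := \sum_(i < m) (- 'X^2) ^+ i.
have cop : coprimep P C.
  rewrite -(coprimep_map (ratr : {rmorphism rat -> algC})).
  apply: Pdiv.ClosedField.root_coprimep => z /rootP Pz.
  have tz : (z - 1) * (map_poly ratr (geometric_sum rat m)).[z] = z ^+ (m + m).+1 - 1.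
    have /(congr1 (fun p => (map_poly (ratr : rat -> algC) p).[z])) := geometric_sumP rat m.
    by rewrite !(rmorphM, rmorphB, rmorphXn, rmorph1) /= map_polyX !hornerE.
  apply/eqP => Cz.
  have z2m : z ^+ (m + m) + 1 = 0.
    have /(congr1 (fun p => (map_poly (ratr : rat -> algC) p).[z])) := odd_cofactor rat om.
    by rewrite rmorphM /= hornerM Cz mulr0 rmorphD /= map_polyXn rmorph1 !hornerE.
  have z2mE : z ^+ (m + m) = -1 by apply/eqP; rewrite -addr_eq0 z2m.
  have tn : (map_poly ratr (geometric_sum rat m)).[z] ^+ n = 1.
    by apply/eqP; rewrite -subr_eq0 -[X in _ == X]Pz rmorphB rmorphXn rmorph1 /= !hornerE.
  have m0 : (0 < m + m)%N by rewrite addn_gt0 (odd_gt0 om).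
  have nt : `|(map_poly ratr (geometric_sum rat m)).[z]| = 1.
    by apply/eqP; rewrite -(pexpr_eq1 (n:=n)) -?normrX ?tn ?normr1.
  have nz : `|z| = 1.
    by apply/eqP; rewrite -(pexpr_eq1 (n:=m + m)) -?normrX ?z2mE ?normrN ?normr1.
  have nn : `|z - 1| = `|z + 1|.
    have <- : `|(z - 1) * (map_poly ratr (geometric_sum rat m)).[z]| = `|z - 1|.
      by rewrite normrM nt mulr1.
    by rewrite tz exprSr z2mE mulN1r -opprD normrN.
  have zz : z * z^* = 1 by rewrite -normCK nz expr1n.
  have zs : z + z^* = 0.
    have : `|z - 1| ^+ 2 = `|z + 1| ^+ 2 by rewrite nn.
    rewrite !normCK rmorphB rmorphD rmorph1 mulrBl !mulrBr !mulrDl !mulrDr zz !mulr1 !mul1r.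
    move=> E; have : (z + z^*) *+ 2 = (1 + z + (z^* + 1)) - (1 - z - (z^* - 1)) by ring.
    rewrite E subrr.
    by move/eqP; rewrite mulrn_eq0 /= => /eqP.
  have z2 : z ^+ 2 = -1.
    by move/eqP: zs; rewrite addr_eq0 => /eqP E; rewrite expr2 {2}E mulrN zz.
  move: Cz; rewrite rmorph_sum /= horner_sum.
  under eq_bigr => i _ do rewrite rmorphXn rmorphN /= map_polyXn hornerE hornerN hornerXn z2 opprK expr1n.
  rewrite sumr_const card_ord => /eqP; rewrite pnatr_eq0.
  by move/eqP=> m00; rewrite m00 in om.
have [[u v] /= /eqpP[[a1 a2] /= /andP[a10 a20] E]] := Bezout_coprimepP _ _ cop.
pose k := (a2^-1 * a1)%:P : {poly rat}.
have kE : k * (u * P + v * C) = 1.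
  by rewrite /k mul_polyC -scalerA E scalerA mulVf // scale1r.
have [u' [a a0 uE]] := rat_poly_scale (k * u * ('X^2 + 1)).
have [v' [d d0 vE]] := rat_poly_scale (k * v).
exists (a * d), (d%:P * u'), (a%:P * v'); split; first by rewrite mulf_neq0.
apply: (map_inj_poly (f := intr : int -> rat)) => //; first exact: intr_inj.
have mapc c (p : {poly int}) : map_poly intr (c%:P * p) = c%:~R%:P * map_poly intr p :> {poly rat}.
  by rewrite rmorphM /= map_polyC.
have mapt : map_poly intr (geometric_sum int m) = geometric_sum rat m.
  by rewrite rmorph_sum /=; apply: eq_bigr => i _; rewrite map_polyXn.
have mapP : map_poly intr (geometric_sum int m ^+ n - 1) = P.
  by rewrite rmorphB rmorphXn rmorph1 /= mapt.
have mapX j : map_poly intr ('X^j + 1) = 'X^j + 1 :> {poly rat}.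
  by rewrite rmorphD rmorph1 /= map_polyXn.
have mapM (p q : {poly int}) :
    map_poly intr (p * q) = map_poly intr p * map_poly intr q :> {poly rat}.
  exact: rmorphM.
rewrite -mul_polyC [RHS]rmorphD /= !mapM !mapX mapP !map_polyC /=.
have U' : map_poly intr u' = a%:~R%:P * (k * u * ('X^2 + 1)) :> {poly rat}.
  by rewrite uE mul_polyC scalerA mulfV ?intr_eq0 // scale1r.
have V' : map_poly intr v' = d%:~R%:P * (k * v) :> {poly rat}.
  by rewrite vE mul_polyC scalerA mulfV ?intr_eq0 // scale1r.
rewrite U' V' (odd_cofactor rat om) -/C intrM polyCM -[LHS]mulr1 -kE.
by ring.
Qed.

(** * Modules over the Gaussian integers *)

(** J is a square root of inversion, and no element but 1 is its own inverse; so
every orbit of J other than that of 1 has four elements. *)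
Lemma card_quarter_turn (hT : finGroupType) (X : {set hT}) (J : hT -> hT) :
  1%g \in X -> {in X, forall x, J x \in X} -> {in X, forall x, J (J x) = x^-1%g} ->
  {in X, forall x, x^-1%g = x -> x = 1%g} -> #|X| = 1 %[mod 4].
Proof.
move=> X1 JX JJ X2.
pose J' x := if x \in X then J x else x.
have J'X x : x \in X -> J' x = J x by rewrite /J' => ->.
have VX x : x \in X -> x^-1%g \in X by move=> Xx; rewrite -JJ // !JX.
have J4 x : x \in X -> J (J (J (J x))) = x.
  by move=> Xx; rewrite !JJ ?VX ?JX // invgK.
have injJ : injective J'.
  move=> x y; rewrite /J'; case: ifP => Xx; case: ifP => Xy // E.
  - by rewrite -(J4 x Xx) E J4.
  - by rewrite -E JX in Xy.
  - by rewrite E JX in Xx.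
have J11 : J 1%g = 1%g.
  by apply: X2; [rewrite JX|rewrite -JJ ?JX // (JJ 1%g X1) invg1].
have Jne x : x \in X -> x != 1%g -> J x != 1%g.
  by move=> Xx; apply: contraNneq => E; rewrite -(J4 x Xx) E !J11.
have ord4 x : x \in X -> x != 1%g -> fingraph.order J' x = 4.
  move=> Xx x1.
  have cyc : fcycle J' [:: x; J x; J (J x); J (J (J x))].
    by rewrite /= !J'X ?JX // !eqxx J4 // eqxx.
  have uc : uniq [:: x; J x; J (J x); J (J (J x))].
    have Vx y : y \in X -> y != 1%g -> y^-1%g != y.
      by move=> Xy; apply: contraNneq => /X2->.
    have Jx y : y \in X -> y != 1%g -> J y != y.
      by move=> Xy y1; apply: contraNneq (Vx y Xy y1) => E; rewrite -(JJ y Xy) !E.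
    have d1 y : y \in X -> y != 1%g -> (y == J y) = false.
      by move=> Xy y1; rewrite eq_sym; apply/negbTE/Jx.
    have d2 y : y \in X -> y != 1%g -> (y == J (J y)) = false.
      by move=> Xy y1; rewrite eq_sym (JJ y Xy); apply/negbTE/Vx.
    have d3 y : y \in X -> y != 1%g -> (y == J (J (J y))) = false.
      move=> Xy y1; apply/negbTE; apply: contraNneq (Jx y Xy y1) => E.
      by rewrite {1}E J4.
    by rewrite /= !inE !negb_or d1 // d2 // d3 // !(d1 (J _)) ?(d2 (J _)) ?(d1 (J (J _))) ?JX ?Jne ?JX.
  by rewrite (order_cycle cyc uc) // inE eqxx.
have cl : fclosed J' (X :\ 1%g).
  apply: (intro_closed (fconnect_sym injJ)) => x _ /eqP<-.
  by rewrite !inE => /andP[x1 Xx]; rewrite J'X // Jne // JX.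
have sub4 : X :\ 1%g \subset order_set J' 4.
  by apply/fintype.subsetP => x; rewrite !inE => /andP[x1 Xx]; rewrite ord4.
have := fcard_order_set injJ sub4 cl.
rewrite (cardsD1 1%g X) X1 => <-.
by rewrite addnC modnMDl.
Qed.

(** The p-part of X is p ^ v, and by the count above it is 1 modulo 4, while p is
-1 modulo 4. *)
Lemma even_logn_quarter_turn (hT : finGroupType) (X : {group hT}) (J : hT -> hT) p :
  abelian X -> {in X, forall x, J x \in X} -> {in X, forall x, J (J x) = x^-1%g} ->
  {in X &, {morph J : x y / (x * y)%g}} ->
  prime p -> (p %% 4 = 3)%N -> ~~ odd (logn p #|X|).
Proof.
move=> cXX JX JJ JM pp p3.
have J1 : J 1%g = 1%g by apply: (mulgI (J 1%g)); rewrite -JM ?group1 // !mulg1.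
have JXn x n : x \in X -> J (x ^+ n)%g = (J x ^+ n)%g.
  move=> Xx; elim: n => [|n IH]; first by rewrite !expg0 J1.
  by rewrite !expgS JM ?groupX // IH.
have hallP := nilpotent_pcore_Hall p (abelian_nil cXX).
have memP x : x \in X -> (x \in pcore p X) = (p.-elt x)%g.
  by move=> Xx; exact: (mem_normal_Hall hallP (pcore_normal _ _)).
have sPX : pcore p X \subset X := pcore_sub _ _.
have : (#|pcore p X| = 1 %[mod 4])%N.
  apply: (card_quarter_turn (J := J)) => //.
  - move=> x Px; have Xx := fintype.subsetP sPX x Px.
    rewrite memP ?JX // /p_elt; apply: pnat_dvd (_ : #[J x]%g %| #[x]%g)%N _.
      by rewrite order_dvdn -JXn // expg_order J1.
    by move: (memP x Xx); rewrite Px /p_elt => <-.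
  - by move=> x Px; apply: JJ; apply: (fintype.subsetP sPX).
  - move=> x Px xV; have /p_natP[k ok] : (p.-elt x)%g.
      by rewrite -memP // (fintype.subsetP sPX).
    have x2 : (#[x]%g %| 2)%N by rewrite order_dvdn expgS expg1 -{1}xV mulVg.
    case: k ok => [|k] ok; first by apply/eqP; rewrite -order_eq1 ok.
    have /dvdn_leq : (p %| 2)%N.
      by apply: dvdn_trans x2; rewrite ok expnS dvdn_mulr.
    by move=> /(_ isT) p2; move: p3; rewrite modn_small ?(leq_ltn_trans p2) // => p3; rewrite p3 in p2.
rewrite (card_Hall hallP) p_part => E; apply/negP => od.
move: E; rewrite -modnXm p3 -(odd_double_half (logn p #|X|)) od expnD -mul2n expnM expn1.
by rewrite -modnMmr -modnXm /= exp1n.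
Qed.

(** * Orders of realizable groups *)

Definition even_valuation_3mod4 (d : nat) : Prop :=
  (0 < d)%N /\ forall p, prime p -> (p %% 4 = 3)%N -> ~~ odd (logn p d).

(** The only orders that can occur when no factor C_2 splits off. *)
Definition unit_order (n : nat) : Prop :=
  exists (d : nat) (qs : seq nat),
    [/\ n = (d * \prod_(q <- qs) q.-1)%N, even_valuation_3mod4 d & all prime_power qs].

Lemma even_valuationM m n :
  even_valuation_3mod4 m -> even_valuation_3mod4 n -> even_valuation_3mod4 (m * n).
Proof.
move=> [m0 Em] [n0 En]; split; first by rewrite muln_gt0 m0.
by move=> p pp p3; rewrite lognM // oddD (negbTE (Em p pp p3)) (negbTE (En p pp p3)).
Qed.

Lemma even_valuation_2nat n : (2.-nat n)%N -> even_valuation_3mod4 n.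
Proof.
move=> /p_natP[k ->]; split; first by rewrite expn_gt0.
move=> p pp p3; rewrite lognX logn_prime //.
by have [E|_] := eqVneq p 2; [move: p3; rewrite E|rewrite muln0].
Qed.

Section RealizableOrder.
Variables (gT : finGroupType) (G : {group gT}) (A : pzRingType) (f : gT -> A).
Hypothesis cGG : abelian G.
Hypothesis fI : {in G &, injective f}.
Hypothesis fM : {in G &, forall x y, f (x * y)%g = f x * f y}.
Hypothesis fU : forall a : A, two_sided_unit a <-> exists2 x, x \in G & f x = a.

(** In characteristic 2 everything is 2-torsion, so the orders of ideals are powers
of 2. *)
Lemma unit_group_char2 : (1 + 1 = 0 :> A) ->
  exists K : {group gT}, [/\ K \subset G, (2.-nat #|G : K|%g)%N,
    forall g, g \in G -> odd #[g]%g -> g \in K & unit_structure (fun d => 2.-nat d)%N K].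
Proof.
move=> c2; have x2 (x : A) : x *+ 2 = 0 by rewrite -mulr_natl mulr2n c2 mul0r.
apply: (torsion_structure cGG fI fM fU (c := 2)) => //.
  by move=> m n Qm Qn; rewrite pnatM Qm.
move=> hT b X bI bD _; apply/pgroupP => p pp /(Cauchy pp)[x Xx ox].
have : (#[x]%g %| 2)%N by rewrite order_dvdn -(add_map_eq0 bI bD) (add_mapX bD) x2.
by rewrite ox dvdn_prime2 // inE.
Qed.

(** The unit y = a h with h ^ 2 = g satisfies y ^ 2 = -g and y ^ 2m = -1, where m
is the order of g, so that polynomial identities modulo X ^ 2m + 1 can be
evaluated at y. The geometric sum becomes a unit of finite order, and
y ^ 2 + 1 = -(g - 1). *)
Lemma odd_order_torsion (a g : gT) : a \in G -> f a * f a = -1 ->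
  (1 != 0 :> A) -> g \in G -> odd #[g]%g -> exists2 c, (0 < c)%N & (f g - 1) *+ c = 0.
Proof.
move=> Ga faa A0 Gg og.
pose B : nzRingType := HB.pack A (GRing.PzSemiRing_isNonZero.Build A A0).
pose m := #[g]%g; pose h := (g ^+ m.+1./2)%g.
have Gh : h \in G by rewrite groupX.
have hh : (h * h = g)%g.
  by rewrite -expgD addnn even_halfK ?oddS ?og //= expgS expg_order mulg1.
pose y : B := f (a * h)%g.
have yy : y ^+ 2 = - f g.
  rewrite expr2 /y fM // mulrA -(mulrA (f a)) (unit_mapC cGG fM Gh Ga) mulrA faa.
  by rewrite -mulrA -fM // hh mulN1r.
have ym : y ^+ (m + m) = -1.
  rewrite addnn -mul2n exprM yy exprNn -signr_odd og expr1.
  by rewrite -(unit_mapX fM fU _ Gg) expg_order (unit_map1 fM fU) mulr1.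
have cy : commr_rmorph (intr : int -> B) y by move=> k; exact: commr_int.
pose ev : {rmorphism {poly int} -> B} := horner_morph cy.
have evX n : ev ('X^n + 1) = y ^+ n + 1.
  by rewrite rmorphD rmorph1 rmorphXn /= horner_morphX.
have evm : ev ('X^(m + m) + 1) = 0 by rewrite evX ym addNr.
pose t := geometric_sum int m; pose t' := t \Po (- 'X).
have tt' : ev t * ev t' = 1.
  by rewrite -rmorphM geometric_sum_unit rmorphD rmorph1 !rmorphM /= evm mulr0 mul0r addr0.
have t't : ev t' * ev t = 1 by rewrite -rmorphM mulrC rmorphM.
have /fU[k Gk fk] : two_sided_unit (ev t : A) by exists (ev t').
have tN : ev (t ^+ #|G| - 1) = 0.
  rewrite rmorphB rmorph1 rmorphXn /=; apply/eqP; rewrite subr_eq0 -fk.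
  by rewrite -(unit_mapX fM fU _ Gk) expg_cardG // (unit_map1 fM fU).
have [c [u [v [c0 E]]]] := geometric_sum_torsion (m := m) og (cardG_gt0 G).
have /(congr1 ev) := E; rewrite rmorphD !rmorphM /= evm tN !mulr0 addr0.
rewrite -mul_polyC rmorphM /= evX yy horner_morphC => E0.
exists `|c|%N; first by rewrite absz_gt0.
have : (f g - 1) *~ c = 0.
  apply: oppr_inj; rewrite -mulNrz opprB oppr0 addrC -mulrzl.
  exact: E0.
by case: (c) => // n; rewrite NegzE mulrNz => /eqP; rewrite oppr_eq0 => /eqP.
Qed.

(** Multiplication by a, a square root of -1, turns the ideals into modules over
the Gaussian integers. *)
Lemma unit_group_char0 (a : gT) : a \in G -> f a * f a = -1 -> (1 != 0 :> A) ->
  exists K : {group gT}, [/\ K \subset G, (2.-nat #|G : K|%g)%N,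
    forall g, g \in G -> odd #[g]%g -> g \in K & unit_structure even_valuation_3mod4 K].
Proof.
move=> Ga faa A0.
have /choice[cs csP] g : exists c, (0 < c)%N /\
    (g \in G -> odd #[g]%g -> (f g - 1) *+ c = 0).
  have [/andP[Gg og]|N] := boolP ((g \in G) && odd #[g]%g).
    by have [c c0 E] := odd_order_torsion Ga faa A0 Gg og; exists c.
  by exists 1%N; split=> // Gg og; rewrite Gg og in N.
apply: (torsion_structure cGG fI fM fU (c := \prod_g cs g)).
- exact: even_valuationM.
- move=> hT b X bI bD bG; split; first exact: cardG_gt0.
  move=> p pp p3.
  pose J x := odflt 1%g [pick y in X | b y == f a * b x].
  have JP x : x \in X -> J x \in X /\ b (J x) = f a * b x.
    move=> Xx; rewrite /J; case: pickP => [y /andP[Xy /eqP]|N] //.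
    by have [y Xy E] := bG a x Ga Xx; have := N y; rewrite Xy E eqxx.
  apply: (even_logn_quarter_turn (J := J)) pp p3.
  + by apply/centsP => x _ y _; apply: bI; rewrite !bD addrC.
  + by move=> x /JP[].
  + move=> x Xx; have [XJ bJ] := JP x Xx; have [_ bJJ] := JP _ XJ.
    by apply: bI; rewrite (add_mapV bD) bJJ bJ mulrA faa mulN1r.
  + move=> x y Xx Xy; apply: bI; rewrite bD.
    by rewrite (JP _ _).2 ?groupM // (JP _ Xx).2 (JP _ Xy).2 bD mulrDr.
- by rewrite prodn_gt0 // => g; have [] := csP g.
- move=> g Gg og; rewrite (bigD1 g) //= mulrnA (csP g).2 //.
  by rewrite mul0rn.
Qed.
End RealizableOrder.

(** The hypothesis on involutions provides the square root a of -1 unless -1 = 1.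
The part of G outside the units that are congruent to 1 has order a power of 2,
which is absorbed into d. *)
Lemma realizable_unit_order (gT : finGroupType) (G : {group gT}) :
  abelian G -> realizable G ->
  (forall z, z \in G -> (z * z = 1)%g -> exists2 y, y \in G & (y * y = z)%g) ->
  unit_order #|G|.
Proof.
move=> cGG [A [f [fI fM fU]]] sq.
have fin (Q : nat -> Prop) (K : {group gT}) : (forall d, Q d -> even_valuation_3mod4 d) ->
    K \subset G -> (2.-nat #|G : K|%g)%N -> unit_structure Q K -> unit_order #|G|.
  move=> QE sKG GK [d [qs [Kd Qd ppq _]]].
  exists (d * #|G : K|%g)%N, qs; split=> //.
    by rewrite -(Lagrange sKG) Kd mulnAC.
  by apply: even_valuationM; [exact: QE|exact: even_valuation_2nat].
have [c2|/eqP c2] := eqVneq (1 + 1 : A) 0.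
  have [K [sKG GK _ st]] := unit_group_char2 cGG fI fM fU c2.
  by apply: fin sKG GK st; exact: even_valuation_2nat.
have A0 : 1 != 0 :> A by apply/eqP => E; apply: c2; rewrite E addr0.
have /fU[z Gz fz] : two_sided_unit (-1 : A) by exists (-1); rewrite mulrNN mulr1.
have [|a Ga aa] := sq z Gz.
  by apply: fI; rewrite ?groupM ?group1 // fM // fz mulrNN mulr1 (unit_map1 fM fU).
have faa : f a * f a = -1 by rewrite -fM // aa.
have [K [sKG GK _ st]] := unit_group_char0 cGG fI fM fU Ga faa A0.
exact: fin sKG GK st.
Qed.

(** An elementary case of Catalan's equation. For j even, p ^ j + 1 is 2 modulo 4.
For j odd, p ^ 2 = 1 modulo 2 ^ (a + 1), where 2 ^ a is the exact power of 2 in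
p + 1; so p ^ j + 1 is not more divisible by 2 than p + 1. *)
Lemma pow2_succ_odd_pow (p k j : nat) :
  odd p -> (1 < p)%N -> (2 ^ k = (p ^ j).+1)%N -> (j <= 1)%N.
Proof.
move=> op p1 E.
have p2 M : (M %| p.-1 * p.+1)%N -> (p ^ 2 = 1 %[mod M])%N.
  move=> dM; apply/eqP; rewrite eqn_mod_dvd ?expn_gt0 ?(ltnW p1) //.
  by have -> : (p ^ 2 - 1 = p.-1 * p.+1)%N by rewrite -[X in (_ - X)%N](exp1n 2) subn_sqr subn1 addn1.
have dp1 : (2 %| p.-1)%N by rewrite dvdn2 -subn1 oddB ?op // ltnW.
have dp2 : (2 %| p.+1)%N by rewrite dvdn2 /= op.
have pj M r : (M %| p.-1 * p.+1)%N -> (p ^ (r + j./2.*2) = p ^ r %[mod M])%N.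
  move=> dM; rewrite expnD -mul2n expnM -modnMmr -modnXm p2 //.
  by rewrite modnXm exp1n modnMmr muln1.
case oj : (odd j); last first.
  have := pj 4 0%N (dvdn_mul dp1 dp2).
  have -> : (0 + j./2.*2 = j)%N by rewrite -[RHS]odd_double_half oj.
  rewrite expn0 => E4.
  case: k E => [|[|k]] E.
  - by move: E; rewrite expn0 => -[/esym/eqP]; rewrite expn_eq0 => /andP[/eqP p0]; rewrite p0 in p1.
  - move: E; rewrite expn1 => -[/esym E1]; case: j E1 {oj E4 pj} => [//|j].
    by rewrite expnS => /eqP; rewrite muln_eq1 => /andP[/eqP p1']; rewrite p1' in p1.
  - have : (4 %| (p ^ j).+1)%N by rewrite -E !expnS mulnA dvdn_mulr.
    by rewrite -[(p ^ j).+1]addn1 /dvdn -modnDml E4.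
pose a := logn 2 p.+1.
have da : (2 ^ a %| p.+1)%N by rewrite pfactor_dvdnn.
have := pj (2 ^ a.+1)%N 1%N; rewrite expnS => /(_ (dvdn_mul dp1 da)).
have -> : (1 + j./2.*2 = j)%N by rewrite -[RHS]odd_double_half oj.
rewrite expn1 => Ea.
have ka : (k <= a)%N.
  rewrite leqNgt; apply/negP => ak.
  have : (2 ^ a.+1 %| p.+1)%N.
    rewrite -(addn1 p) /dvdn -modnDml expnS -Ea modnDml addn1 -E -expnS.
    exact: dvdn_exp2l.
  by rewrite pfactor_dvdn // ltnn.
have : (p ^ j <= p ^ 1)%N.
  by rewrite expn1 -ltnS -E (leq_trans _ (dvdn_leq _ da)) // leq_exp2l.
by rewrite leq_exp2l.
Qed.

(** Since G has odd order, -1 = 1 and the characteristic is 2. Then d = 1, and each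
q - 1 is a power of p with q a power of 2, hence 1 or p. *)
Lemma odd_realizable_pgroup (p : nat) (gT : finGroupType) (G : {group gT}) :
  prime p -> odd p -> abelian G -> (p.-group G)%g -> realizable G ->
  (forall g, g \in G -> (g ^+ p = 1)%g) /\
  (G :=: 1%g \/ exists k, p.+1 = (2 ^ k)%N).
Proof.
move=> pp op cGG pG [A [f [fI fM fU]]].
have oG : odd #|G|.
  by have /p_natP[n ->] := pG; rewrite oddX op orbT.
have oel g : g \in G -> odd #[g]%g.
  by move=> /order_dvdG/dvdn_odd; apply.
have /fU[z Gz fz] : two_sided_unit (-1 : A) by exists (-1); rewrite mulrNN mulr1.
have zz : (z * z = 1)%g.
  by apply: fI; rewrite ?groupM ?group1 // fM // fz mulrNN mulr1 (unit_map1 fM fU).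
have z1 : z = 1%g.
  have : (#[z]%g %| 2)%N by rewrite order_dvdn expgS expg1 zz.
  rewrite dvdn_divisors // inE => /orP[/eqP o1|]; last first.
    by rewrite inE => /eqP o2; have := oel z Gz; rewrite o2.
  by apply/eqP; rewrite -order_eq1 o1.
have c2 : 1 + 1 = 0 :> A.
  by have := fz; rewrite z1 (unit_map1 fM fU) => {2}->; rewrite subrr.
have [K [sKG _ KP [d [qs [Kd d2 ppq eK]]]]] := unit_group_char2 cGG fI fM fU c2.
have GK : K :=: G.
  by apply/eqP; rewrite finset.eqEsubset sKG; apply/fintype.subsetP => g Gg; apply: KP; rewrite ?oel.
rewrite GK in Kd eK.
have od : odd d by apply: dvdn_odd oG; rewrite Kd dvdn_mulr.
have d1 : d = 1%N by have /p_natP[[|n] dE] := d2; rewrite dE // in od *; rewrite oddX in od.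
have qP q : q \in qs -> q.-1 = 1%N \/ q.-1 = p /\ exists k, p.+1 = (2 ^ k)%N.
  move=> qq; have dq : (q.-1 %| #|G|)%N.
    by rewrite Kd (big_rem q) //= mulnCA dvdn_mulr.
  have /p_natP[j qj] : (p.-nat q.-1)%N := pnat_dvd dq pG.
  have /andP[q1 /p_natP[k qk]] := allP ppq q qq.
  have qS : q = (p ^ j).+1 by rewrite -qj prednK // ltnW.
  have q2 : pdiv q = 2%N.
    apply/eqP; rewrite eqn_leq pdiv_min_dvd // ?dvdn2 ?qS ?oddS ?oddX ?op ?orbT //.
    by rewrite prime_gt1 // pdiv_prime // -qS.
  have E : (2 ^ k = (p ^ j).+1)%N by rewrite -qS -{1}q2 -qk.
  have := pow2_succ_odd_pow op (prime_gt1 pp) E.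
  case: j E qj {qS} => [|[|//]] E qj _; rewrite ?expn0 ?expn1 in E qj; first by left.
  by right; split=> //; exists k.
split.
  move=> g Gg; apply: (eK p) => //; first by rewrite d1 dvd1n.
  by apply/allP => q /qP[->|[-> _]]; rewrite ?dvd1n ?dvdnn.
have [/hasP[q qq qp]|/hasPn N] := boolP (has (fun q => q.-1 == p) qs).
  right; case: (qP q qq) => [q1|[]] //.
  by move: qp; rewrite q1 => /eqP p1; rewrite -p1 in pp.
left; apply/eqP; rewrite trivg_card1 Kd d1 mul1n big1_seq // => q /andP[_ qq].
by case: (qP q qq) => [//|[E _]]; have := N q qq; rewrite E eqxx.
Qed.

(** * Square-zero extensions of the integers *)

Definition square_zero_ext (V : zmodType) : Type := (int * V)%type.

Section SquareZero.
Variable V : zmodType.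
HB.instance Definition _ := GRing.Zmodule.on (square_zero_ext V).

Definition sqz_mul (x y : square_zero_ext V) : square_zero_ext V :=
  (x.1 * y.1, y.2 *~ x.1 + x.2 *~ y.1).
Definition sqz_one : square_zero_ext V := (1, 0).

Fact sqz_mulA : associative sqz_mul.
Proof.
move=> x y z; congr pair; rewrite /= ?mulrA // !mulrzDl !mulrzA addrA.
by rewrite -!mulrzA [z.1 * _]mulrC (mulrC y.1) [x.1 * z.1]mulrC.
Qed.

Fact sqz_mul1 : left_id sqz_one sqz_mul.
Proof. by move=> [n v]; rewrite /sqz_mul /= mul1r mul0rz addr0. Qed.

Fact sqz_mulr1 : right_id sqz_one sqz_mul.
Proof. by move=> [n v]; rewrite /sqz_mul /= mulr1 mul0rz add0r. Qed.

Fact sqz_mulDl : left_distributive sqz_mul +%R.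
Proof.
move=> x y z; congr pair; rewrite /= ?mulrDl // mulrzDr mulrzDl addrACA.
by [].
Qed.

Fact sqz_mulDr : right_distributive sqz_mul +%R.
Proof.
move=> x y z; congr pair; rewrite /= ?mulrDr // mulrzDr mulrzDl addrACA.
by [].
Qed.

HB.instance Definition _ := GRing.Zmodule_isPzRing.Build (square_zero_ext V)
  sqz_mulA sqz_mul1 sqz_mulr1 sqz_mulDl sqz_mulDr.
End SquareZero.
(** The units of the square-zero extension by M are the pairs (s, v) with s = 1 or
s = -1. The group G = Z x M is mapped to them through s g, which says whether g
lies in M, and the component m g of g in M. *)
Lemma realizable_dprod_card2 (gT : finGroupType) (Z M G : {group gT}) :
  (Z \x M)%g = G -> #|Z| = 2%N -> abelian M -> realizable G.
Proof.
move=> dG Z2 cMM; have [z Zz oz] : exists2 z, z \in Z & #[z]%g = 2%N.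
  by have [//||z Zz oz] := @Cauchy _ 2%N Z; [rewrite Z2|exists z].
have [_ ZM cZM tZM] := dprodP dG.
have ZE : Z :=: [set 1%g; z].
  by apply/eqP; rewrite eq_sym eqEcard cards2 Z2 eq_sym -order_gt1 oz andbT finset.subUset !finset.sub1set group1.
have sMG : M \subset G by rewrite -ZM mulG_subr.
have Gz : z \in G by rewrite -ZM (fintype.subsetP (mulG_subl _ _)).
have cGG : abelian G.
  rewrite -ZM abelianM cMM cZM andbT (cyclic_abelian (prime_cyclic _)) ?Z2 //.
have zz : (z * z = 1)%g by rewrite -expg2 -oz expg_order.
have zM : z \notin M.
  apply/negP => Mz; have : z \in (Z :&: M)%g by rewrite inE Zz.
  by rewrite tZM inE => /eqP z1; rewrite z1 order1 in oz.
have zg g : g \in G -> g \notin M -> (z * g)%g \in M.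
  rewrite -ZM => /mulsgP[y x]; rewrite ZE !inE => /orP[] /eqP-> Mx ->.
    by rewrite mul1g Mx.
  by rewrite mulgA zz mul1g.
have gM g : g \in M -> (z * g)%g \notin M by move=> Mg; rewrite groupMr.
pose S := subg_of M.
have addA : associative (fun x y : S => x * y)%g := mulgA.
have addC : commutative (fun x y : S => x * y)%g.
  move=> x y; apply: val_inj; rewrite /= (centsP cMM) //; exact: subgP.
have add0 : left_id (1%g : S) (fun x y : S => x * y)%g := mul1g.
have addN : left_inverse (1%g : S) (fun x => x^-1)%g (fun x y : S => x * y)%g := mulVg.
pose V : zmodType := HB.pack S (GRing.isZmodule.Build S addA addC add0 addN).
pose v (g : gT) : V := subg M g.
have vD g h : g \in M -> h \in M -> v (g * h)%g = v g + v h.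
  by move=> Mg Mh; rewrite /v morphM.
have vI g h : g \in M -> h \in M -> v g = v h -> g = h.
  by move=> Mg Mh /(congr1 (@sgval _ _)); rewrite !subgK.
pose s (g : gT) : int := (-1) ^+ (g \notin M).
pose m (g : gT) := if g \in M then g else (z * g)%g.
have Mm g : g \in G -> m g \in M.
  by move=> Gg; rewrite /m; case: ifP => // /negbT; exact: zg.
have ss g : s g * s g = 1 by rewrite /s -expr2 sqrr_sign.
have cG g h : g \in G -> h \in G -> (g * h = h * g)%g.
  by move=> Gg Gh; exact: (centsP cGG).
have memM g h : g \in G -> h \in G -> ((g * h)%g \in M) = ((g \in M) == (h \in M)).
  move=> Gg Gh; have [Mg|ng] := boolP (g \in M); first by rewrite groupMl.
  have [Mh|nh] := boolP (h \in M); first by rewrite groupMr // (negbTE ng).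
  have -> : (g * h = (z * g) * (z * h))%g.
    by rewrite (cG z g) // -mulgA (mulgA z z) zz mul1g.
  by rewrite groupM ?zg.
have sM g h : g \in G -> h \in G -> s (g * h)%g = s g * s h.
  by move=> Gg Gh; rewrite /s memM // -signr_addb; case: (g \in M); case: (h \in M).
have mM g h : g \in G -> h \in G -> m (g * h)%g = (m g * m h)%g.
  move=> Gg Gh; rewrite /m memM //.
  case: (g \in M); case: (h \in M) => //=; rewrite ?mulgA // ?(cG g z) ?mulgA //.
  by rewrite -(mulgA z g) (cG g z) // !mulgA zz mul1g.
pose f (g : gT) : square_zero_ext V := (s g, v (m g) *~ s g).
have fM : {in G &, forall x y, f (x * y)%g = f x * f y}.
  move=> x y Gx Gy; rewrite /f sM // mM // vD ?Mm //; congr pair.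
  rewrite /= mulrzDl -!mulrzA [s y * s x]mulrC addrC.
  by [].
have f1 : f 1%g = 1.
  by rewrite /f /s /m group1 expr0; congr pair; rewrite /v morph1.
exists (square_zero_ext V), f; split=> //.
- move=> x y Gx Gy [] sxy.
  rewrite sxy => /(congr1 (fun u => u *~ s y)); rewrite -!mulrzA ss => /vI.
  rewrite !Mm // => /(_ isT isT); move: sxy; rewrite /s /m.
  by case: (x \in M); case: (y \in M) => //= _ /mulgI.
- move=> a; split=> [[b [ab _]]|[x Gx <-]]; last first.
    by exists (f x^-1%g); rewrite -!fM ?groupV // mulgV mulVg f1.
  have a1 : a.1 * b.1 = 1 by have := congr1 fst ab.
  have a11 : (a.1 == 1) || (a.1 == -1).
    have : `|a.1|%N == 1%N by move/(congr1 absz): a1; rewrite abszM => /eqP; rewrite muln_eq1 => /andP[].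
    by case: (a.1) => [] [|[|n]].
  have Ma (u : V) : sgval (u : S) \in M by exact: subgP.
  have va (u : V) : v (sgval (u : S)) = u by rewrite /v sgvalK.
  case: a a11 {ab a1} => n u /= /orP[] /eqP ->.
    exists (sgval (u : S)); first by rewrite (fintype.subsetP sMG) // Ma.
    by rewrite /f /s /m Ma /= va.
  exists (z * sgval (- u : S))%g; first by rewrite groupM // (fintype.subsetP sMG) // Ma.
  rewrite /f /s /m (negbTE (gM _ (Ma _))) mulgA zz mul1g va /= expr1.
  by rewrite mulrNz opprK.
Qed.

(** * Types of finite abelian groups *)

(** The condition on the head makes the definition suited to induction; the last
part is allowed to be any number above 1 since head 1 [::] = 1. *)
Fixpoint divisor_chain (t : seq nat) : bool :=
  if t is d :: t' then [&& 1 < d, head 1%N t' %| d & divisor_chain t']%N else true.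

Definition tprod (t : seq nat) : nat := (\prod_(d <- t) d)%N.

Lemma tprod_cons d t : tprod (d :: t) = (d * tprod t)%N.
Proof. by rewrite /tprod big_cons. Qed.

Lemma divisor_chainE t :
  divisor_chain t = all [pred d | 1 < d]%N t && sorted [rel m n | n %| m]%N t.
Proof.
elim: t => //= d [|e t] IH /=; first by rewrite dvd1n !andbT.
move: IH => /= ->.
case: (1 < d)%N => //=; case: (1 < e)%N => //=; rewrite ?andbF //.
by case: (e %| d)%N => //=; rewrite andbF.
Qed.

Lemma divisor_chain_gt1 t d : divisor_chain t -> d \in t -> (1 < d)%N.
Proof. by rewrite divisor_chainE => /andP[/allP/(_ d)]. Qed.

Lemma divisor_chain_dvd_head d t e : divisor_chain (d :: t) -> e \in t -> (e %| d)%N.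
Proof.
elim: t d => // c t IH d /and3P[_ /= cd /[dup] ct /and3P[c1 _ _]].
rewrite inE => /predU1P[->|/(IH c ct) ec] //; exact: dvdn_trans ec cd.
Qed.

Lemma tprod_gt0 t : divisor_chain t -> (0 < tprod t)%N.
Proof.
move=> ct; rewrite /tprod big_seq; apply: prodn_cond_gt0 => d dt.
exact: ltnW (divisor_chain_gt1 ct dt).
Qed.

Lemma dvdn_tprod t d : d \in t -> (d %| tprod t)%N.
Proof. by move=> dt; rewrite /tprod (big_rem d) //= dvdn_mulr. Qed.

Lemma divisor_chain_type (gT : finGroupType) (G : {group gT}) :
  divisor_chain (abelian_type G).
Proof.
by rewrite divisor_chainE abelian_type_gt1 abelian_type_dvdn_sorted.
Qed.

Lemma tprod_type (gT : finGroupType) (G : {group gT}) :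
  abelian G -> tprod (abelian_type G) = #|G|.
Proof.
move=> cGG; have [b defG <-] := abelian_structure cGG.
by rewrite -(bigdprod_card defG) /tprod big_map.
Qed.

(** In a chain, the p-valuations decrease along the list, so the parts with a
valuation above n form an initial segment. *)
Lemma divisor_chain_nth_logn p n t i : divisor_chain t ->
  (n < logn p (nth 1 t i))%N = (i < count [pred d | n < logn p d] t)%N.
Proof.
elim: t i => [|d t IH] i; first by rewrite nth_nil logn1.
move=> ct; have ct' : divisor_chain t by case/and3P: ct.
have [d1 _ _] := and3P ct; have d0 : (0 < d)%N := ltnW d1.
have [nd|dn] := ltnP n (logn p d); rewrite /=.
  by rewrite nd; case: i => [|i] /=; rewrite ?nd //= add1n ltnS IH.
have t0 : count [pred d | n < logn p d]%N t = 0%N.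
  apply/eqP; rewrite -leqn0 leqNgt -has_count; apply/hasPn => e et /=.
  by rewrite -leqNgt (leq_trans _ dn) // dvdn_leq_log // (divisor_chain_dvd_head ct).
rewrite (ltnNge n (logn p d)) dn t0 /=; case: i => [|i] /=; first by rewrite ltnNge dn.
by rewrite IH // t0.
Qed.

(** A part is determined by its valuations, and those are counted by the number of
parts with valuation above each n. *)
Lemma divisor_chain_eq t u : divisor_chain t -> divisor_chain u ->
  (forall p n, count [pred d | n < logn p d]%N t = count [pred d | n < logn p d]%N u) ->
  t = u.
Proof.
move=> ct cu E.
have pos v i : divisor_chain v -> (0 < nth 1 v i)%N.
  move=> cv; have [iv|vi] := ltnP i (size v); last by rewrite nth_default.
  by rewrite ltnW // (divisor_chain_gt1 cv) // mem_nth.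
have nthE i : nth 1%N t i = nth 1%N u i.
  have le v w : divisor_chain v -> divisor_chain w ->
      (forall p n, count [pred d | n < logn p d]%N v = count [pred d | n < logn p d]%N w) ->
      forall p, (logn p (nth 1 v i) <= logn p (nth 1 w i))%N.
    move=> cv cw Evw p; rewrite leqNgt; apply/negP.
    by rewrite divisor_chain_nth_logn // Evw -divisor_chain_nth_logn // ltnn.
  apply: eqn_from_log; rewrite ?pos // => p; apply/eqP.
  by rewrite eqn_leq !le // => q n; rewrite E.
have sz v i : divisor_chain v -> (1 < nth 1 v i)%N = (i < size v)%N.
  move=> cv; have [iv|vi] := ltnP i (size v); last by rewrite nth_default.
  by rewrite (divisor_chain_gt1 cv) // mem_nth.
have szE : size t = size u.
  apply/eqP; rewrite eqn_leq; apply/andP; split; rewrite leqNgt; apply/negP => lt.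
    by have := lt; rewrite -(sz _ _ ct) nthE sz // ltnn.
  by have := lt; rewrite -(sz _ _ cu) -nthE sz // ltnn.
exact: (@eq_from_nth _ 1%N).
Qed.

(** For a decomposition into cyclic groups, the number of parts with p-valuation
above n is an invariant of the group. *)
Lemma abelian_type_cycles (gT : finGroupType) (G : {group gT}) (b : seq gT) :
  abelian G -> (\big[dprod/1]_(x <- b) <[x]>)%g = G ->
  divisor_chain [seq #[x]%g | x <- b] -> abelian_type G = [seq #[x]%g | x <- b].
Proof.
move=> cGG defG cb; have [b' defG' tb'] := abelian_structure cGG.
apply: divisor_chain_eq => //; first exact: divisor_chain_type.
move=> p n; rewrite -tb' !count_map.
exact: etrans (count_logn_dprod_cycle p n defG') (esym (count_logn_dprod_cycle p n defG)).
Qed.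

Lemma exists_abelian_type t : divisor_chain t ->
  exists (gT : finGroupType) (G : {group gT}), abelian G /\ abelian_type G = t.
Proof.
move=> ct; suff [gT [G [b [cGG defG bt]]]] : exists (gT : finGroupType) (G : {group gT})
    (b : seq gT), [/\ abelian G, (\big[dprod/1]_(x <- b) <[x]>)%g = G & [seq #[x]%g | x <- b] = t].
  exists gT, G; split=> //; rewrite (@abelian_type_cycles _ _ b) ?bt //.
have {ct} : all (fun d => 1 < d)%N t.
  by apply/allP => d dt; apply: divisor_chain_gt1 dt.
elim: t => [|d t IH] /=.
  exists 'I_2, 1%G, [::]; rewrite big_nil; split=> //; exact: abelian1.
case/andP=> d1 /IH[hT [H [b [cHH defH bt]]]].
pose gT : finGroupType := ('Z_d * hT)%type.
pose x : gT := pairg1 _ (Zp1 : 'Z_d).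
have ox : #[x]%g = d.
  by rewrite order_injm ?injm_pairg1 ?inE // order_Zp1 Zp_cast.
pose C := <[Zp1 : 'Z_d]>%G.
have defG : (\big[dprod/1]_(y <- x :: map (@pair1g 'Z_d hT) b) <[y]>)%g = finset.setX C H.
  rewrite big_cons big_map -[RHS]setX_dprod; congr (_ \x _)%g.
    by rewrite -morphim_pairg1 morphim_cycle ?inE.
  rewrite -morphim_pair1g -(injm_bigdprod _ _ defH) ?injm_pair1g ?finset.subsetT //.
  by apply: eq_bigr => y _; rewrite morphim_cycle ?inE.
exists gT, [group of finset.setX C H], (x :: map (@pair1g 'Z_d hT) b); split=> //.
  apply/centsP => -[a h] /finset.setXP[Ca Hh] [a' h'] /finset.setXP[Ca' Hh'].
  by congr (_, _); [exact: (centsP (cycle_abelian _) a Ca a' Ca')|exact: (centsP cHH h Hh h' Hh')].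
rewrite /= ox -map_comp; congr (_ :: _); rewrite -bt; apply: eq_map => y /=.
by rewrite order_injm ?injm_pair1g ?inE.
Qed.

(** Only serves to enumerate the finitely many types of bounded product. *)
Fixpoint bounded_words (X n : nat) : seq (seq nat) :=
  if n is n'.+1 then
    [::] :: [seq d :: t | d <- iota 0 X.+1, t <- bounded_words X n']
  else [:: [::]].

Lemma mem_bounded_words X n t :
  (t \in bounded_words X n) = (size t <= n)%N && all (fun d => d <= X)%N t.
Proof.
elim: n t => [|n IH] [|d t] //.
have -> : bounded_words X n.+1 =
    [::] :: [seq d :: t | d <- iota 0 X.+1, t <- bounded_words X n] by [].
rewrite inE orFb.
apply/allpairsPdep/idP => [[e [u [ei uw [-> ->]]]]|/andP[tn]].
  move: uw ei; rewrite IH mem_iota add0n ltnS => /andP[un ua] /= eX.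
  by rewrite /= ltnS un ua eX.
rewrite [all _ _]/= => /andP[dX tX].
exists d, t; split=> //; first by rewrite mem_iota add0n ltnS.
by rewrite IH tX andbT -ltnS.
Qed.

Definition types (X : nat) : seq (seq nat) :=
  undup [seq t <- bounded_words X X | divisor_chain t && (tprod t <= X)%N].

Lemma mem_types X t : (t \in types X) = divisor_chain t && (tprod t <= X)%N.
Proof.
rewrite mem_undup mem_filter; case ct: (divisor_chain t) => //=.
case tX: (tprod t <= X)%N => //=; rewrite mem_bounded_words; apply/andP; split.
  apply: leq_trans tX; elim: t ct => // d t IH /= /and3P[d1 _ ct].
  rewrite tprod_cons; apply: leq_trans (_ : 2 * tprod t <= _)%N; last by rewrite leq_mul2r d1 orbT.
  by rewrite mul2n -addnn -addn1 addnC leq_add ?tprod_gt0 ?IH.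
apply/allP => d dt; apply: leq_trans tX; rewrite dvdn_leq ?tprod_gt0 //.
exact: dvdn_tprod.
Qed.

Lemma types_uniq X : uniq (types X).
Proof. exact: undup_uniq. Qed.

Definition class_type (C : group_class) (t : seq nat) : bool :=
  `[< exists (gT : finGroupType) (G : {group gT}), C gT G /\ abelian_type G = t >].

(** An abelian group is determined by its type, and every chain is a type; so
counting groups up to isomorphism is counting chains. *)
Lemma num_iso_classes_types (R : realType) (C : group_class) (x : R) (X : nat) :
  (forall (gT : finGroupType) (G : {group gT}), C gT G -> abelian G) ->
  (forall n : nat, (n%:R <= x) = (n <= X)%N) ->
  num_iso_classes C x = count (class_type C) (types X).
Proof.
move=> Cab xX; apply: (iso_class_count_unique (num_iso_classesP C x)).
pose L := [seq t <- types X | class_type C t].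
have -> : count (class_type C) (types X) = size L by rewrite size_filter.
have LP i : (i < size L)%N -> nth [::] L i \in types X /\ class_type C (nth [::] L i).
  by move=> iL; have := mem_nth [::] iL; rewrite mem_filter => /andP[].
have pick (i : 'I_(size L)) : exists s : {gT : finGroupType & {group gT}},
    C _ (projT2 s) /\ abelian_type (projT2 s) = nth [::] L i.
  have [_ /asboolP[gT [G GP]]] := LP i (ltn_ord i).
  by exists (existT _ gT G).
have [s sP] := choice pick.
exists (fun i => projT1 (s i)), (fun i => projT2 (s i)); split.
- move=> i; have [Ci Ei] := sP i; split=> //.
  have [] := LP i (ltn_ord i); rewrite mem_types -Ei => /andP[_ tX] _.
  by rewrite xX -tprod_type //; exact: Cab.
- move=> i j /isog_abelian_type; rewrite (sP i).2 (sP j).2 => E.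
  have uL : uniq L by rewrite filter_uniq ?types_uniq.
  by apply/val_inj/eqP; rewrite -(nth_uniq [::] (ltn_ord i) (ltn_ord j) uL) E.
- move=> hT H CH; rewrite xX => HX; have cHH := Cab _ _ CH.
  have HL : abelian_type H \in L.
    rewrite mem_filter mem_types divisor_chain_type tprod_type // HX !andbT.
    by apply/asboolP; exists hT, H.
  have iL : (index (abelian_type H) L < size L)%N by rewrite index_mem.
  exists (Ordinal iL); rewrite eq_abelian_type_isog ?(Cab _ _ (sP _).1) //.
  by rewrite (sP _).2 nth_index.
Qed.

Definition has_exact_two (t : seq nat) : bool := has (fun d => d %% 4 == 2)%N t.

(** The 2-part of a cyclic factor of order 2 modulo 4 is a direct factor C_2. *)
Lemma has_exact_two_realizable (gT : finGroupType) (G : {group gT}) :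
  abelian G -> has_exact_two (abelian_type G) -> realizable G.
Proof.
move=> cGG; have [b defG <-] := abelian_structure cGG.
rewrite /has_exact_two has_map => /hasP[x bx /= /eqP x2].
move: defG; rewrite (perm_big _ (perm_to_rem bx)) big_cons /= => defG.
have [[_ H _ defH] _ _ _] := dprodP defG; rewrite defH in defG.
have nilx : nilpotent <[x]>%g := abelian_nil (cycle_abelian x).
move: defG; rewrite -(nilpotent_pcoreC 2%N nilx) -dprodA => defG.
have [[_ M _ defM] ZM _ _] := dprodP defG; rewrite defM in defG ZM.
apply: realizable_dprod_card2 defG _ _; last first.
  by apply: abelianS cGG; rewrite -ZM mulG_subr.
rewrite (card_Hall (nilpotent_pcore_Hall 2%N nilx)) p_part -[#|<[x]>%g|]/(#[x]%g).
have -> : (#[x]%g = 2 * (#[x]%g %/ 4).*2.+1)%N.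
  by rewrite {1}(divn_eq #[x]%g 4) x2; lia.
by rewrite lognM // logn_prime //= lognE dvdn2 /= odd_double.
Qed.

(** An involution is a product of involutions of the cyclic factors; in a cyclic
group of order divisible by 4 the involution is a square, and in one of odd
order there is none. *)
Lemma involution_square (gT : finGroupType) (b : seq gT) (G : {group gT}) (z : gT) :
  (\big[dprod/1]_(x <- b) <[x]>)%g = G -> ~~ has_exact_two [seq #[x]%g | x <- b] ->
  z \in G -> (z * z = 1)%g -> exists2 y, y \in G & (y * y = z)%g.
Proof.
elim: b G z => [|x b IH] G z.
  rewrite big_nil => <- _; rewrite inE => /eqP-> _.
  by exists 1%g; rewrite ?inE ?mulg1.
rewrite big_cons /= negb_or => defG /andP[x2 b2].
have [[_ H _ defH] HG cHx tHx] := dprodP defG; rewrite defH in defG HG cHx tHx.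
rewrite -HG => /mulsgP[u v xu Hv ->] uv2.
have cuv : commute u v := esym (centsP cHx v Hv u xu).
have uuvv : (u * u * (v * v) = 1)%g by rewrite -uv2 !mulgA -(mulgA u v) -cuv !mulgA.
have uu : (u * u = 1)%g.
  have : (u * u)%g \in (<[x]> :&: H)%g.
    have E : (u * u = (v * v)^-1)%g by apply: (mulIg (v * v)%g); rewrite uuvv mulVg.
    by rewrite inE groupM //= E groupV groupM.
  by rewrite tHx inE => /eqP.
have vv : (v * v = 1)%g by move: uuvv; rewrite uu mul1g.
have [y2 Hy2 E2] := IH H v defH b2 Hv vv.
have [y1 xy1 E1] : exists2 y, y \in <[x]>%g & (y * y = u)%g.
  have /cycleP[a ua] := xu.
  have dxa : (#[x]%g %| a * 2)%N by rewrite order_dvdn muln2 -addnn expgD -ua uu.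
  have [ox|ex] := boolP (odd #[x]%g).
    exists 1%g => //; rewrite mulg1 ua; apply/esym/eqP; rewrite -order_dvdn.
    by rewrite -(@Gauss_dvdl _ _ 2) // coprimen2.
  have x4 : (4 %| #[x]%g)%N by move: x2 ex; lia.
  have a2 : (2 %| a)%N by have := dvdn_trans x4 dxa; lia.
  exists (x ^+ (a %/ 2))%g; first exact: mem_cycle.
  by rewrite -expgD addnn -muln2 divnK.
have cy : commute y1 y2 := esym (centsP cHx y2 Hy2 y1 xy1).
exists (y1 * y2)%g; first by rewrite mem_mulg.
by rewrite -E1 -E2 !mulgA -(mulgA y1 y2) -cy !mulgA.
Qed.

Lemma realizable_has_exact_two (gT : finGroupType) (G : {group gT}) :
  abelian G -> realizable G -> has_exact_two (abelian_type G) \/ unit_order #|G|.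
Proof.
move=> cGG rG; have [|n2] := boolP (has_exact_two (abelian_type G)); [by left|right].
apply: realizable_unit_order => // z Gz zz.
have [b defG bt] := abelian_structure cGG.
by apply: involution_square defG _ Gz zz; rewrite bt.
Qed.

(** * Counting functions and sums of reciprocals *)

(** The number of binary digits, a positive substitute for the logarithm. *)
Definition lg (n : nat) : nat := (trunc_log 2 n).+1.

Lemma ltn_exp_lg n : (n < 2 ^ lg n)%N.
Proof. by rewrite /lg trunc_log_ltn. Qed.

Lemma leq_exp_lg n : (0 < n)%N -> (2 ^ (lg n).-1 <= n)%N.
Proof. by move=> n0; rewrite trunc_logP. Qed.

Lemma lg_leq n m : (0 < m)%N -> (n < 2 ^ m)%N -> (lg n <= m)%N.
Proof.
move=> m0 nm; case: n nm => [|n] nm; first by rewrite /lg trunc_log0.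
by have := leq_ltn_trans (leq_exp_lg (ltn0Sn n)) nm; rewrite ltn_exp2l.
Qed.

Lemma leq_lg m n : (m <= n)%N -> (lg m <= lg n)%N.
Proof. by move=> mn; rewrite lg_leq // (leq_ltn_trans mn) // ltn_exp_lg. Qed.

Lemma lg_mul m n : (lg (m * n) <= lg m + lg n)%N.
Proof.
apply: lg_leq => //; rewrite expnD.
have [->|n0] := posnP n; first by rewrite muln0 muln_gt0 !expn_gt0.
by apply: ltn_mul; rewrite ltn_exp_lg.
Qed.

Lemma lg_block K n : (2 ^ K <= n < 2 ^ K.+1)%N -> lg n = K.+1.
Proof. by move=> H; rewrite /lg (trunc_log_eq _ H). Qed.

Definition cnt (P : pred nat) (X : nat) : nat := (\sum_(1 <= n < X.+1 | P n) 1)%N.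

Lemma cntE P X : cnt P X = count P (iota 1 X).
Proof. by rewrite /cnt -sum1_count /index_iota subn1. Qed.

Lemma cnt_size (P : pred nat) X (s : seq nat) : uniq s ->
  {in s, forall n, P n /\ (0 < n <= X)%N} -> (size s <= cnt P X)%N.
Proof.
move=> us sP; rewrite cntE -size_filter uniq_leq_size // => n /sP[Pn nX].
by rewrite mem_filter Pn mem_iota add1n ltnS.
Qed.

Lemma cnt_le P X : (cnt P X <= X)%N.
Proof. by rewrite cntE (leq_trans (count_size _ _)) // size_iota. Qed.

Lemma leq_cnt P X Y : (X <= Y)%N -> (cnt P X <= cnt P Y)%N.
Proof. by move=> XY; rewrite !cntE -(subnKC XY) iotaD count_cat leq_addr. Qed.

Lemma sub_cnt (P Q : pred nat) X :
  (forall n, (0 < n <= X)%N -> P n -> Q n) -> (cnt P X <= cnt Q X)%N.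
Proof.
move=> PQ; rewrite [cnt P X]cntE -size_filter; apply: cnt_size.
  by rewrite filter_uniq ?iota_uniq.
move=> n; rewrite mem_filter mem_iota add1n ltnS => /andP[Pn nX]; split=> //.
exact: PQ.
Qed.

Lemma cntU (P Q : pred nat) X : (cnt (predU P Q) X <= cnt P X + cnt Q X)%N.
Proof. by rewrite !cntE -count_predUI leq_addr. Qed.

Section Reciprocals.
Variable R : realType.

Definition recip (P : pred nat) (X : nat) : R := \sum_(1 <= n < X.+1 | P n) n%:R^-1.

Lemma recip_ge0 P X : 0 <= recip P X.
Proof. by apply: sumr_ge0 => n _; rewrite invr_ge0. Qed.

Lemma ler_recip P X Y : (X <= Y)%N -> recip P X <= recip P Y.
Proof.
move=> XY; rewrite /recip (@big_cat_nat _ _ _ X.+1 1%N Y.+1) //= lerDl.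
by apply: sumr_ge0 => n _; rewrite invr_ge0.
Qed.

(** Summation by dyadic blocks: on the integers between 2 ^ K and 2 ^ (K + 1) the
reciprocal is at most 2 ^ -K, and lg is the constant K + 1, so the bound on cnt
contributes 2 psi (K + 1). *)
Lemma recip_block (P : pred nat) (psi : nat -> R) K :
  (forall k, 0 <= psi k) ->
  (forall X, (0 < X)%N -> (cnt P X)%:R <= X%:R * psi (lg X)) ->
  recip P (2 ^ K).-1 <= 2 * \sum_(1 <= k < K.+1) psi k.
Proof.
move=> psi0 H; elim: K => [|K IH].
  by rewrite /recip !big_geq // mulr0.
rewrite big_nat_recr //= mulrDr.
have K0 : (0 < 2 ^ K)%N by rewrite expn_gt0.
have KS : (2 ^ K <= 2 ^ K.+1)%N by rewrite leq_exp2l.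
rewrite /recip prednK ?expn_gt0 // (@big_cat_nat _ _ _ (2 ^ K) 1%N) //=.
rewrite -{1}(prednK K0); apply: lerD; first exact: IH.
have le : \sum_(2 ^ K <= n < 2 ^ K.+1 | P n) n%:R^-1 <=
    \sum_(2 ^ K <= n < 2 ^ K.+1 | P n) (2 ^ K)%:R^-1 :> R.
  rewrite big_nat_cond [leRHS]big_nat_cond; apply: ler_sum => n /andP[/andP[n1 _] _].
  by rewrite lef_pV2 ?posrE ?ltr0n ?(leq_trans K0) // ler_nat.
apply: (le_trans le); rewrite big_const_seq iter_addr_0.
have c : (count P (index_iota (2 ^ K) (2 ^ K.+1)) <= cnt P (2 ^ K.+1).-1)%N.
  rewrite cntE -size_filter -[leqRHS]size_filter uniq_leq_size ?filter_uniq ?iota_uniq //.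
  move=> n; rewrite !mem_filter => /andP[-> ]; rewrite mem_index_iota mem_iota => /andP[n1 n2].
  by rewrite add1n prednK ?expn_gt0 // n2 (leq_trans K0).
have X0 : (0 < (2 ^ K.+1).-1)%N.
  by rewrite -subn1 subn_gt0 (leq_ltn_trans K0) // ltn_exp2l.
have lgX : lg (2 ^ K.+1).-1 = K.+1.
  apply: lg_block; rewrite prednK ?expn_gt0 // leqnn andbT -ltnS prednK ?expn_gt0 //.
  by rewrite ltn_exp2l.
have := H _ X0; rewrite lgX => HX.
rewrite -[leLHS]mulr_natl ler_pdivrMr ?ltr0n //.
apply: (@le_trans _ _ (cnt P (2 ^ K.+1).-1)%:R); first by rewrite ler_nat.
apply: (le_trans HX); rewrite mulrAC ler_wpM2r //.
by rewrite -natrM -expnS ler_nat leq_pred.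
Qed.

Lemma ler_recip_lg (P : pred nat) (psi : nat -> R) X :
  (forall k, 0 <= psi k) ->
  (forall Y, (0 < Y)%N -> (cnt P Y)%:R <= Y%:R * psi (lg Y)) ->
  recip P X <= 2 * \sum_(1 <= k < (lg X).+1) psi k.
Proof.
move=> psi0 H; apply: le_trans (recip_block _ psi0 H); apply: ler_recip.
by rewrite -ltnS prednK ?expn_gt0 // ltn_exp_lg.
Qed.

Definition harmonic (K : nat) : R := \sum_(1 <= k < K.+1) k%:R^-1.

(** Each dyadic block contributes at most 1. *)
Lemma harmonic_lg X : harmonic X <= (lg X)%:R.
Proof.
suff H K : harmonic (2 ^ K).-1 <= K%:R.
  apply: le_trans (H (lg X)); apply: (ler_recip predT).
  by rewrite -ltnS prednK ?expn_gt0 // ltn_exp_lg.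
elim: K => [|K IH]; first by rewrite /harmonic big_geq.
have K0 : (0 < 2 ^ K)%N by rewrite expn_gt0.
have KS : (2 ^ K <= 2 ^ K.+1)%N by rewrite leq_exp2l.
rewrite /harmonic prednK ?expn_gt0 // (@big_cat_nat _ _ _ (2 ^ K) 1%N) //=.
rewrite -{1}(prednK K0) -[K.+1%:R]natr1; apply: lerD; first exact: IH.
have le : \sum_(2 ^ K <= n < 2 ^ K.+1) n%:R^-1 <=
    \sum_(2 ^ K <= n < 2 ^ K.+1) (2 ^ K)%:R^-1 :> R.
  rewrite big_nat_cond [leRHS]big_nat_cond; apply: ler_sum => n /andP[/andP[n1 _] _].
  by rewrite lef_pV2 ?posrE ?ltr0n ?(leq_trans K0) // ler_nat.
apply: (le_trans le); rewrite sumr_const_nat expnS mul2n -addnn addnK.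
by rewrite -[leLHS]mulr_natr mulVf // pnatr_eq0 -lt0n.
Qed.

Lemma harmonic_ge1 K : (0 < K)%N -> 1 <= harmonic K.
Proof.
move=> K0; rewrite /harmonic big_ltn // invr1 lerDl.
by apply: sumr_ge0 => n _; rewrite invr_ge0.
Qed.

Lemma ler_harmonic J K : (J <= K)%N -> harmonic J <= harmonic K.
Proof. exact: (ler_recip predT). Qed.

(** The increment of 2 sqrt x between K and K + 1 exceeds 1 / sqrt (K + 1). *)
Lemma sum_inv_sqrt K : \sum_(1 <= k < K.+1) (Num.sqrt k%:R)^-1 <= 2 * Num.sqrt K%:R :> R.
Proof.
elim: K => [|K IH]; first by rewrite big_geq // sqrtr0 mulr0.
rewrite big_nat_recr //=; apply: le_trans (lerD IH (lexx _)) _.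
set a := Num.sqrt K%:R; set b := Num.sqrt K.+1%:R.
have a2 : a ^+ 2 = K%:R by rewrite sqr_sqrtr.
have b2 : b ^+ 2 = a ^+ 2 + 1 by rewrite a2 sqr_sqrtr // -natr1.
have b0 : 0 < b by rewrite sqrtr_gt0 ltr0n.
have a0 : 0 <= a by rewrite sqrtr_ge0.
have ab : a <= b by rewrite ler_sqrt ?ler_nat.
rewrite -(ler_pM2r b0) mulrDl mulVf ?gt_eqF // -!mulrA -expr2 b2.
nra.
Qed.
End Reciprocals.
(** * Chebyshev bounds for prime powers *)

Lemma prod_primes_dvdn (s : seq nat) m : uniq s -> all prime s ->
  {in s, forall p, p %| m}%N -> (\prod_(p <- s) p %| m)%N.
Proof.
elim: s m => [|p s IH] m /=; first by rewrite big_nil dvd1n.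
move=> /andP[ps us] /andP[pp sp] H; rewrite big_cons Gauss_dvd.
  by rewrite H ?mem_head // IH // => q qs; rewrite H // inE qs orbT.
rewrite prime_coprime // big_seq.
elim/big_ind : _ => [|x y nx ny|q qs].
- by rewrite dvdn1; apply/negP => /eqP p1; rewrite p1 in pp.
- by rewrite Euclid_dvdM // negb_or nx.
- rewrite dvdn_prime2 ?(allP sp q qs) //; apply/negP => /eqP pq.
  by rewrite pq qs in ps.
Qed.

Lemma leq_bin_expn m k : ('C(m, k) <= 2 ^ m)%N.
Proof.
elim: m k => [|m IH] [|k]; rewrite ?bin0 ?expn_gt0 //.
by rewrite binS expnS mul2n -addnn leq_add.
Qed.

Lemma prime_dvd_fact p n : prime p -> (p %| n`!)%N = (p <= n)%N.
Proof.
move=> pp; apply/idP/idP; last by move=> pn; rewrite dvdn_fact // prime_gt0.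
elim: n => [|n IH]; first by rewrite dvdn1 => /eqP p1; rewrite p1 in pp.
by rewrite factS Euclid_dvdM // => /orP[/dvdn_leq->//|/IH/leqW].
Qed.

(** The primes between n and 2n divide the binomial coefficient C(2n, n), which is
at most 2 ^ 2n. *)
Lemma primes_block n :
  (n ^ size [seq p <- iota n.+1 n | prime p] <= 2 ^ n.*2)%N.
Proof.
pose s := [seq p <- iota n.+1 n | prime p]; rewrite -/s.
have sP p : p \in s -> prime p /\ (n < p <= n.*2)%N.
  by rewrite mem_filter mem_iota addSn addnn => /andP[-> /andP[-> ?]].
apply: leq_trans (leq_bin_expn _ n).
apply: (@leq_trans (\prod_(p <- s) p)).
  elim: s sP => [|p s IH] sP; first by rewrite big_nil.
  rewrite big_cons /= expnS leq_mul //; last by apply: IH => q qs; apply: sP; rewrite inE qs orbT.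
  by have [_ /andP[/ltnW]] := sP p (mem_head _ _).
apply: dvdn_leq; first by rewrite bin_gt0 -addnn leq_addr.
apply: prod_primes_dvdn; rewrite ?filter_uniq ?iota_uniq //; first exact: filter_all.
move=> p /sP[pp /andP[np pn]].
have := prime_dvd_fact n.*2 pp; rewrite pn -(@bin_fact _ n) -?addnn ?leq_addr //.
rewrite addnK !Euclid_dvdM // !prime_dvd_fact // leqNgt np /= !orbF.
by [].
Qed.

Lemma cnt_prime_pow2 k : (k * cnt prime (2 ^ k) <= 6 * 2 ^ k)%N.
Proof.
have [k6|] := leqP k 6; first by rewrite leq_mul // cnt_le.
elim: k => // k IH k6; have k1 : (1 < k)%N by lia.
have {}IH : (k * cnt prime (2 ^ k) <= 6 * 2 ^ k)%N.
  by have [k6'|/IH//] := leqP k 6; rewrite leq_mul // cnt_le.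
pose s := size [seq p <- iota (2 ^ k).+1 (2 ^ k) | prime p].
have cS : cnt prime (2 ^ k.+1) = (cnt prime (2 ^ k) + s)%N.
  by rewrite !cntE expnS mul2n -addnn iotaD count_cat add1n /s size_filter.
have ks : (k * s <= 2 ^ k.+1)%N.
  have := primes_block (2 ^ k); rewrite -/s -expnM leq_exp2l // expnS.
  by rewrite -mul2n.
rewrite cS -(@leq_pmul2l k) ?(ltnW k1) //.
rewrite expnS in ks *; set A := (2 ^ k)%N in IH ks *; set c := cnt _ _ in IH *.
nia.
Qed.

(** A prime power that is not a prime is p ^ j with p at most the square root of the
bound and j at most its logarithm; there are few of them. *)
Lemma cnt_prime_power_pow2 k : (k * cnt prime_power (2 ^ k) <= 26 * 2 ^ k)%N.
Proof.
pose np q := prime_power q && ~~ prime q.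
have le1 : (cnt prime_power (2 ^ k) <= cnt prime (2 ^ k) + cnt np (2 ^ k))%N.
  apply: leq_trans (cntU _ _ _); apply: sub_cnt => q _ /= ppq.
  by rewrite /np ppq /= orbN.
pose S := [seq (p, j) | p <- iota 0 (2 ^ (k./2).+1), j <- iota 0 k.+1].
have le2 : (cnt np (2 ^ k) <= 2 ^ (k./2).+1 * k.+1)%N.
  have -> : (2 ^ (k./2).+1 * k.+1)%N = size S by rewrite size_allpairs !size_iota.
  rewrite cntE -size_filter -(size_map (fun q => (pdiv q, logn (pdiv q) q))).
  have qE q : prime_power q -> (q = pdiv q ^ logn (pdiv q) q)%N.
    by move=> /andP[q1 /p_natP[j qj]]; rewrite {4}qj pfactorK ?pdiv_prime.
  apply: uniq_leq_size.
    rewrite map_inj_in_uniq ?filter_uniq ?iota_uniq // => q r.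
    rewrite !mem_filter => /andP[/andP[qq _] _] /andP[/andP[rr _] _] [E1 E2].
    by rewrite (qE q qq) (qE r rr) E1 -E2 -E1.
  move=> x /mapP[q]; rewrite mem_filter mem_iota => /andP[/andP[qq nq] /andP[q0 qk]] ->.
  have q1 : (1 < q)%N by case/andP: qq.
  have pp := pdiv_prime q1; have Eq := qE q qq.
  move: qk; rewrite add1n ltnS => qk.
  set p := pdiv q in pp Eq *; set j := logn p q in Eq *.
  have j2 : (1 < j)%N.
    case: (j) Eq => [|[|//]] E; first by rewrite E in q1.
    by rewrite E expn1 pp in nq.
  apply/allpairsPdep; exists p, j; split=> //; rewrite mem_iota add0n /=; last first.
    rewrite ltnS -(@leq_exp2l 2) // (leq_trans _ qk) // Eq leq_exp2r ?prime_gt1 //.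
    exact: ltnW.
  rewrite ltnNge; apply/negP => pk; suff : (2 ^ k < q)%N by rewrite ltnNge qk.
  apply: (@leq_trans (p ^ 2)); last by rewrite Eq (leq_exp2l _ _ (prime_gt1 pp)).
  apply: (@leq_trans ((2 ^ (k./2).+1) ^ 2)); last by rewrite leq_exp2r.
  rewrite -expnM ltn_exp2l //; lia.
have le3 : (k * (2 ^ (k./2).+1 * k.+1) <= 20 * 2 ^ k)%N.
  pose j := uphalf k; have kj : (k = k./2 + j)%N by rewrite /j; lia.
  have jj : (j * j <= 2 * 2 ^ j)%N.
    elim: (j) => // i IH; have [i3|] := leqP i 3; last first.
      by move=> i3; rewrite expnS; nia.
    by case: i i3 {IH} => [|[|[|[|]]]].
  have j1 : (j <= 2 ^ j)%N by rewrite ltnW // ltn_expl.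
  have kj2 : (k <= 2 * j)%N by rewrite /j; lia.
  rewrite [X in (_ <= 20 * 2 ^ X)%N]kj expnD expnS.
  set A := (2 ^ k./2)%N; set B := (2 ^ j)%N in jj j1 *.
  have : (k * k.+1 <= 10 * B)%N by nia.
  by nia.
have := cnt_prime_pow2 k; nia.
Qed.

Lemma cnt_prime_power_le X : (cnt prime_power X * lg X <= 52 * X)%N.
Proof.
have [->|X0] := posnP X; first by rewrite /cnt big_geq.
have := cnt_prime_power_pow2 (lg X); have := leq_cnt prime_power (ltnW (ltn_exp_lg X)).
have := leq_exp_lg X0; have -> : (2 ^ lg X = 2 * 2 ^ (lg X).-1)%N by rewrite -expnS.
set A := (2 ^ _)%N; set c := cnt _ X; set d := cnt _ _; nia.
Qed.

(** * Numbers with even valuation at the primes 3 modulo 4 *)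

Lemma ler_sum_cover (R : numDomainType) (I : Type) (T : eqType) (s : seq T) (J : seq I)
    (g : I -> T) (F : T -> R) : (forall x, 0 <= F x) ->
  uniq s -> {subset s <= map g J} -> \sum_(x <- s) F x <= \sum_(j <- J) F (g j).
Proof.
move=> F0 us sub; rewrite -(big_map g predT F).
rewrite [leRHS](bigID (mem s)) /= -[leLHS]addr0 lerD //; last exact: sumr_ge0.
rewrite -[leRHS]big_filter.
have : subseq (undup [seq x <- map g J | x \in s]) [seq x <- map g J | x \in s] := undup_subseq _.
have pe : perm_eq s (undup [seq x <- map g J | x \in s]).
  apply: uniq_perm; rewrite ?undup_uniq // => x.
  by rewrite mem_undup mem_filter; case xs: (x \in s) => //=; rewrite sub.
rewrite (perm_big _ pe) /= {pe}.
elim: [seq x <- map g J | x \in s] (undup _) => [|y l IH] [|x u] //=; rewrite ?big_nil ?sumr_ge0 //.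
rewrite !big_cons; case: eqP => [->|_] sl; first by rewrite lerD2l IH.
by have := IH (x :: u) sl; rewrite big_cons => h; apply: (le_trans h); rewrite lerDr.
Qed.

Lemma leq_sum_cover (I : Type) (T : eqType) (s : seq T) (J : seq I) (g : I -> T)
    (F : T -> nat) :
  uniq s -> {subset s <= map g J} -> (\sum_(x <- s) F x <= \sum_(j <- J) F (g j))%N.
Proof.
move=> us sub; rewrite -(ler_nat int) !natr_sum.
exact: (@ler_sum_cover int _ _ _ _ _ (fun x => (F x)%:R)).
Qed.

(** The boolean form of even_valuation_3mod4, on which sums can be filtered. *)
Definition even3 (d : nat) : bool :=
  (0 < d)%N && all (fun p => (p %% 4 == 3) ==> ~~ odd (logn p d))%N (primes d).

Lemma lg_le_sum_pfactors n :
  (0 < n)%N -> (lg n <= 1 + \sum_(p <- primes n) lg (p ^ logn p n))%N.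
Proof.
move=> n0; rewrite {1}(prod_prime_decomp n0) prime_decompE big_map /=.
elim: (primes n) => [|p s IH]; first by rewrite !big_nil.
rewrite !big_cons (leq_trans (lg_mul _ _)) // addnCA leq_add2l.
exact: IH.
Qed.

Lemma even3_coprime_part n p : even3 n -> p \in primes n -> even3 (n %/ p ^ logn p n).
Proof.
move=> /andP[n0 /allP E] pn.
have dn := pfactor_dvdnn p n; have pp : prime p by move: pn; rewrite mem_primes => /andP[].
have m0 : (0 < n %/ p ^ logn p n)%N by rewrite divn_gt0 ?expn_gt0 ?prime_gt0 // dvdn_leq.
rewrite /even3 m0; apply/allP => q; rewrite mem_primes => /and3P[qq _ qm].
have qn : q \in primes n by rewrite mem_primes qq n0 (dvdn_trans qm) // dvdn_div.
have := E q qn; have [q3|//] := boolP (q %% 4 == 3)%N => /=.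
rewrite logn_div // lognX (logn_prime _ pp).
have [->|qp] := eqVneq q p; last by rewrite muln0 subn0.
by rewrite muln1 subnn.
Qed.

Lemma cnt_dvdn (P : pred nat) q X : (0 < q)%N ->
  (\sum_(1 <= n < X.+1 | (q %| n) && P (n %/ q)) 1 <= cnt P (X %/ q))%N.
Proof.
move=> q0; rewrite -/(cnt _ _) cntE -size_filter.
rewrite -(size_map (fun n => n %/ q)%N); apply: cnt_size.
  rewrite map_inj_in_uniq ?filter_uniq ?iota_uniq // => m n.
  rewrite !mem_filter => /andP[/andP[qm _] _] /andP[/andP[qn _] _] E.
  by rewrite -(divnK qm) -(divnK qn) E.
move=> x /mapP[n]; rewrite mem_filter mem_iota add1n ltnS => /andP[/andP[qn Pn] /andP[n0 nX]] ->.
by split=> //; rewrite divn_gt0 // dvdn_leq //= leq_div2r.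
Qed.

(** Both sides range over the pairs (q, m) with q m at most X. *)
Lemma big_hyperbola (V : Type) (idx : V) (op : Monoid.com_law idx) (P Q : pred nat)
    (F : nat -> nat -> V) X :
  \big[op/idx]_(1 <= q < X.+1 | P q) \big[op/idx]_(1 <= m < (X %/ q).+1 | Q m) F q m =
  \big[op/idx]_(1 <= m < X.+1 | Q m) \big[op/idx]_(1 <= q < (X %/ m).+1 | P q) F q m.
Proof.
have W (A : pred nat) (G : nat -> V) q : (0 < q)%N ->
    \big[op/idx]_(1 <= m < (X %/ q).+1 | A m) G m =
    \big[op/idx]_(1 <= m < X.+1 | A m && (m * q <= X)%N) G m.
  move=> q0; rewrite (@big_nat_widen _ _ _ 1%N _ X.+1) ?ltnS ?leq_div //.
  by apply: eq_bigl => m; rewrite ltnS leq_divRL.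
rewrite big_nat_cond [RHS]big_nat_cond.
under eq_bigr => q /andP[/andP[q0 _] _] do rewrite W //.
under [RHS]eq_bigr => m /andP[/andP[m0 _] _] do rewrite W //.
rewrite -!big_nat_cond (exchange_big_dep_nat Q) /=; last by move=> q m _ _ _ /andP[].
apply: eq_bigr => m Qm; apply: eq_bigl => q.
by rewrite Qm mulnC.
Qed.

(** Bound lg n by a sum over the exact prime powers q of n; since n / q has again
even valuations, exchanging the sums leaves, for each m of the same kind, the sum
of lg q over the prime powers q up to X / m, at most a multiple of X / m. *)
Lemma sum_lg_even3 X :
  (\sum_(1 <= n < X.+1 | even3 n) lg n <=
   X + \sum_(1 <= m < X.+1 | even3 m) 52 * (X %/ m))%N.
Proof.
apply: (@leq_trans (\sum_(1 <= n < X.+1 | even3 n) (1 + \sum_(p <- primes n) lg (p ^ logn p n)))).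
  by apply: leq_sum => n /andP[n0 _]; exact: lg_le_sum_pfactors.
rewrite big_split leq_add ?cnt_le //=.
pose ex n q := [&& prime_power q, q %| n & even3 (n %/ q)]%N.
apply: (@leq_trans (\sum_(1 <= n < X.+1) \sum_(1 <= q < X.+1 | ex n q) lg q)).
  rewrite [leqRHS](bigID even3) /= -[leqLHS]addn0 leq_add // big_nat_cond [leqRHS]big_nat_cond.
  apply: leq_sum => n /andP[/andP[n0 nX] En].
  rewrite -(big_map (fun p => p ^ logn p n)%N predT lg) -[leqRHS]big_filter.
  apply: (leq_sum_cover (g := id)).
    rewrite map_inj_in_uniq ?primes_uniq // => p q pn qn E.
    have := pn; rewrite -logn_gt0 => lp; have := pn; rewrite mem_primes => /and3P[pp _ _].
    have := qn; rewrite mem_primes => /and3P[qq _ _].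
    have : (p %| q ^ logn q n)%N by rewrite -E dvdn_exp.
    by rewrite Euclid_dvdX // dvdn_prime2 // => /andP[/eqP].
  move=> x /mapP[p pn ->]; rewrite map_id mem_filter mem_index_iota.
  have dn := pfactor_dvdnn p n.
  have := pn; rewrite mem_primes => /and3P[pp _ pdn].
  have lp : (0 < logn p n)%N by rewrite logn_gt0.
  rewrite expn_gt0 prime_gt0 // ltnS (leq_trans (dvdn_leq n0 dn)) -1?ltnS //= andbT.
  rewrite /ex dn even3_coprime_part // !andbT.
  apply: (pgroup_prime_power pp); last by rewrite pnatX pnat_id.
  by rewrite -(expn0 p) ltn_exp2l // prime_gt1.
rewrite (exchange_big_dep_nat prime_power) /=; last by move=> n q _ _ _ /and3P[].
apply: (@leq_trans (\sum_(1 <= q < X.+1 | prime_power q)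
    \sum_(1 <= m < (X %/ q).+1 | even3 m) lg q)).
  rewrite big_nat_cond [leqRHS]big_nat_cond; apply: leq_sum => q /andP[/andP[q0 _] qq].
  have cE (A : pred nat) Y : (\sum_(1 <= n < Y | A n) lg q = (\sum_(1 <= n < Y | A n) 1) * lg q)%N.
    by rewrite big_distrl /=; apply: eq_bigr => n _; rewrite mul1n.
  rewrite !cE leq_mul2r; apply/orP; right; apply: leq_trans (cnt_dvdn _ _ q0).
  by rewrite (eq_bigl (fun n => (q %| n) && even3 (n %/ q))%N) // => n; rewrite /ex qq.
rewrite big_hyperbola big_nat_cond [leqRHS]big_nat_cond.
apply: leq_sum => m /andP[/andP[m0 _] _]; apply: leq_trans (cnt_prime_power_le _).
rewrite /cnt big_distrl /= big_nat_cond [leqRHS]big_nat_cond.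
by apply: leq_sum => q /andP[/andP[_ qX] _]; rewrite mul1n leq_lg.
Qed.

Lemma cnt_squares_lg X : (0 < X)%N ->
  (cnt (fun n => n * n <= X)%N X * lg X <= 4 * X)%N.
Proof.
move=> X0; pose L := lg X; pose j := L./2.
have XL : (X < 2 ^ L)%N := ltn_exp_lg X.
have LX : (2 ^ L <= 2 * X)%N.
  by have := leq_exp_lg X0; rewrite -(@leq_pmul2l 2) // -expnS.
have Lj : (L = j + uphalf L)%N by rewrite /j; lia.
have c1 : (cnt (fun n => n * n <= X)%N X <= 2 ^ uphalf L)%N.
  apply: (@leq_trans (size (iota 0 (2 ^ uphalf L)))); last by rewrite size_iota.
  rewrite cntE -size_filter uniq_leq_size ?filter_uniq ?iota_uniq // => n.
  rewrite mem_filter mem_iota => /andP[nX _]; rewrite mem_iota add0n /= ltnNge.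
  apply/negP => nL; have := leq_mul nL nL; rewrite -expnD => h.
  have := leq_ltn_trans (leq_trans h nX) XL; rewrite ltn_exp2l // => {}h.
  have : forall l, (l <= uphalf l + uphalf l)%N by move=> l; lia.
  by move/(_ L); rewrite leqNgt h.
have j1 : (j < 2 ^ j)%N by rewrite ltn_expl.
have L2 : (2 ^ L = 2 ^ j * 2 ^ uphalf L)%N by rewrite -expnD -Lj.
have L3 : (L <= 2 * 2 ^ j)%N by move: j1; rewrite /j; lia.
rewrite -/L; apply: leq_trans (leq_mul c1 L3) _.
rewrite mulnCA (mulnC (2 ^ uphalf L)%N) -L2.
by apply: leq_trans (leq_mul (leqnn 2) LX) _; rewrite mulnA.
Qed.

(** An n with n ^ 2 > X has 2 lg n at least lg X, and few n have n ^ 2 at most X. *)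
Lemma cnt_even3_lg X : (0 < X)%N ->
  (cnt even3 X * lg X <= 4 * X + 2 * (\sum_(1 <= n < X.+1 | even3 n) lg n))%N.
Proof.
move=> X0; apply: (@leq_trans (cnt (fun n => n * n <= X)%N X * lg X +
    2 * (\sum_(1 <= n < X.+1 | even3 n) lg n))); last by rewrite leq_add2r cnt_squares_lg.
rewrite /cnt !big_distrl /= big_distrr /=.
rewrite [X in (_ <= X + _)%N]big_mkcond [X in (_ <= _ + X)%N]big_mkcond /= -big_split /=.
rewrite big_mkcond /=; apply: leq_sum => n _; rewrite mul1n.
case: (even3 n) => //; have [nX|nX] := boolP (n * n <= X)%N; first by rewrite leq_addr.
rewrite -ltnNge in nX; rewrite add0n mul2n -addnn.
by rewrite (leq_trans _ (lg_mul _ _)) // leq_lg // ltnW.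
Qed.

(** The density of these numbers is bounded by the sum of their reciprocals divided
by lg X, a saving over the trivial bound once that sum is o(lg X). *)
Lemma cnt_even3_recip (R : realType) X : (0 < X)%N ->
  (cnt even3 X)%:R * (lg X)%:R <= 110 * X%:R * recip R even3 X.
Proof.
move=> X0; have r1 : 1 <= recip R even3 X.
  rewrite /recip big_ltn_cond // /even3 /= invr1 lerDl.
  by apply: sumr_ge0 => n _; rewrite invr_ge0.
have := leq_trans (cnt_even3_lg X0) (_ : _ <= 4 * X + 2 * (X + \sum_(1 <= m < X.+1 | even3 m) 52 * (X %/ m)))%N.
rewrite leq_add2l leq_mul2l sum_lg_even3 => /(_ isT).
rewrite -(ler_nat R) natrM => h; apply: (le_trans h).
rewrite natrD !natrM natrD.
have le : (\sum_(1 <= m < X.+1 | even3 m) 52 * (X %/ m))%:R <= 52 * X%:R * recip R even3 X.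
  rewrite natr_sum /recip mulr_sumr big_nat_cond [leRHS]big_nat_cond.
  apply: ler_sum => m /andP[/andP[m0 _] _]; rewrite natrM -mulrA ler_pM2l //.
  by rewrite ler_pdivlMr ?ltr0n // -natrM ler_nat leq_trunc_div.
have X1 : X%:R <= X%:R * recip R even3 X by rewrite ler_peMr.
lra.
Qed.

(** The nontrivial Dirichlet character modulo 4. *)
Definition chi4 (n : nat) : int :=
  if (n %% 4 == 1)%N then 1 else if (n %% 4 == 3)%N then -1 else 0.

Lemma chi4M m n : chi4 (m * n) = chi4 m * chi4 n.
Proof.
rewrite /chi4 -modnMm.
have : (m %% 4 < 4)%N by rewrite ltn_mod.
have : (n %% 4 < 4)%N by rewrite ltn_mod.
by case: (m %% 4)%N => [|[|[|[|]]]] //; case: (n %% 4)%N => [|[|[|[|]]]].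
Qed.

Lemma chi4X m n : chi4 (m ^ n) = chi4 m ^+ n.
Proof. by elim: n => [|n IH] //; rewrite expnS chi4M IH exprS. Qed.

(** One quarter of the number of representations of n as a sum of two squares. *)
Definition sum_chi4 (n : nat) : int := \sum_(d <- divisors n) chi4 d.

(** The divisors of p ^ v m are the p ^ j d, which makes sums of multiplicative
functions over divisors multiplicative. *)
Lemma divisors_pfactor p v m : prime p -> (0 < m)%N -> ~~ (p %| m)%N ->
  perm_eq (divisors (p ^ v * m)) [seq p ^ j * d | j <- iota 0 v.+1, d <- divisors m]%N.
Proof.
move=> pp m0 pm; have pv0 k : (0 < p ^ k)%N by rewrite expn_gt0 prime_gt0.
have ld d : d \in divisors m -> logn p d = 0%N /\ (0 < d)%N.
  rewrite -dvdn_divisors // => dm; have d0 := dvdn_gt0 m0 dm; split=> //.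
  by apply/eqP; rewrite -leqn0 leqNgt logn_gt0 mem_primes pp d0 /=; apply: contra pm => /dvdn_trans; apply.
apply: uniq_perm; first exact: divisors_uniq.
  apply: allpairs_uniq; rewrite ?iota_uniq ?divisors_uniq // => -[j d] [k e].
  move=> /allpairsPdep[j' [d' [_ dd [-> ->]]]] /allpairsPdep[k' [e' [_ ee [-> ->]]]] /= E.
  have [ld0 d0] := ld _ dd; have [le0 e0] := ld _ ee.
  have jk : j' = k'.
    by have := congr1 (logn p) E; rewrite !lognM // !pfactorK // ld0 le0 !addn0.
  by move: E; rewrite jk => /eqP; rewrite eqn_pmul2l // => /eqP ->.
move=> x; rewrite -dvdn_divisors ?muln_gt0 ?pv0 //.
apply/idP/allpairsPdep => [xd|[j [d [ji dm ->]]]]; last first.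
  rewrite dvdn_mul // ?dvdn_exp2l ?dvdn_divisors //.
  by move: ji; rewrite mem_iota add0n ltnS.
have x0 : (0 < x)%N by rewrite (dvdn_gt0 _ xd) // muln_gt0 pv0.
exists (logn p x), (x %/ p ^ logn p x)%N.
have dx := pfactor_dvdnn p x.
split; last by rewrite mulnC divnK.
  rewrite mem_iota add0n ltnS /= (leq_trans (dvdn_leq_log p _ xd)) ?muln_gt0 ?pv0 //.
  by rewrite lognM // pfactorK // (@lognE p m) (negbTE pm) !andbF addn0.
rewrite -dvdn_divisors //.
have cop : coprime (x %/ p ^ logn p x) (p ^ v).
  apply: coprimeXr; rewrite coprime_sym prime_coprime //; apply/negP => h.
  have : (0 < logn p (x %/ p ^ logn p x))%N.
    by rewrite logn_gt0 mem_primes pp h divn_gt0 // dvdn_leq.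
  by rewrite logn_div // pfactorK // subnn.
by rewrite -(Gauss_dvdr _ cop) (dvdn_trans _ xd) // dvdn_div.
Qed.

(** By multiplicativity it is a product of sums of powers of 1, of -1 or of 0. *)
Lemma sum_chi4_ge0 n : (0 < n)%N -> 0 <= sum_chi4 n.
Proof.
elim/ltn_ind: n => n IH n0; have [n1|n1] := leqP n 1.
  have -> : n = 1%N by lia.
  by rewrite /sum_chi4 (_ : divisors 1 = [:: 1%N]) // big_seq1.
pose p := pdiv n; have pp : prime p := pdiv_prime n1.
pose v := logn p n; pose m := (n %/ p ^ v)%N.
have nE : n = (p ^ v * m)%N by rewrite mulnC divnK // pfactor_dvdnn.
have v0 : (0 < v)%N by rewrite logn_gt0 pi_pdiv.
have m0 : (0 < m)%N by move: n0; rewrite nE muln_gt0 => /andP[].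
have pm : ~~ (p %| m)%N.
  have : logn p m = 0%N by rewrite logn_div ?pfactor_dvdnn // pfactorK // subnn.
  by move/eqP; rewrite -leqn0 leqNgt logn_gt0 mem_primes pp m0.
have mn : (m < n)%N.
  by rewrite nE ltn_Pmull // -(expn0 p) ltn_exp2l ?prime_gt1.
rewrite /sum_chi4 nE (perm_big _ (divisors_pfactor v pp m0 pm)).
rewrite big_allpairs_dep.
have -> : \sum_(i <- iota 0 v.+1) \sum_(j <- divisors m) chi4 (p ^ i * j) =
    (\sum_(i <- iota 0 v.+1) chi4 p ^+ i) * sum_chi4 m.
  rewrite mulr_suml; apply: eq_bigr => i _; rewrite /sum_chi4 mulr_sumr.
  by apply: eq_bigr => j _; rewrite chi4M chi4X.
apply: mulr_ge0; last exact: IH.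
have : chi4 p \in [:: 1; -1; 0] by rewrite /chi4; case: ifP => // _; case: ifP.
rewrite !inE => /or3P[] /eqP ->.
- by apply: sumr_ge0 => i _; rewrite expr1n.
- suff H k : \sum_(i <- iota 0 k.+1) (-1 : int) ^+ i = (~~ odd k)%:R by rewrite H.
  elim: k => [|k IHk]; first by rewrite big_seq1.
  rewrite -addn1 iotaD big_cat /= IHk add0n big_seq1 exprS -signr_odd /=.
  by case: (odd k).
- by apply: sumr_ge0 => i _; rewrite exprn_ge0.
Qed.

Definition all_1mod4 (a : nat) : bool := (0 < a)%N && all (fun p => p %% 4 == 1)%N (primes a).

Lemma all_1mod4_dvdn a d : all_1mod4 a -> (d %| a)%N -> all_1mod4 d.
Proof.
move=> /andP[a0 /allP H] da; have d0 := dvdn_gt0 a0 da; rewrite /all_1mod4 d0.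
apply/allP => p; rewrite mem_primes => /and3P[pp _ pd]; apply: H.
by rewrite mem_primes pp a0 (dvdn_trans pd).
Qed.

Lemma chi4_all_1mod4 a : all_1mod4 a -> chi4 a = 1.
Proof.
elim/ltn_ind: a => a IH; have [a1 /andP[a0 _]|a1 H] := leqP a 1.
  by have -> : a = 1%N by lia.
have pd := pdiv_dvd a; have pp := pdiv_prime a1.
rewrite -(divnK pd) chi4M IH ?(all_1mod4_dvdn H) ?dvdn_div ?ltn_Pdiv ?prime_gt1 ?(ltnW a1) //.
have /andP[_ /allP H'] := H; rewrite mul1r /chi4 H' //.
by rewrite pi_pdiv.
Qed.

Lemma sum_multiples (R : zmodType) (F : nat -> R) d Z : (0 < d)%N ->
  \sum_(1 <= n < Z.+1 | (d %| n)%N) F n = \sum_(1 <= m < (Z %/ d).+1) F (d * m)%N.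
Proof.
move=> d0; rewrite -big_filter -(big_map (fun m => d * m)%N predT F).
apply: perm_big; apply: uniq_perm; first by rewrite filter_uniq ?iota_uniq.
  by rewrite map_inj_uniq ?iota_uniq // => x y /eqP; rewrite eqn_pmul2l // => /eqP.
move=> n; rewrite mem_filter mem_index_iota; apply/andP/mapP => [[dn /andP[n0 nZ]]|[m]].
  exists (n %/ d)%N; last by rewrite mulnC divnK.
  by rewrite mem_index_iota divn_gt0 // dvdn_leq //= ltnS leq_div2r.
rewrite mem_index_iota => /andP[m0 mZ] ->.
by rewrite dvdn_mulr // muln_gt0 d0 m0 ltnS mulnC -leq_divRL.
Qed.

Section Density3mod4.
Variable R : realType.

(** The partial sums of 1 - 1/3 + 1/5 - ...; the strengthened bound at multiples
of 4 is what the induction needs. *)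
Lemma sum_chi4_div_le1 x : \sum_(1 <= d < x.+1) (chi4 d)%:~R / d%:R <= 1 :> R.
Proof.
pose S x : R := \sum_(1 <= d < x.+1) (chi4 d)%:~R / d%:R.
have SS n : S n.+1 = S n + (chi4 n.+1)%:~R / n.+1%:R by rewrite /S big_nat_recr.
have c4 k r : chi4 (4 * k + r)%N = chi4 r by rewrite /chi4 -modnDml modnMr add0n.
have pos n : 0 < n.+1%:R^-1 :> R by rewrite invr_gt0 ltr0n.
have step k : S (4 * k)%N <= 1 - (4 * k).+1%:R^-1 ->
    [/\ S (4 * k).+1 <= 1, S (4 * k).+2 <= 1, S (4 * k).+3 <= 1 &
       S (4 * k.+1)%N <= 1 - (4 * k.+1).+1%:R^-1].
  move=> Sk.
  have E1 : S (4 * k).+1 <= 1.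
    rewrite SS -(addn1 (4 * k)) (c4 k 1%N) (_ : chi4 1 = 1) // mul1r addn1.
    by rewrite -lerBrDr.
  have E2 : S (4 * k).+2 <= 1.
    by rewrite SS -(addn2 (4 * k)) (c4 k 2%N) (_ : chi4 2 = 0) // mul0r addr0.
  have E3 : S (4 * k).+3 <= 1 - (4 * k).+3%:R^-1.
    by rewrite SS -{1}(addn3 (4 * k)) (c4 k 3%N) (_ : chi4 3 = -1) // mulN1r lerD2r.
  split=> //; first by rewrite (le_trans E3) // lerBlDr lerDl ltW.
  rewrite mulnS addnC addn4 SS -{1}(addn4 (4 * k)) (c4 k 4%N) (_ : chi4 4 = 0) // mul0r addr0.
  apply: (le_trans E3); rewrite lerD2l lerN2 lef_pV2 ?posrE ?ltr0n // ler_nat.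
  by lia.
have S4 k : S (4 * k)%N <= 1 - (4 * k).+1%:R^-1.
  elim: k => [|k /step[]//].
  by rewrite muln0 /S big_geq // invr1 subrr.
have [E1 E2 E3 _] := step _ (S4 (x %/ 4)%N).
have E0 : S (4 * (x %/ 4))%N <= 1 by rewrite (le_trans (S4 _)) // lerBlDr lerDl ltW.
rewrite -/(S x) (divn_eq x 4) mulnC.
have : (x %% 4 < 4)%N by rewrite ltn_mod.
by case: (x %% 4)%N => [|[|[|[|]]]] // _; rewrite ?addn0 ?addn1 ?addn2 ?addn3.
Qed.

Lemma sum_sum_chi4 Z :
  \sum_(1 <= n < Z.+1) (sum_chi4 n)%:~R / n%:R <= harmonic R Z.
Proof.
have -> : \sum_(1 <= n < Z.+1) (sum_chi4 n)%:~R / n%:R =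
    \sum_(1 <= n < Z.+1) \sum_(1 <= d < Z.+1 | (d %| n)%N) (chi4 d)%:~R / n%:R :> R.
  apply: eq_big_nat => n /andP[n0 nZ].
  rewrite /sum_chi4 rmorph_sum mulr_suml /= -[RHS]big_filter; apply: perm_big.
  apply: uniq_perm; rewrite ?divisors_uniq ?filter_uniq ?iota_uniq // => d.
  rewrite -dvdn_divisors // mem_filter mem_index_iota.
  case dn: (d %| n)%N => //=; rewrite (dvdn_gt0 n0 dn) /= ltnS.
  by rewrite (leq_trans (dvdn_leq n0 dn)).
rewrite (exchange_big_dep_nat predT) //=.
have -> : \sum_(1 <= d < Z.+1) \sum_(1 <= n < Z.+1 | (d %| n)%N) (chi4 d)%:~R / n%:R =
    \sum_(1 <= d < Z.+1) \sum_(1 <= m < (Z %/ d).+1) (chi4 d)%:~R / d%:R * m%:R^-1 :> R.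
  apply: eq_big_nat => d /andP[d0 _]; rewrite sum_multiples //.
  by apply: eq_bigr => m _; rewrite natrM invfM mulrA.
rewrite big_hyperbola /harmonic; apply: ler_sum => m _.
by rewrite -mulr_suml ler_piMl ?invr_ge0 // sum_chi4_div_le1.
Qed.

(** Expanding the square counts each n with its factorizations n = a b, at most the
number of divisors of n; for n with only prime factors that are 1 modulo 4 this
is sum_chi4 n, and the sum of sum_chi4 n / n grows only like a logarithm, not
like its square. So the sum of reciprocals is O(sqrt (log y)). *)
Lemma recip_all_1mod4_sqr y : recip R all_1mod4 y ^+ 2 <= 2 * (lg y)%:R.
Proof.
pose Z := (y * y)%N.
pose A := [seq a <- index_iota 1 y.+1 | all_1mod4 a].
have AE : recip R all_1mod4 y = \sum_(a <- A) a%:R^-1 by rewrite big_filter.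
pose P := [seq (a, b) | a <- A, b <- A].
pose J := [seq (n, d) | n <- [seq n <- index_iota 1 Z.+1 | all_1mod4 n], d <- divisors n].
have Auniq : uniq A by rewrite filter_uniq ?iota_uniq.
have Ain a : a \in A -> [/\ all_1mod4 a, (0 < a)%N & (a <= y)%N].
  by rewrite mem_filter mem_index_iota ltnS => /andP[-> /andP[-> ->]].
have allM a b : all_1mod4 a -> all_1mod4 b -> all_1mod4 (a * b)%N.
  move=> /andP[a0 /allP Ha] /andP[b0 /allP Hb]; rewrite /all_1mod4 muln_gt0 a0 b0.
  apply/allP => p; rewrite mem_primes => /and3P[pp _]; rewrite Euclid_dvdM // => /orP[] pd.
    by apply: Ha; rewrite mem_primes pp a0.
  by apply: Hb; rewrite mem_primes pp b0.
have -> : recip R all_1mod4 y ^+ 2 = \sum_(p <- [seq (p.1 * p.2, p.1)%N | p <- P]) p.1%:R^-1.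
  rewrite big_map /P big_allpairs_dep /= expr2 {1}AE mulr_suml.
  apply: eq_bigr => a _; rewrite AE mulr_sumr; apply: eq_bigr => b _ /=.
  by rewrite natrM invfM.
apply: (@le_trans _ _ (\sum_(p <- J) p.1%:R^-1)).
  apply: (ler_sum_cover (g := id)) => [x||x].
  - by rewrite invr_ge0.
  - rewrite map_inj_in_uniq; first by rewrite allpairs_uniq // => -[? ?] [? ?] _ _ /= [-> ->].
    move=> [a b] [a' b'] /allpairsPdep[x1 [y1 [/Ain[_ x10 _] _ [-> _]]]] _ /= [] + E.
    by rewrite -E => /eqP; rewrite eqn_pmul2l // => /eqP ->.
  - move=> /mapP[[a b] /allpairsPdep[a1 [b1 [/Ain[Aa a0 ay] /Ain[Ab b0 yb] [-> ->]]]] ->] /=.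
    rewrite map_id; apply/allpairsPdep; exists (a1 * b1)%N, a1; split=> //.
      by rewrite mem_filter allM // mem_index_iota muln_gt0 a0 b0 ltnS leq_mul.
    by rewrite -dvdn_divisors ?muln_gt0 ?a0 // dvdn_mulr.
apply: (@le_trans _ _ (harmonic R Z)); last first.
  apply: le_trans (harmonic_lg _ _) _; rewrite -natrM ler_nat mul2n -addnn; exact: lg_mul.
apply: le_trans (sum_sum_chi4 Z).
rewrite /J big_allpairs_dep /= big_filter.
rewrite [leRHS](bigID all_1mod4) /= -[leLHS]addr0 lerD //; last first.
  rewrite big_nat_cond; apply: sumr_ge0 => n /andP[/andP[n0 _] _].
  by rewrite divr_ge0 // ler0z sum_chi4_ge0.
rewrite big_nat_cond [leRHS]big_nat_cond; apply: ler_sum => n /andP[/andP[n0 _] An].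
rewrite /sum_chi4 rmorph_sum mulr_suml /= le_eqVlt; apply/orP; left; apply/eqP.
apply: eq_big_seq => d; rewrite -dvdn_divisors // => dn.
by rewrite chi4_all_1mod4 ?mul1r //; apply: all_1mod4_dvdn An dn.
Qed.
End Density3mod4.
(** The primes 3 modulo 4 together form the square t ^ 2, their exponents being
even. *)
Lemma even3_decomposition m : even3 m ->
  exists i t a, [/\ m = (2 ^ i * t ^ 2 * a)%N, (0 < t)%N & all_1mod4 a].
Proof.
elim/ltn_ind: m => m IH Em; have m0 : (0 < m)%N by case/andP: Em.
have [m1|m1] := leqP m 1.
  by exists 0%N, 1%N, 1%N; split=> //; lia.
pose p := pdiv m; have pp : prime p := pdiv_prime m1.
have pm : p \in primes m by rewrite pi_pdiv.
pose v := logn p m; have v0 : (0 < v)%N by rewrite logn_gt0.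
have dm := pfactor_dvdnn p m.
have mE : m = (m %/ p ^ v * p ^ v)%N by rewrite divnK.
have lt : (m %/ p ^ v < m)%N.
  by rewrite ltn_Pdiv // -(expn0 p) ltn_exp2l ?prime_gt1.
have [i [t [a [E t0 Aa]]]] := IH _ lt (even3_coprime_part Em pm).
rewrite -/p -/v in E; have [p2|p2] := eqVneq p 2%N.
  by exists (i + v)%N, t, a; split=> //; rewrite mE E p2 expnD; ring.
have op : odd p by case: (even_prime pp) p2 => [->|].
have [p1|p1] := eqVneq (p %% 4)%N 1%N.
  exists i, t, (p ^ v * a)%N; split=> //; first by rewrite mE E; ring.
  have /andP[a0 /allP H] := Aa.
  rewrite /all_1mod4 muln_gt0 expn_gt0 prime_gt0 //= a0; apply/allP => q.
  rewrite mem_primes => /and3P[qq _]; rewrite Euclid_dvdM // Euclid_dvdX // dvdn_prime2 //.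
  move=> /orP[/andP[/eqP-> _]|qa]; first by rewrite p1.
  by apply: H; rewrite mem_primes qq a0.
have p3 : (p %% 4 == 3)%N by move: op p1; lia.
have /andP[_ /allP /(_ p pm)] := Em; rewrite p3 /= => ev.
exists i, (p ^ v./2 * t)%N, a; split=> //; last by rewrite muln_gt0 expn_gt0 prime_gt0.
rewrite mE E -{1}(odd_double_half v) (negbTE ev) add0n -addnn expnD; ring.
Qed.

Section Even3Density.
Variable R : realType.

Lemma sum_inv_squares X : \sum_(1 <= t < X.+1) (t ^ 2)%:R^-1 <= 2 :> R.
Proof.
case: X => [|X]; first by rewrite big_geq.
suff H : \sum_(1 <= t < X.+2) (t ^ 2)%:R^-1 <= 2 - X.+1%:R^-1 :> R.
  by rewrite (le_trans H) // lerBlDr lerDl invr_ge0.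
elim: X => [|X IH]; first by rewrite big_nat1 exp1n invr1; lra.
rewrite big_nat_recr //=; apply: (le_trans (lerD IH (lexx _))).
have x0 : 0 < X.+1%:R :> R by rewrite ltr0n.
rewrite natrX -(natr1 X.+1); set x : R := X.+1%:R in x0 *.
have x1 : 0 < x + 1 by lra.
rewrite -addrA lerD2l -subr_ge0.
rewrite [leRHS](_ : _ = (x * (x + 1) ^+ 2)^-1); first by rewrite invr_ge0 mulr_ge0 ?exprn_ge0 // ltW.
by field; rewrite !gt_eqF.
Qed.

Lemma sum_inv_pow2 k : \sum_(0 <= i < k) (2 ^ i)%:R^-1 <= 2 :> R.
Proof.
suff H : \sum_(0 <= i < k) (2 ^ i)%:R^-1 = 2 - 2 * (2 ^ k)%:R^-1 :> R.
  by rewrite H lerBlDr lerDl mulr_ge0 ?invr_ge0.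
elim: k => [|k IH]; first by rewrite big_geq // expn0 invr1; lra.
rewrite big_nat_recr //= IH expnS natrM.
have x0 : (2 ^ k)%:R != 0 :> R by rewrite pnatr_eq0 expn_eq0.
by field.
Qed.

Lemma recip_even3 X : recip R even3 X <= 4 * recip R all_1mod4 X.
Proof.
pose L := [seq m <- index_iota 1 X.+1 | even3 m].
pose A := [seq a <- index_iota 1 X.+1 | all_1mod4 a].
pose S := [seq (i, t) | i <- index_iota 0 (lg X), t <- index_iota 1 X.+1].
pose J := [seq (s, a) | s <- S, a <- A].
pose g (j : nat * nat * nat) := (2 ^ j.1.1 * j.1.2 ^ 2 * j.2)%N.
apply: (@le_trans _ _ (\sum_(j <- J) (g j)%:R^-1)).
  rewrite /recip -big_filter; apply: ler_sum_cover => [x||m].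
  - by rewrite invr_ge0.
  - by rewrite filter_uniq ?iota_uniq.
  - rewrite mem_filter mem_index_iota => /andP[Em /andP[m0 mX]].
    have [i [t [a [E t0 Aa]]]] := even3_decomposition Em.
    have a0 : (0 < a)%N by case/andP: Aa.
    have i0 : (0 < 2 ^ i)%N by rewrite expn_gt0.
    have t20 : (0 < t ^ 2)%N by rewrite expn_gt0 t0.
    rewrite ltnS in mX.
    have ld d : (d %| m)%N -> (d <= X)%N by move=> dm; rewrite (leq_trans _ mX) // dvdn_leq.
    apply/mapP; exists (i, t, a); last by rewrite /g.
    apply/allpairsPdep; exists (i, t), a; split=> //.
      apply/allpairsPdep; exists i, t; split=> //; rewrite mem_index_iota.
        rewrite -(@ltn_exp2l 2) // (leq_ltn_trans _ (ltn_exp_lg X)) // ld // E.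
        by rewrite -mulnA dvdn_mulr.
      by rewrite t0 ltnS ld // E dvdn_mulr // dvdn_mull // dvdn_exp.
    by rewrite mem_filter Aa mem_index_iota a0 ltnS ld // E dvdn_mull.
have -> : \sum_(j <- J) (g j)%:R^-1 =
   (\sum_(0 <= i < lg X) (2 ^ i)%:R^-1) * (\sum_(1 <= t < X.+1) (t ^ 2)%:R^-1) * recip R all_1mod4 X.
  rewrite /J big_allpairs_dep /S big_allpairs_dep -mulrA [RHS]mulr_suml.
  apply: eq_bigr => i _; rewrite mulr_suml mulr_sumr; apply: eq_bigr => t _.
  rewrite /recip big_filter !mulr_sumr; apply: eq_bigr => a _.
  by rewrite /g !natrM !invfM /= !mulrA.
rewrite ler_wpM2r ?recip_ge0 //.
have := sum_inv_pow2 (lg X); have := sum_inv_squares X.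
have p0 : 0 <= \sum_(0 <= i < lg X) (2 ^ i)%:R^-1 :> R.
  by apply: sumr_ge0 => i _; rewrite invr_ge0.
have q0 : 0 <= \sum_(1 <= t < X.+1) (t ^ 2)%:R^-1 :> R.
  by apply: sumr_ge0 => i _; rewrite invr_ge0.
nra.
Qed.

(** A weak form of Landau's theorem on sums of two squares. *)
Lemma cnt_even3 X : (0 < X)%N ->
  (cnt even3 X)%:R <= 880 * X%:R / Num.sqrt (lg X)%:R :> R.
Proof.
move=> X0; set L : R := (lg X)%:R; set r := recip R all_1mod4 X.
have L0 : 0 < L by rewrite ltr0n.
have r0 : 0 <= r := recip_ge0 _ _ _.
set q := Num.sqrt L; have q0 : 0 < q by rewrite sqrtr_gt0.
have q2 : q ^+ 2 = L by rewrite sqr_sqrtr // ltW.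
have rq : r <= 2 * q.
  rewrite -(@ler_pXn2r _ 2) ?nnegrE ?mulr_ge0 ?(ltW q0) //.
  apply: (le_trans (recip_all_1mod4_sqr R X)); rewrite exprMn q2 -/L.
  by lra.
have H := cnt_even3_recip R X0.
have X0' : 0 <= 110 * X%:R :> R by rewrite mulr_ge0.
rewrite ler_pdivlMr // -(ler_pM2r q0) -mulrA -expr2 q2.
apply: (le_trans H); apply: (le_trans (ler_wpM2l X0' (recip_even3 X))).
apply: (@le_trans _ _ (110 * X%:R * (4 * (2 * q)))); last by lra.
by rewrite ler_wpM2l // ler_pM2l.
Qed.
End Even3Density.
(** * Products with shifted prime powers *)

Definition prodset (P Q : pred nat) : pred nat :=
  fun n => has (fun e => P e && Q (n %/ e)%N) (divisors n).

Lemma prodsetP (P Q : pred nat) n : (0 < n)%N ->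
  reflect (exists e b, [/\ n = (e * b)%N, P e & Q b]) (prodset P Q n).
Proof.
move=> n0; apply: (iffP hasP) => [[e]|[e [b [E Pe Qb]]]].
  rewrite -dvdn_divisors // => en /andP[Pe Qe]; exists e, (n %/ e)%N.
  by rewrite mulnC divnK.
have e0 : (0 < e)%N by move: n0; rewrite E muln_gt0 => /andP[].
exists e; first by rewrite -dvdn_divisors // E dvdn_mulr.
by rewrite Pe E mulKn.
Qed.

(** In a product e b at most X, one of the two factors has its square at most X. *)
Lemma cnt_prodset (P Q : pred nat) X :
  (cnt (prodset P Q) X <=
    \sum_(1 <= e < X.+1 | P e && (e * e <= X)) cnt Q (X %/ e) +
    \sum_(1 <= b < X.+1 | Q b && (b * b <= X)) cnt P (X %/ b))%N.
Proof.
pose I (A : pred nat) := [seq e <- index_iota 1 X.+1 | A e && (e * e <= X)%N].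
pose J (A B : pred nat) := [seq (e, b) | e <- I A, b <- [seq b <- index_iota 1 (X %/ e).+1 | B b]].
have JE A B : (\sum_(1 <= e < X.+1 | A e && (e * e <= X)) cnt B (X %/ e) = \sum_(j <- J A B) 1)%N.
  rewrite /J big_allpairs_dep big_filter; apply: eq_bigr => e _.
  by rewrite big_filter.
rewrite !JE -big_cat /cnt -big_filter.
apply: (leq_sum_cover (g := fun j : nat * nat => (j.1 * j.2)%N)).
  by rewrite filter_uniq ?iota_uniq.
move=> n; rewrite mem_filter mem_index_iota ltnS => /andP[Pn /andP[n0 nX]].
have [e [b [E Pe Qb]]] := prodsetP P Q n0 Pn.
have /andP[e0 b0] : (0 < e)%N && (0 < b)%N by rewrite -muln_gt0 -E.
have inJ (A B : pred nat) x y : A x -> B y -> (0 < x)%N -> (0 < y)%N -> (x * y <= X)%N -> (x * x <= X)%N ->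
    (x, y) \in J A B.
  move=> Ax By x0 y0 xy xx; apply/allpairsPdep; exists x, y; split=> //.
    rewrite mem_filter Ax xx mem_index_iota x0 ltnS (leq_trans _ xx) // leq_pmulr //.
  by rewrite mem_filter By mem_index_iota y0 ltnS leq_divRL // mulnC.
have eb : (e * b <= X)%N by rewrite -E.
rewrite map_cat mem_cat; have [ebl|bel] := leqP e b.
  apply/orP; left; apply/mapP; exists (e, b) => //; apply: inJ => //.
  by rewrite (leq_trans _ eb) // leq_mul.
apply/orP; right; apply/mapP; exists (b, e); last by rewrite /= mulnC.
apply: inJ => //; first by rewrite mulnC.
by rewrite (leq_trans _ eb) // leq_mul // ltnW.
Qed.

Lemma lg_divn_sqrt X e : (0 < e)%N -> (e * e <= X)%N -> (lg X <= 4 * lg (X %/ e))%N.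
Proof.
move=> e0 ee; set Y := (X %/ e)%N; have eY : (e <= Y)%N by rewrite leq_divRL.
have XY : (X <= 2 * (Y * Y))%N.
  have := ltn_ceil X e0; rewrite -/Y => h; nia.
apply: (leq_trans (leq_lg XY)); apply: (leq_trans (lg_mul _ _)).
have := lg_mul Y Y; have : lg 2 = 2%N by [].
have : (0 < lg Y)%N by []; lia.
Qed.

(** The factors q - 1. *)
Definition shifted_prime_power : pred nat := fun b => prime_power b.+1.

Lemma cnt_shifted_prime_power X : (cnt shifted_prime_power X * lg X <= 104 * X)%N.
Proof.
have [->|X0] := posnP X; first by rewrite /cnt big_geq.
apply: (@leq_trans (cnt prime_power X.+1 * lg X.+1)); last first.
  by apply: leq_trans (cnt_prime_power_le _) _; lia.
apply: leq_mul; last exact: leq_lg.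
rewrite cntE -size_filter -(size_map S); apply: cnt_size.
  by rewrite map_inj_uniq ?filter_uniq ?iota_uniq // => x y [].
move=> x /mapP[n]; rewrite mem_filter mem_iota add1n ltnS => /andP[Pn /andP[_ nX]] ->.
by split.
Qed.

Section ProductDensity.
Variable R : realType.
Local Notation harmonic := (harmonic R).

(** The function for which X * psi s (lg X) bounds, up to a constant, the number of products of an
even3 number with s shifted prime powers; harmonic (lg X) is of size log log X. *)
Definition psi (s k : nat) : R := harmonic k ^+ s / Num.sqrt k%:R.

Lemma harmonic_ge0 k : 0 <= harmonic k.
Proof. exact: (recip_ge0 R predT). Qed.

Lemma psi_ge0 s k : 0 <= psi s k.
Proof. by rewrite mulr_ge0 ?exprn_ge0 ?harmonic_ge0 // invr_ge0 sqrtr_ge0. Qed.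

Lemma sum_psi s K : \sum_(1 <= k < K.+1) psi s k <= harmonic K ^+ s * (2 * Num.sqrt K%:R).
Proof.
apply: (@le_trans _ _ (harmonic K ^+ s * \sum_(1 <= k < K.+1) (Num.sqrt k%:R)^-1)).
  rewrite mulr_sumr big_nat_cond [leRHS]big_nat_cond.
  apply: ler_sum => k /andP[/andP[_ kK] _]; rewrite ler_wpM2r ?invr_ge0 ?sqrtr_ge0 //.
  by rewrite lerXn2r ?nnegrE ?harmonic_ge0 // ler_harmonic.
by rewrite ler_wpM2l ?exprn_ge0 ?harmonic_ge0 // sum_inv_sqrt.
Qed.

Lemma recip_shifted_prime_power X :
  recip R shifted_prime_power X <= 208 * harmonic (lg X).
Proof.
have := @ler_recip_lg R shifted_prime_power (fun k => 104 / k%:R) X.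
rewrite -mulr_sumr mulrA (_ : 2 * 104 = 208); last by lra.
apply=> [k|Y Y0]; first by rewrite mulr_ge0 ?invr_ge0.
by rewrite mulrA ler_pdivlMr ?ltr0n // -!natrM ler_nat mulnC (mulnC Y) mulnC cnt_shifted_prime_power.
Qed.

(** By cnt_prodset the count is a sum over one small factor of the count of the
other one, for which lg (X / e) is still of size lg X. The sum of reciprocals of
the shifted prime powers brings in one more factor harmonic (lg X), and that of P
a factor lg X * psi, against the density 1 / lg of the shifted prime powers. *)
Lemma cnt_prodset_psi (P : pred nat) (C : R) s : 0 <= C ->
  (forall Y, (0 < Y)%N -> (cnt P Y)%:R <= Y%:R * (C * psi s (lg Y))) ->
  forall X, (0 < X)%N ->
  (cnt (prodset P shifted_prime_power) X)%:R <= X%:R * (2080 * C * psi s.+1 (lg X)).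
Proof.
move=> C0 HP X X0; set L : R := (lg X)%:R; set h := harmonic (lg X).
have L0 : 0 < L by rewrite ltr0n.
have h1 : 1 <= h by rewrite harmonic_ge1.
have h0 : 0 <= h by lra.
have hs0 n : 0 <= h ^+ n by rewrite exprn_ge0.
set q := Num.sqrt L; have q0 : 0 < q by rewrite sqrtr_gt0.
have q2 : q ^+ 2 = L by rewrite sqr_sqrtr // ltW.
have X0' : 0 < X%:R :> R by rewrite ltr0n.
have divX (e : nat) : (0 < e)%N -> (X %/ e)%:R <= X%:R / e%:R :> R.
  by move=> e0; rewrite ler_pdivlMr ?ltr0n // -natrM ler_nat leq_trunc_div.
have lgY (e : nat) : (0 < e)%N -> (e * e <= X)%N -> L <= 4 * (lg (X %/ e))%:R.
  by move=> e0 ee; rewrite -natrM ler_nat lg_divn_sqrt.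
have S1 : (\sum_(1 <= e < X.+1 | P e && (e * e <= X)%N) cnt shifted_prime_power (X %/ e))%:R <=
    1664 * C * X%:R * (h ^+ s.+1 / q).
  apply: (@le_trans _ _ (\sum_(1 <= e < X.+1 | P e) 416 * X%:R / L * e%:R^-1)).
    rewrite natr_sum [leRHS](bigID (fun e => e * e <= X)%N) /= -[leLHS]addr0 lerD //; last first.
      apply: sumr_ge0 => e _; apply: mulr_ge0; last by rewrite invr_ge0.
      exact: divr_ge0 (mulr_ge0 (ler0n R 416) (ltW X0')) (ltW L0).
    rewrite big_nat_cond [leRHS]big_nat_cond; apply: ler_sum => e /andP[/andP[e0 _] /andP[_ ee]].
    have := cnt_shifted_prime_power (X %/ e); rewrite -(ler_nat R) !natrM => H.
    have lY := lgY e e0 ee; have D := divX e e0.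
    set c : R := (cnt _ _)%:R in H *; set l : R := (lg (X %/ e))%:R in H lY *.
    have c0 : 0 <= c by exact: ler0n.
    rewrite mulrAC ler_pdivlMr // -mulrA.
    have := ler_wpM2l c0 lY; lra.
  rewrite -mulr_sumr -/(recip R P X).
  have rP := ler_recip_lg X (fun k => mulr_ge0 C0 (psi_ge0 s k)) HP.
  have K0 : 0 <= 416 * X%:R / L := divr_ge0 (mulr_ge0 (ler0n R 416) (ltW X0')) (ltW L0).
  apply: (le_trans (ler_wpM2l K0 rP)).
  rewrite -mulr_sumr; have := sum_psi s (lg X); rewrite -/L -/h -/q => sp.
  apply: (@le_trans _ _ (416 * X%:R / L * (2 * (C * (h ^+ s * (2 * q)))))).
    by rewrite ler_wpM2l // ler_wpM2l // ler_wpM2l.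
  rewrite -q2 [h ^+ s.+1]exprS; set H := h ^+ s.
  apply: (@le_trans _ _ (1664 * C * X%:R * (H / q))).
    by rewrite le_eqVlt; apply/orP; left; apply/eqP; field; rewrite gt_eqF.
  apply: ler_wpM2l; first exact: mulr_ge0 (mulr_ge0 (ler0n R 1664) C0) (ltW X0').
  apply: ler_wpM2r; first by rewrite invr_ge0 ltW.
  by rewrite ler_peMl ?hs0.
have S2 : (\sum_(1 <= b < X.+1 | shifted_prime_power b && (b * b <= X)%N) cnt P (X %/ b))%:R <=
    416 * C * X%:R * (h ^+ s.+1 / q).
  apply: (@le_trans _ _ (\sum_(1 <= b < X.+1 | shifted_prime_power b)
      2 * C * X%:R * h ^+ s / q * b%:R^-1)).
    have K0 : 0 <= 2 * C * X%:R * h ^+ s / q.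
      exact: divr_ge0 (mulr_ge0 (mulr_ge0 (mulr_ge0 (ler0n R 2) C0) (ltW X0')) (hs0 s)) (ltW q0).
    rewrite natr_sum [leRHS](bigID (fun e => e * e <= X)%N) /= -[leLHS]addr0 lerD //; last first.
      by apply: sumr_ge0 => e _; rewrite mulr_ge0 ?invr_ge0.
    rewrite big_nat_cond [leRHS]big_nat_cond; apply: ler_sum => b /andP[/andP[b0 _] /andP[_ bb]].
    have Y0 : (0 < X %/ b)%N by rewrite divn_gt0 // (leq_trans _ bb) // leq_pmulr.
    apply: (le_trans (HP _ Y0)).
    have lY := lgY b b0 bb; have D := divX b b0.
    set l : R := (lg (X %/ b))%:R in lY *.
    have ql : q <= 2 * Num.sqrt l.
      have -> : 2 * Num.sqrt l = Num.sqrt (4 * l) :> R.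
        rewrite sqrtrM ?ler0n // (_ : 4 = 2 ^+ 2) ?sqrtr_sqr ?normr_nat //.
        by rewrite expr2; lra.
      by rewrite ler_wsqrtr.
    have sl0 : 0 < Num.sqrt l by lra.
    have ps : psi s (lg (X %/ b)) <= 2 * (h ^+ s / q).
      rewrite /psi -/l.
      apply: (@le_trans _ _ (h ^+ s / Num.sqrt l)).
        rewrite ler_wpM2r ?invr_ge0 ?sqrtr_ge0 // lerXn2r ?nnegrE ?harmonic_ge0 //.
        by rewrite ler_harmonic // leq_lg // leq_div.
      rewrite mulrCA ler_wpM2l ?hs0 // -[2]invrK -invfM lef_pV2 ?posrE //; last by rewrite mulr_gt0.
      by rewrite mulrC ler_pdivrMr // mulrC.
    apply: (@le_trans _ _ (X%:R / b%:R * (C * (2 * (h ^+ s / q))))).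
      apply: ler_pM => //; first by rewrite mulr_ge0 ?psi_ge0.
      by rewrite ler_wpM2l.
    rewrite le_eqVlt; apply/orP; left; apply/eqP.
    have b1 : b%:R != 0 :> R by rewrite pnatr_eq0 -lt0n.
    have q1 : q != 0 by rewrite gt_eqF.
    by field; rewrite ?b1 ?q1.
  rewrite -mulr_sumr -/(recip R shifted_prime_power X).
  have K0 : 0 <= 2 * C * X%:R * h ^+ s / q.
    exact: divr_ge0 (mulr_ge0 (mulr_ge0 (mulr_ge0 (ler0n R 2) C0) (ltW X0')) (hs0 s)) (ltW q0).
  apply: (le_trans (ler_wpM2l K0 (recip_shifted_prime_power X))).
  rewrite -/h [h ^+ s.+1]exprS le_eqVlt; apply/orP; left; apply/eqP.
  by field; rewrite gt_eqF.
have := cnt_prodset P shifted_prime_power X; rewrite -(ler_nat R) natrD => le.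
apply: (le_trans le); apply: (le_trans (lerD S1 S2)).
by rewrite /psi -/h -/L -/q le_eqVlt; apply/orP; left; apply/eqP; field; rewrite gt_eqF.
Qed.
End ProductDensity.
(** * Negligible sequences *)

(** That is, c X = o(X). *)
Definition negligible (c : nat -> nat) : Prop :=
  forall k, exists X0, forall X, (X0 <= X)%N -> (k * c X <= X)%N.

Lemma negligible_le (c d : nat -> nat) :
  (forall X, c X <= d X)%N -> negligible d -> negligible c.
Proof.
move=> cd H k; have [X0 HX] := H k; exists X0 => X XX.
by rewrite (leq_trans _ (HX X XX)) // leq_mul2l cd orbT.
Qed.

Lemma negligibleD (c d : nat -> nat) :
  negligible c -> negligible d -> negligible (fun X => c X + d X)%N.
Proof.
move=> Hc Hd k; have [X0 H0] := Hc (2 * k)%N; have [X1 H1] := Hd (2 * k)%N.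
exists (maxn X0 X1) => X; rewrite geq_max => /andP[XX0 XX1].
by have := H0 X XX0; have := H1 X XX1; lia.
Qed.

Lemma negligible_sum (I : Type) (s : seq I) (c : I -> nat -> nat) :
  (forall i, negligible (c i)) -> negligible (fun X => \sum_(i <- s) c i X)%N.
Proof.
move=> H; elim: s => [|i s IH].
  by move=> k; exists 0%N => X _; rewrite big_nil muln0.
apply: negligible_le (negligibleD (H i) IH) => X.
by rewrite big_cons.
Qed.

Lemma poly_lt_exp (a N : nat) : exists m0, forall m, (m0 <= m)%N -> (N * m ^ a <= 2 ^ m)%N.
Proof.
exists (N * a.+1 ^ a.+1)%N => m mN.
pose x := (m %/ a.+1)%N.
have mx : (m <= a.+1 * x.+1)%N by rewrite mulnC ltnW // ltn_ceil.
have e1 : (x.+1 ^ a.+1 <= 2 ^ m)%N.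
  apply: (@leq_trans ((2 ^ x) ^ a.+1)); first by rewrite leq_exp2r // ltn_expl.
  by rewrite -expnM leq_exp2l // leq_trunc_div.
have [m0|m0] := posnP m.
  move: mN; rewrite m0 leqn0 muln_eq0 expn_eq0 /= orbF => /eqP ->.
  by rewrite mul0n.
have e2 : (m ^ a.+1 <= a.+1 ^ a.+1 * x.+1 ^ a.+1)%N by rewrite -expnMn leq_exp2r.
rewrite -(@leq_pmul2l (a.+1 ^ a.+1)) ?expn_gt0 //.
apply: (@leq_trans (m ^ a.+1)).
  by rewrite [leqRHS]expnS mulnA leq_mul2r mulnC mN orbT.
by rewrite (leq_trans e2) // leq_mul2l e1 orbT.
Qed.

(** Products of an even3 number with s shifted prime powers. *)
Fixpoint even3_times (s : nat) : pred nat :=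
  if s is s'.+1 then prodset (even3_times s') shifted_prime_power else even3.

(** A power of log log X is negligible against sqrt (log X). *)
Lemma negligible_even3_times (R : realType) s : negligible (cnt (even3_times s)).
Proof.
have [C C0 HC] : exists2 C : R, 0 <= C & forall X, (0 < X)%N ->
    (cnt (even3_times s) X)%:R <= X%:R * (C * psi R s (lg X)).
  elim: s => [|s [C C0 IH]].
    exists 880; first exact: ler0n; move=> X X0.
    apply: le_trans (cnt_even3 R X0) _.
    by rewrite /psi expr0 mul1r mulrA (mulrC X%:R).
  exists (2080 * C); first exact: mulr_ge0 (ler0n R 2080) C0.
  by move=> X X0; apply: cnt_prodset_psi.
move=> k; pose c := Num.truncn (k%:R * C); have kC : k%:R * C < c.+1%:R.
  by rewrite /c truncnS_gt.
have [m0 Hm] := poly_lt_exp (2 * s) (c.+1 ^ 2 * 2).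
exists (2 ^ (2 ^ m0))%N => X XX; have X0 : (0 < X)%N by rewrite (leq_trans _ XX) ?expn_gt0.
pose L := lg X; pose m := lg L.
have Lm0 : (2 ^ m0 <= L)%N by rewrite -(leq_exp2l _ _ (ltnSn 1)) (leq_trans XX) // ltnW // ltn_exp_lg.
have m0m : (m0 <= m)%N by rewrite -(leq_exp2l _ _ (ltnSn 1)) (leq_trans Lm0) // ltnW // ltn_exp_lg.
have HL : (c.+1 ^ 2 * m ^ (2 * s) <= L)%N.
  have := Hm m m0m; have := leq_exp_lg (_ : 0 < L)%N; rewrite -/m => /(_ isT) mL.
  have -> : (2 ^ m = 2 * 2 ^ m.-1)%N by rewrite -expnS.
  rewrite mulnAC (mulnC _ 2) leq_pmul2l // => h; exact: leq_trans h mL.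
have sqL : c.+1%:R * m%:R ^+ s <= Num.sqrt L%:R :> R.
  rewrite -[leLHS]ger0_norm; last by rewrite mulr_ge0 ?exprn_ge0.
  rewrite -sqrtr_sqr ler_sqrt ?ler0n //.
  by rewrite exprMn -exprM -!natrX -natrM ler_nat (mulnC s).
have L0 : 0 < Num.sqrt L%:R :> R by rewrite sqrtr_gt0 ltr0n.
rewrite -(ler_nat R) natrM.
apply: (le_trans (ler_wpM2l (ler0n R k) (HC X X0))).
rewrite mulrCA ler_piMr // mulrA /psi -/L mulrA ler_pdivrMr // mul1r.
apply: le_trans sqL; apply: ler_pM.
- exact: mulr_ge0.
- by rewrite exprn_ge0 // harmonic_ge0.
- exact: ltW.
- by rewrite lerXn2r ?nnegrE ?harmonic_ge0 ?ler0n // harmonic_lg.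
Qed.

(** Dominated convergence: c i X / X tends to 0 for each i and is dominated by the
summable 1 / w i. *)
Lemma dominated_negligible (R : realType) (T : eqType) (D : pred T) (w : T -> nat)
    (c : T -> nat -> nat) (B : R) :
  (forall s, uniq s -> all D s -> \sum_(i <- s) (w i)%:R^-1 <= B) ->
  (forall i, D i -> 0 < w i)%N ->
  (forall i X, D i -> c i X * w i <= X)%N ->
  (forall i, D i -> negligible (c i)) ->
  forall k, exists X0, forall X, (X0 <= X)%N ->
    forall s, uniq s -> all D s -> (k * (\sum_(i <- s) c i X) <= X)%N.
Proof.
move=> HB w0 cw neg k.
pose E : set R := [set x : R | exists s, [/\ uniq s, all D s & x = \sum_(i <- s) (w i)%:R^-1]]%classic.
have supE : has_sup E.
  split; first by exists 0, [::]; split=> //; rewrite big_nil.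
  by exists B => _ [s [us Ds ->]]; exact: HB.
have e0 : 0 < (2 * k.+1)%:R^-1 :> R by rewrite invr_gt0 ltr0n.
(* s0 carries all but at most 1 / (2 (k + 1)) of the total weight. *)
have [_ [s0 [us0 Ds0 ->]] H0] := sup_adherent e0 supE.
have tail s : uniq s -> all D s -> all (fun i => i \notin s0) s ->
    \sum_(i <- s) (w i)%:R^-1 <= (2 * k.+1)%:R^-1 :> R.
  move=> us Ds ns; have : E (\sum_(i <- s0 ++ s) (w i)%:R^-1).
    exists (s0 ++ s); rewrite cat_uniq us0 us all_cat Ds0 Ds andbT -all_predC.
    by split=> //=; apply/allP => i /(allP ns).
  move=> /(ub_le_sup supE.2); rewrite big_cat /= => h.
  move: H0 h; set a := \sum_(i <- s0) _; set b := \sum_(i <- s) _; set e := _^-1.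
  by move=> H0 h; lra.
have [X0 HX0] : exists X0, forall X, (X0 <= X)%N -> (2 * k * (\sum_(i <- s0) c i X) <= X)%N.
  have : negligible (fun X => \sum_(i <- s0) (if D i then c i X else 0%N))%N.
    apply: negligible_sum => i; case: (boolP (D i)) => [Di|_]; first exact: neg.
    by move=> n; exists 0%N => X _; rewrite muln0.
  move=> /(_ (2 * k)%N)[X0 HX]; exists X0 => X XX.
  have -> : (\sum_(i <- s0) c i X = \sum_(i <- s0) (if D i then c i X else 0))%N; last exact: HX.
  by apply: eq_big_seq => i /(allP Ds0) ->.
exists X0 => X XX s us Ds; rewrite (bigID (mem s0)) /=.
have le1 : (\sum_(i <- s | i \in s0) c i X <= \sum_(i <- s0) c i X)%N.
  rewrite -big_filter; apply: (leq_sum_cover (g := id)); first exact: filter_uniq.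
  by move=> i; rewrite mem_filter map_id => /andP[].
have le2 : (2 * k * (\sum_(i <- s | i \notin s0) c i X) <= X)%N.
  rewrite -big_filter; set t := [seq i <- s | i \notin s0].
  have Dt : all D t by apply/allP => i; rewrite mem_filter => /andP[_ /(allP Ds)].
  have ht := tail t (filter_uniq _ us) Dt (filter_all _ _).
  have : (\sum_(i <- t) c i X)%:R <= X%:R * \sum_(i <- t) (w i)%:R^-1 :> R.
    rewrite natr_sum mulr_sumr big_seq [leRHS]big_seq; apply: ler_sum => i it.
    have Di := allP Dt i it.
    by rewrite ler_pdivlMr ?ltr0n ?w0 // -natrM ler_nat cw.
  move=> h; have := le_trans h (ler_wpM2l (ler0n R X) ht).
  rewrite ler_pdivlMr ?ltr0n // -natrM ler_nat => h2.
  by apply: leq_trans h2; rewrite mulnC leq_mul2l leq_mul2l leqnSn !orbT.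
have := HX0 X XX; nia.
Qed.

(** * The orders of unit groups have density zero *)

Definition mersenne_product (F : nat) : pred nat := fun m =>
  `[< exists fs : seq nat, all (fun f => 1 < f < F)%N fs /\ m = (\prod_(f <- fs) (2 ^ f).-1)%N >].

Lemma mersenne_product_gt0 F m : mersenne_product F m -> (0 < m)%N.
Proof.
move=> /asboolP[fs [ffs ->]]; rewrite big_seq; apply: prodn_cond_gt0 => f /(allP ffs)/andP[f1 _].
by rewrite -ltnS prednK ?expn_gt0 // -(expn0 2) ltn_exp2l // ltnW.
Qed.

(** The Euler product over 1 < f < F of 1 / (1 - 1 / (2 ^ f - 1)), evaluated through the
recursion that removes one factor 2 ^ F0 - 1. The bound 3 / (1 + 8 / 2 ^ F) is
chosen so that the recursion preserves it. *)
Lemma recip_mersenne_product (R : realType) F X : recip R (mersenne_product F) X <= 3.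
Proof.
have lift n : (n <= 2)%N -> recip R (mersenne_product n) X <= 1.
  move=> n2; rewrite /recip -big_filter.
  apply: (@le_trans _ _ (\sum_(i <- [:: 1%N]) i%:R^-1)); last by rewrite big_seq1 invr1.
  apply: (ler_sum_cover (g := id)) => [x||m]; first by rewrite invr_ge0.
    by rewrite filter_uniq ?iota_uniq.
  rewrite mem_filter => /andP[/asboolP[[|f fs] [/= ff ->]] _]; first by rewrite big_nil inE.
  by move: ff => /andP[/andP[f1 fn]]; lia.
suff H k : recip R (mersenne_product k.+2) X <= 3 / (1 + 4 * (2 / (2 ^ k.+2)%:R)).
  have l13 : 1 <= 3 :> R by lra.
  case: F => [|[|k]]; [exact: le_trans (lift 0%N isT) l13|exact: le_trans (lift 1%N isT) l13|].
  apply: (le_trans (H k)); rewrite ler_pdivrMr; last first.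
    by rewrite ltr_pwDl // mulr_ge0 // mulr_ge0 // invr_ge0.
  by rewrite ler_peMr // lerDl mulr_ge0 // mulr_ge0 // invr_ge0.
elim: k => [|k IH].
  apply: (le_trans (lift 2%N (leqnn _))).
  by rewrite (_ : (2 ^ 2)%:R = 4) // ler_pdivlMr; lra.
set F0 := k.+2 in IH *; set q := (2 ^ F0).-1.
have F01 : (1 < F0)%N by [].
have qE : q.+1 = (2 ^ F0)%N by rewrite /q prednK ?expn_gt0.
have q3 : (3 <= q)%N by rewrite -ltnS qE (@leq_exp2l 2 2).
have rec : recip R (mersenne_product F0.+1) X <=
    recip R (mersenne_product F0) X + q%:R^-1 * recip R (mersenne_product F0.+1) X.
  rewrite /recip mulr_sumr -[leLHS]big_filter -[X in _ <= X + _]big_filter -[X in _ <= _ + X]big_filter.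
  set L1 := [seq i <- index_iota 1 X.+1 | mersenne_product F0.+1 i].
  set L0 := [seq i <- index_iota 1 X.+1 | mersenne_product F0 i].
  apply: (@le_trans _ _ (\sum_(i <- L0 ++ [seq (q * i)%N | i <- L1]) i%:R^-1)); last first.
    rewrite big_cat big_map /= lerD2l; apply: ler_sum => i _.
    by rewrite natrM invfM.
  apply: (ler_sum_cover (g := id)) => [x||m]; first by rewrite invr_ge0.
    by rewrite filter_uniq ?iota_uniq.
  rewrite map_id mem_filter mem_index_iota mem_cat => /andP[Mm /andP[m0 mX]].
  have /asboolP[fs [ffs mE]] := Mm.
  have [Ff|nF] := boolP (F0 \in fs); apply/orP; [right|left].
    apply/mapP; exists (\prod_(f <- rem F0 fs) (2 ^ f).-1)%N; last first.
      by rewrite mE (big_rem F0).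
    have mE' : m = (q * \prod_(f <- rem F0 fs) (2 ^ f).-1)%N by rewrite mE (big_rem F0).
    rewrite mem_filter mem_index_iota; apply/andP; split.
      apply/asboolP; exists (rem F0 fs); split=> //; apply/allP => f /mem_rem.
      exact: (allP ffs).
    move: m0; rewrite mE' muln_gt0 => /andP[q0 ->] /=.
    by rewrite (leq_ltn_trans _ mX) // mE' leq_pmull.
  rewrite mem_filter mem_index_iota m0 mX !andbT; apply/asboolP; exists fs; split=> //.
  apply/allP => f ff; have := allP ffs f ff => /andP[f1]; rewrite ltnS leq_eqVlt f1 => /orP[/eqP fF|->] //.
  by rewrite -fF ff in nF.
set s1 := recip R _ X in rec *; set s0 := recip R _ X in rec IH.
have s10 : 0 <= s1 := recip_ge0 _ _ _.
have s00 : 0 <= s0 := recip_ge0 _ _ _.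
have -> : (2 ^ F0.+1)%:R = 2 * (q%:R + 1) :> R by rewrite natr1 qE expnS natrM.
have E0 : (2 ^ F0)%:R = q%:R + 1 :> R by rewrite natr1 qE.
rewrite E0 in IH; have q3' : 3 <= q%:R :> R by rewrite ler_nat.
set x : R := q%:R in rec IH q3' *.
have x0 : 0 < x by lra.
have rec' : s1 * (x - 1) <= s0 * x.
  have : s1 * x <= (s0 + x^-1 * s1) * x by rewrite ler_wpM2r // ltW.
  rewrite mulrDl -mulrA (mulrC s1 x) mulrA mulVf ?gt_eqF // mul1r; lra.
have E1 : 3 / (1 + 4 * (2 / (x + 1))) = 3 * (x + 1) / (x + 9).
  by field; rewrite !gt_eqF //; lra.
have E2 : 3 / (1 + 4 * (2 / (2 * (x + 1)))) = 3 * (x + 1) / (x + 5).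
  by field; rewrite !gt_eqF //; lra.
rewrite E1 in IH; rewrite E2 ler_pdivlMr; last by lra.
rewrite ler_pdivlMr in IH; last by lra.
nra.
Qed.

Definition mersenne_any : pred nat := fun m => `[< exists F, mersenne_product F m >].

Lemma mersenne_product_mono F F' m : (F <= F')%N ->
  mersenne_product F m -> mersenne_product F' m.
Proof.
move=> FF /asboolP[fs [ffs ->]]; apply/asboolP; exists fs; split=> //.
by apply/allP => f /(allP ffs)/andP[-> /leq_trans->].
Qed.

Lemma sum_mersenne_any (R : realType) (s : seq nat) :
  uniq s -> all mersenne_any s -> \sum_(i <- s) i%:R^-1 <= 3 :> R.
Proof.
move=> us Ms; have [F HF] : exists F, all (mersenne_product F) s.
  elim: s {us} Ms => [|m s IH]; first by exists 0%N.
  move=> /= /andP[/asboolP[F mF] /IH[F' H]]; exists (maxn F F').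
  rewrite /= (mersenne_product_mono (leq_maxl _ _) mF) /=.
  by apply/allP => x /(allP H); apply: mersenne_product_mono; rewrite leq_maxr.
pose X := (\max_(m <- s) m)%N.
apply: le_trans (recip_mersenne_product R F X).
rewrite /recip -[leRHS]big_filter; apply: (ler_sum_cover (g := id)) => // m ms.
rewrite map_id mem_filter (allP HF) // mem_index_iota (mersenne_product_gt0 (allP HF m ms)).
by rewrite ltnS /X (@leq_bigmax_seq _ _ predT id).
Qed.

(** The odd prime powers contribute even numbers q - 1 and the even ones Mersenne
numbers. *)
Lemma unit_order_factor d (qs : seq nat) : even3 d -> all prime_power qs ->
  exists s e m, [/\ (d * \prod_(q <- qs) q.-1 = e * m)%N, even3_times s e,
    mersenne_any m, (0 < e)%N & (2 ^ s %| e)%N].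
Proof.
move=> d3; elim: qs => [_|q qs IH /= /andP[qq /IH[s [e [m [E es mm e0 se]]]]]].
  exists 0%N, d, 1%N; rewrite big_nil dvd1n; split=> //; last by case/andP: d3.
  by apply/asboolP; exists 0%N; apply/asboolP; exists [::]; rewrite big_nil.
have /andP[q1 /p_natP[f qf]] := qq.
have q0 : (0 < q.-1)%N by rewrite -ltnS prednK // ltnW.
have [oq|eq] := boolP (odd q).
  exists s.+1, (e * q.-1)%N, m; split=> //.
  - by rewrite big_cons mulnCA E; ring.
  - apply/prodsetP; first by rewrite muln_gt0 e0.
    by exists e, q.-1; split=> //; rewrite /shifted_prime_power prednK // ltnW.
  - by rewrite muln_gt0 e0.
  - by rewrite expnSr dvdn_mul // dvdn2 -subn1 oddB ?oq // ltnW.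
have p2 : pdiv q = 2%N.
  have : (2 %| q)%N by rewrite dvdn2.
  move=> /(pdiv_min_dvd (ltnSn 1)) h; apply/eqP; rewrite eqn_leq h.
  by rewrite prime_gt1 // pdiv_prime.
rewrite p2 in qf; exists s, e, (q.-1 * m)%N; split=> //.
  by rewrite big_cons mulnCA E; ring.
have /asboolP[F /asboolP[fs [ffs mE]]] := mm.
apply/asboolP; exists (maxn F f.+1); apply/asboolP.
case: f qf => [|[|f]] qf.
- by rewrite qf in q1.
- exists fs; rewrite qf /= mul1n; split=> //.
  by apply/allP => g /(allP ffs)/andP[-> /leq_trans->] //; rewrite leq_maxl.
- exists (f.+2 :: fs); rewrite big_cons -mE -qf /= leq_max leqnn orbT; split=> //.
  by apply/allP => g /(allP ffs)/andP[-> /leq_trans->] //; rewrite leq_maxl.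
Qed.

Definition unit_orderb : pred nat := fun n => `[< unit_order n >].

(** For each Mersenne product m the number of products e m is negligible, and it is
at most X / m, which is summable. *)
Lemma negligible_even3_mersenne (R : realType) s :
  negligible (cnt (prodset (even3_times s) mersenne_any)).
Proof.
pose c m X := cnt (even3_times s) (X %/ m).
have neg m : mersenne_any m -> negligible (c m).
  move=> _; apply: negligible_le (negligible_even3_times R s) => X.
  by rewrite leq_cnt // leq_div.
have cw m X : mersenne_any m -> (c m X * m <= X)%N.
  by move=> _; rewrite (leq_trans _ (leq_trunc_div X m)) // leq_mul2r cnt_le orbT.
have w0 m : mersenne_any m -> (0 < m)%N.
  by move=> /asboolP[F]; exact: mersenne_product_gt0.
move=> k; have [X0 H] := dominated_negligible (@sum_mersenne_any R) w0 cw neg k.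
exists X0 => X XX; pose ms := [seq m <- index_iota 1 X.+1 | mersenne_any m].
apply: leq_trans (H X XX ms _ _); rewrite ?filter_uniq ?iota_uniq ?filter_all //.
rewrite leq_mul2l; apply/orP; right.
pose J := [seq (m, e) | m <- ms, e <- [seq e <- index_iota 1 (X %/ m).+1 | even3_times s e]].
have -> : (\sum_(m <- ms) c m X = \sum_(j <- J) 1)%N.
  by rewrite /J big_allpairs_dep; apply: eq_bigr => m _; rewrite big_filter.
rewrite /cnt -big_filter; apply: (leq_sum_cover (g := fun j : nat * nat => (j.2 * j.1)%N)).
  by rewrite filter_uniq ?iota_uniq.
move=> n; rewrite mem_filter mem_index_iota ltnS => /andP[Pn /andP[n0 nX]].
have [e [m [E Pe Mm]]] := prodsetP _ _ n0 Pn.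
have /andP[e0 m0] : (0 < e)%N && (0 < m)%N by rewrite -muln_gt0 -E.
apply/mapP; exists (m, e) => //; apply/allpairsPdep; exists m, e; split=> //.
  by rewrite mem_filter Mm mem_index_iota m0 ltnS (leq_trans _ nX) // E leq_pmull.
by rewrite mem_filter Pe mem_index_iota e0 ltnS leq_divRL // -E.
Qed.

(** With more than r odd prime powers the number is divisible by 2 ^ (r + 1), which
happens with density at most 2 ^ -(r + 1). *)
Lemma negligible_unit_order (R : realType) : negligible (cnt unit_orderb).
Proof.
move=> k; pose r := k.
have : negligible (fun X => \sum_(s <- iota 0 r.+1) cnt (prodset (even3_times s) mersenne_any) X)%N.
  by apply: negligible_sum => s; exact: negligible_even3_mersenne R s.
move=> /(_ (2 * k)%N)[X0 H]; exists X0 => X XX; have {}H := H X XX.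
have le : (cnt unit_orderb X <=
    \sum_(s <- iota 0 r.+1) cnt (prodset (even3_times s) mersenne_any) X +
    cnt (fun n => 2 ^ r.+1 %| n)%N X)%N.
  pose Q n := has (fun s => prodset (even3_times s) mersenne_any n) (iota 0 r.+1).
  apply: (@leq_trans (cnt Q X + cnt (fun n => 2 ^ r.+1 %| n)%N X)).
    apply: leq_trans (cntU _ _ _); apply: sub_cnt => n /andP[n0 _] /asboolP[d [qs [nE [d0 dE] qq]]].
    have d3 : even3 d.
      rewrite /even3 d0; apply/allP => p; rewrite mem_primes => /andP[pp _].
      by apply/implyP => /eqP; exact: dE.
    have [s [e [m [E es mm e0 se]]]] := unit_order_factor d3 qq.
    rewrite /=; have [sr|rs] := leqP s r.
      apply/orP; left; apply/hasP; exists s; first by rewrite mem_iota add0n ltnS.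
      by apply/prodsetP => //; exists e, m; rewrite nE E.
    apply/orP; right; rewrite nE E dvdn_mulr // (dvdn_trans _ se) // dvdn_exp2l //.
  rewrite leq_add2r {H}; elim: (iota 0 r.+1) @Q => [|s l IH] Q.
    by rewrite big_nil /cnt big1 // => n.
  by rewrite big_cons (leq_trans (cntU _ _ _)) // leq_add2l.
have le2 : (2 ^ r.+1 * cnt (fun n => 2 ^ r.+1 %| n) X <= X)%N.
  have q0 : (0 < 2 ^ r.+1)%N by rewrite expn_gt0.
  have := leq_trans (cnt_dvdn predT X q0) (cnt_le _ _).
  rewrite (eq_bigl (fun n => 2 ^ r.+1 %| n)%N) => [h|n]; last by rewrite andbT.
  by apply: leq_trans (leq_trunc_div X (2 ^ r.+1)); rewrite mulnC leq_mul2r h orbT.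
have kr : (2 * k <= 2 ^ r.+1)%N by rewrite expnS leq_mul2l ltnW ?orbT // ltn_expl.
set a := (\sum_(s <- _) _)%N in H le; set b := cnt (fun n => 2 ^ r.+1 %| n)%N X in le le2.
have : (2 * k * b <= X)%N by apply: leq_trans (leq_mul kr (leqnn b)) le2.
by move: H le; set c := cnt unit_orderb X; nia.
Qed.

(** * Types ordered by their tails *)

(** The smallest order of a group whose type has the tail t: the first part must be
a multiple of the head of t. *)
Definition tail_weight (t : seq nat) : nat := (head 1 t * tprod t)%N.

Definition tails (X : nat) : seq (seq nat) := [seq t <- types X | tail_weight t <= X]%N.

(** A type is a tail t together with n, the quotient of the first part by the head
of t; the trivial type is the one with n = 1 and empty tail. *)
Definition extend_type (t : seq nat) (n : nat) : seq nat :=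
  if (n * head 1 t == 1)%N then [::] else (n * head 1 t)%N :: t.

Lemma head_gt0 t : divisor_chain t -> (0 < head 1 t)%N.
Proof. by case: t => // d t /and3P[/ltnW]. Qed.

Lemma tail_weight_gt0 t : divisor_chain t -> (0 < tail_weight t)%N.
Proof. by move=> ct; rewrite muln_gt0 head_gt0 // tprod_gt0. Qed.

Lemma tails_uniq X : uniq (tails X).
Proof. by rewrite filter_uniq ?types_uniq. Qed.

Lemma mem_tails X t : (t \in tails X) = divisor_chain t && (tail_weight t <= X)%N.
Proof.
rewrite mem_filter mem_types andbC -andbA; case ct: (divisor_chain t) => //=.
case wX: (tail_weight t <= X)%N; rewrite ?andbF // andbT.
by rewrite (leq_trans _ wX) // leq_pmull // head_gt0.
Qed.

Lemma extend_type_chain t n : divisor_chain t -> (0 < n)%N ->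
  divisor_chain (extend_type t n) /\ tprod (extend_type t n) = (n * tail_weight t)%N.
Proof.
move=> ct n0; have h0 := head_gt0 ct; rewrite /extend_type; case: eqP => [nh|/eqP nh].
  have h1 : head 1%N t = 1%N by move/eqP: nh; rewrite muln_eq1 => /andP[_ /eqP].
  have n1 : n = 1%N by move: nh; rewrite h1 muln1.
  have t0 : t = [::].
    by case: t ct h1 {h0 nh} => // d t /and3P[d1 _ _] /= E; rewrite E in d1.
  by rewrite n1 t0 /tail_weight /tprod big_nil.
split; last by rewrite tprod_cons mulnA.
by apply/and3P; split; rewrite ?dvdn_mull // ltn_neqAle eq_sym nh muln_gt0 n0.
Qed.

Lemma extend_type_inj t u m n : divisor_chain t -> divisor_chain u ->
  (0 < m)%N -> (0 < n)%N -> extend_type t m = extend_type u n -> t = u /\ m = n.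
Proof.
move=> ct cu m0 n0; rewrite /extend_type.
have nil v k : divisor_chain v -> (k * head 1 v = 1)%N -> v = [::] /\ k = 1%N.
  move=> cv /eqP; rewrite muln_eq1 => /andP[/eqP -> /eqP h1]; split=> //.
  by case: v cv h1 => // d v /and3P[d1 _ _] /= E; rewrite E in d1.
case: eqP => [E1|_]; case: eqP => [E2|_] //.
  by have [-> ->] := nil _ _ ct E1; have [-> ->] := nil _ _ cu E2.
case=> E tu; rewrite tu in E ct *; split=> //; apply/eqP.
by rewrite -(eqn_pmul2r (head_gt0 cu)) E.
Qed.

Lemma extend_type_onto t : divisor_chain t ->
  exists u n, [/\ divisor_chain u, (0 < n)%N & t = extend_type u n].
Proof.
case: t => [_|d t ct]; first by exists [::], 1%N.
have /and3P[d1 hd ct'] := ct; exists t, (d %/ head 1 t)%N; split=> //.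
  by rewrite divn_gt0 ?head_gt0 // dvdn_leq // ltnW.
by rewrite /extend_type divnK // gtn_eqF.
Qed.

Definition tail_pairs (X : nat) : seq (seq nat * nat) :=
  [seq (t, n) | t <- tails X, n <- index_iota 1 (X %/ tail_weight t).+1].

Lemma mem_tail_pairs X t n : ((t, n) \in tail_pairs X) =
  [&& divisor_chain t, 0 < n & n * tail_weight t <= X]%N.
Proof.
apply/allpairsPdep/and3P => [[u [m [uX mX [-> ->]]]]|[ct n0 nX]].
  move: uX mX; rewrite mem_tails mem_index_iota ltnS => /andP[cu _] /andP[m0 mX]; split=> //.
  by rewrite -leq_divRL // tail_weight_gt0.
exists t, n; split=> //; rewrite ?mem_tails ?mem_index_iota ?ct ?n0 /=.
  by rewrite (leq_trans _ nX) // leq_pmull.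
by rewrite ltnS leq_divRL // tail_weight_gt0.
Qed.

(** So the types of product at most X are the pairs (t, n) with
n * tail_weight t at most X. *)
Lemma perm_types_tails X :
  perm_eq (types X) [seq extend_type p.1 p.2 | p <- tail_pairs X].
Proof.
apply: uniq_perm; first exact: types_uniq.
  rewrite map_inj_in_uniq.
    rewrite allpairs_uniq_dep ?tails_uniq // => [t _|[t m] [u n] _ _ /= [-> ->]//].
    exact: iota_uniq.
  move=> [t m] [u n]; rewrite !mem_tail_pairs => /and3P[ct m0 _] /and3P[cu n0 _] /= E.
  by have [-> ->] := extend_type_inj ct cu m0 n0 E.
move=> t; apply/idP/mapP => [|[[u n]]].
  rewrite mem_types => /andP[ct tX].
  have [u [n [cu n0 E]]] := extend_type_onto ct; exists (u, n) => //.
  by rewrite mem_tail_pairs cu n0 -(extend_type_chain cu n0).2 -E.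
rewrite mem_tail_pairs => /and3P[cu n0 nX] -> /=.
by rewrite mem_types; have [-> ->] := extend_type_chain cu n0.
Qed.

Lemma count_types (P : pred (seq nat)) X :
  count P (types X) =
  (\sum_(t <- tails X) cnt (fun n => P (extend_type t n)) (X %/ tail_weight t))%N.
Proof.
rewrite (seq.permP (perm_types_tails X)) count_map -sum1_count big_mkcond /=.
rewrite /tail_pairs big_allpairs_dep; apply: eq_bigr => t _.
by rewrite /cnt [RHS]big_mkcond.
Qed.

Lemma size_types X : size (types X) = (\sum_(t <- tails X) X %/ tail_weight t)%N.
Proof.
rewrite -count_predT count_types; apply: eq_bigr => t _.
by rewrite cntE count_predT size_iota.
Qed.

Lemma leq_size_types X : (X <= size (types X))%N.
Proof.
have -> : X = size [seq extend_type [::] n | n <- iota 1 X] by rewrite size_map size_iota.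
apply: uniq_leq_size.
  rewrite map_inj_in_uniq ?iota_uniq // => m n; rewrite !mem_iota => /andP[m0 _] /andP[n0 _].
  by move=> /(extend_type_inj (isT : divisor_chain [::]) (isT : divisor_chain [::]) m0 n0)[].
move=> t /mapP[n]; rewrite mem_iota add1n ltnS => /andP[n0 nX] ->.
have [ct pt] := extend_type_chain (isT : divisor_chain [::]) n0.
by rewrite mem_types ct pt /tail_weight /tprod big_nil !muln1 size_map size_iota.
Qed.

(** With floor (X / (2 w)) = floor (X / w) / 2 up to 1/2, the error is at most the
number of tails. *)
Lemma size_types_half X :
  (2 * size (types (X %/ 2)) <= size (types X) <= 2 * size (types (X %/ 2)) + size (tails X))%N.
Proof.
have half : size (types (X %/ 2)) = (\sum_(t <- tails X) (X %/ 2) %/ tail_weight t)%N.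
  rewrite size_types [RHS](bigID (fun t => t \in tails (X %/ 2)%N)) /= [X in (_ + X)%N]big1_seq.
    rewrite addn0 -[RHS]big_filter; apply: perm_big; apply: uniq_perm.
    - exact: tails_uniq.
    - by rewrite filter_uniq ?tails_uniq.
    - move=> t; rewrite [RHS]mem_filter !mem_tails; case ct: (divisor_chain t) => //=.
      by case h: (tail_weight t <= X %/ 2)%N => //=; rewrite (leq_trans h) // leq_div.
  move=> t /andP[nt]; rewrite mem_tails => /andP[ct _]; apply: divn_small.
  by move: nt; rewrite mem_tails ct /= -ltnNge.
rewrite half size_types -sum1_size !big_distrr /= -big_split /=; apply/andP; split.
  apply: leq_sum => t _; rewrite divnAC; apply: leq_trans (leq_trunc_div _ 2).
  by rewrite mulnC.
apply: leq_sum => t _; rewrite divnAC.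
by have := divn_eq (X %/ tail_weight t) 2; have := ltn_pmod (X %/ tail_weight t) (ltn0Sn 1); lia.
Qed.

Section Summability.
Variable R : realType.

Lemma sum_inv_powers j N :
  \sum_(1 <= n < N.+1) (n ^ j.+2)%:R^-1 <= 1 + 2 / (2 ^ j.+1)%:R :> R.
Proof.
case: N => [|N]; first by rewrite big_geq // addr_ge0 // divr_ge0.
rewrite big_ltn // exp1n invr1 lerD2l.
have S2 := sum_inv_squares R N.+1; rewrite big_ltn // (_ : (1 ^ 2)%N = 1%N) // invr1 in S2.
have {}S2 : \sum_(2 <= n < N.+2) (n ^ 2)%:R^-1 <= 1 :> R by lra.
have c0 : 0 <= ((2 ^ j)%:R : R)^-1 by rewrite invr_ge0.
apply: (@le_trans _ _ ((2 ^ j)%:R^-1 * \sum_(2 <= n < N.+2) (n ^ 2)%:R^-1)).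
  rewrite mulr_sumr big_nat_cond [leRHS]big_nat_cond; apply: ler_sum => n /andP[/andP[n2 _] _].
  have n0 : (0 < n)%N by apply: leq_trans n2.
  have p0 : (0 < 2 ^ j * n ^ 2)%N by rewrite muln_gt0 !expn_gt0 n0.
  have le : (2 ^ j * n ^ 2 <= n ^ j.+2)%N.
    rewrite -[j.+2]addn2 expnD leq_mul2r; apply/orP; right.
    by case: (j) => // i; rewrite leq_exp2r.
  rewrite -invfM -natrM lef_pV2 ?ler_nat // posrE ltr0n //.
  exact: leq_trans p0 le.
rewrite expnS natrM invfM mulrA mulfV ?pnatr_eq0 // mul1r.
by rewrite -[leRHS]mulr1 ler_wpM2l.
Qed.

(** The weights that arise by iterating the passage to the tail: the exponent of
the head grows by one each time a part is removed. *)
Definition type_weight (j : nat) (t : seq nat) : nat := (head 1 t ^ j * tprod t)%N.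

Lemma type_weight_extend j t n : divisor_chain t -> (0 < n)%N ->
  type_weight j (extend_type t n) = (n ^ j.+1 * type_weight j.+1 t)%N.
Proof.
move=> ct n0; have [ce pe] := extend_type_chain ct n0.
rewrite /type_weight pe /tail_weight.
have -> : head 1%N (extend_type t n) = (n * head 1 t)%N.
  by rewrite /extend_type; case: eqP => [->|].
by rewrite expnMn !expnS; ring.
Qed.

(** By induction on the length, a sum over types is a sum over the quotient n of
the first part, of 1 / n ^ (j + 2), times the sum for the tails with j + 1. The
factors 1 + 2 / 2 ^ (j + 1) multiply to a convergent product, bounded by an
exponential. *)
Lemma sum_inv_type_weight j (s : seq (seq nat)) : uniq s -> all divisor_chain s ->
  \sum_(t <- s) (type_weight j.+1 t)%:R^-1 <= expR (4 / (2 ^ j.+1)%:R) :> R.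
Proof.
have [L] : exists L, all (fun t => size t <= L)%N s.
  exists (\max_(t <- s) size t)%N; apply/allP => t ts.
  exact: (@leq_bigmax_seq _ _ predT size).
have e1 i : 1 <= expR (4 / (2 ^ i)%:R) :> R.
  by rewrite -expR0 ler_expR divr_ge0.
elim: L j s => [|L IH] j s Ls us cs.
  apply: le_trans (e1 _); apply: (@le_trans _ _ (\sum_(t <- [:: [::]]) (type_weight j.+1 t)%:R^-1)).
    apply: (ler_sum_cover (g := id)) => // t ts.
    by rewrite inE -size_eq0 -leqn0 (allP Ls).
  by rewrite big_seq1 /type_weight /tprod big_nil /= exp1n invr1.
pose s' := undup [seq t' <- map behead s | divisor_chain t'].
pose N := (\max_(t <- s) head 1 t)%N.
have cs' : all divisor_chain s'.
  by apply/allP => t'; rewrite mem_undup mem_filter => /andP[].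
have Ls' : all (fun t => size t <= L)%N s'.
  apply/allP => t'; rewrite mem_undup mem_filter => /andP[_ /mapP[t ts ->]].
  by rewrite size_behead -subn1 leq_subLR add1n (allP Ls).
have {}IH := IH j.+1 s' Ls' (undup_uniq _) cs'.
pose J := [seq (t, n) | t <- s', n <- index_iota 1 N.+1].
apply: (@le_trans _ _ (\sum_(p <- J) (type_weight j.+1 (extend_type p.1 p.2))%:R^-1)).
  apply: (ler_sum_cover (g := fun p => extend_type p.1 p.2)) => // t ts.
  have ct := allP cs t ts; have hN : (head 1 t <= N)%N by exact: (@leq_bigmax_seq _ _ predT (head 1%N)).
  have [u [n [cu n0 E]]] := extend_type_onto ct.
  have uE : u = behead t \/ u = [::] /\ n = 1%N /\ t = [::].
    rewrite E /extend_type; case: eqP => [h1|_]; last by left.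
    right; move/eqP: h1; rewrite muln_eq1 => /andP[/eqP -> /eqP h1]; split=> //.
    by case: u cu h1 {E} => // d u /and3P[d1 _ _] /= h; rewrite h in d1.
  have nh : (n <= head 1 t)%N.
    rewrite E /extend_type; case: eqP => [h1|_] /=; last by rewrite leq_pmulr // head_gt0.
    by move/eqP: h1; rewrite muln_eq1 => /andP[/eqP ->].
  apply/mapP; exists (u, n) => //; apply/allpairsPdep; exists u, n; split=> //.
    rewrite mem_undup mem_filter cu; apply/mapP; exists t => //.
    by case: uE => [//|[-> [_ ->]]].
  by rewrite mem_index_iota n0 ltnS (leq_trans nh).
have -> : \sum_(p <- J) (type_weight j.+1 (extend_type p.1 p.2))%:R^-1 =
    (\sum_(1 <= n < N.+1) (n ^ j.+2)%:R^-1) * \sum_(t <- s') (type_weight j.+2 t)%:R^-1 :> R.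
  rewrite /J big_allpairs_dep mulrC mulr_suml; apply: eq_big_seq => t ts'.
  rewrite mulr_sumr; apply: eq_big_nat => n /andP[n0 _].
  by rewrite type_weight_extend ?(allP cs') // natrM invfM mulrC.
set a : R := 2 / (2 ^ j.+1)%:R.
have a0 : 0 <= a by rewrite divr_ge0.
have -> : expR (4 / (2 ^ j.+1)%:R) = expR a * expR a.
  by rewrite -expRD; congr expR; rewrite /a; field; rewrite pnatr_eq0 expn_eq0.
have E2 : 4 / (2 ^ j.+2)%:R = a :> R.
  by rewrite /a (expnS 2 j.+1) natrM; field; rewrite pnatr_eq0 expn_eq0.
rewrite E2 in IH; apply: ler_pM => //.
- by apply: sumr_ge0 => n _; rewrite invr_ge0.
- by apply: sumr_ge0 => n _; rewrite invr_ge0.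
- by apply: (le_trans (sum_inv_powers j N)); exact: expR_ge1Dx.
Qed.

Lemma sum_inv_tail_weight (s : seq (seq nat)) : uniq s -> all divisor_chain s ->
  \sum_(t <- s) (tail_weight t)%:R^-1 <= expR 2 :> R.
Proof.
move=> us cs; have := sum_inv_type_weight 0 us cs.
rewrite expn1 (_ : 4 / 2 = 2 :> R); last by lra.
apply: le_trans; rewrite le_eqVlt; apply/orP; left; apply/eqP.
by apply: eq_bigr => t _; rewrite /type_weight expn1.
Qed.

(** Each tail is counted once, so this is dominated convergence with a
summable weight. *)
Lemma negligible_tails : negligible (fun X => size (tails X)).
Proof.
pose c (t : seq nat) X : nat := (tail_weight t <= X)%N.
move=> k; have [X0 H] : exists X0, forall X, (X0 <= X)%N -> forall s, uniq s ->
    all divisor_chain s -> (k * (\sum_(t <- s) c t X) <= X)%N.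
  apply: (dominated_negligible sum_inv_tail_weight).
  - exact: tail_weight_gt0.
  - by move=> t X _; rewrite /c; case h: (tail_weight t <= X)%N; rewrite ?mul1n ?mul0n.
  - by move=> t _ n; exists n => X nX; rewrite /c; case: (tail_weight t <= X)%N; rewrite ?muln1 ?muln0.
exists X0 => X XX; have := H X XX (tails X) (tails_uniq X) _.
have -> : (\sum_(t <- tails X) c t X = size (tails X))%N.
  rewrite -sum1_size; apply: eq_big_seq => t; rewrite mem_tails => /andP[_ h].
  by rewrite /c h.
by apply; apply/allP => t; rewrite mem_tails => /andP[].
Qed.

(** For a fixed tail t the orders n * tail_weight t lie in a set of density 0. *)
Lemma negligible_types_unit_order :
  negligible (fun X => count (fun t => unit_orderb (tprod t)) (types X)).
Proof.
pose c (t : seq nat) X := cnt (fun n => unit_orderb (n * tail_weight t)%N) (X %/ tail_weight t).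
move=> k; have [X0 H] : exists X0, forall X, (X0 <= X)%N -> forall s, uniq s ->
    all divisor_chain s -> (k * (\sum_(t <- s) c t X) <= X)%N.
  apply: (dominated_negligible sum_inv_tail_weight).
  - exact: tail_weight_gt0.
  - by move=> t X _; apply: leq_trans (leq_trunc_div X (tail_weight t)); rewrite leq_mul2r cnt_le orbT.
  - move=> t ct; apply: negligible_le (negligible_unit_order R) => X.
    have w0 := tail_weight_gt0 ct.
    rewrite /c cntE -size_filter -(size_map (fun n => n * tail_weight t)%N).
    apply: cnt_size.
      rewrite map_inj_uniq ?filter_uniq ?iota_uniq // => m n /eqP.
      by rewrite eqn_pmul2r // => /eqP.
    move=> x /mapP[n]; rewrite mem_filter mem_iota add1n ltnS => /andP[Un /andP[n0 nX]] ->.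
    by split=> //; rewrite muln_gt0 n0 w0 -leq_divRL.
exists X0 => X XX; rewrite count_types.
have -> : (\sum_(t <- tails X) cnt (fun n => unit_orderb (tprod (extend_type t n))) (X %/ tail_weight t) =
    \sum_(t <- tails X) c t X)%N.
  apply: eq_big_seq => t; rewrite mem_tails => /andP[ct _].
  rewrite /c /cnt big_nat_cond [RHS]big_nat_cond; apply: eq_bigl => n.
  case n0: (0 < n)%N => //=.
  by rewrite (extend_type_chain ct n0).2.
apply: H => //; first exact: tails_uniq.
by apply/allP => t; rewrite mem_tails => /andP[].
Qed.
End Summability.

(** * Adding a factor of order two *)

(** The type of C_2 x G in terms of that of G: C_2 combines with the first odd part
if there is one, and is a new last part otherwise. *)
Fixpoint add_two (t : seq nat) : seq nat :=
  if t is d :: t' then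
    if odd d then (2 * d)%N :: t' else d :: add_two t'
  else [:: 2%N].

Lemma tprod_add_two t : tprod (add_two t) = (2 * tprod t)%N.
Proof.
elim: t => [|d t IH] /=; first by rewrite /tprod big_seq1 big_nil.
by case: ifP => _; rewrite !tprod_cons ?IH; ring.
Qed.

Lemma head_add_two t : divisor_chain t -> (head 1 t %| head 1 (add_two t))%N.
Proof. by case: t => // d t _ /=; case: ifP => _ //=; rewrite dvdn_mull. Qed.

Lemma add_two_chain t : divisor_chain t -> divisor_chain (add_two t).
Proof.
elim: t => // d t IH /= /and3P[d1 hd ct].
case: ifP => [od|ed] /=; first by rewrite ct dvdn_mull // !andbT (leq_trans d1) // leq_pmull.
rewrite d1 IH // andbT /=; case: t hd ct {IH} => [|e t] /= hd ct; first by rewrite dvdn2 ed.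
case: ifP => [oe|_] //=; rewrite Gauss_dvd ?hd ?dvdn2 ?ed //.
by rewrite coprime2n.
Qed.

Lemma add_two_has t : divisor_chain t -> has_exact_two (add_two t).
Proof.
elim: t => // d t IH /= /and3P[d1 hd ct].
case: ifP => od /=; last by rewrite IH ?orbT.
by apply/orP; left; lia.
Qed.

Lemma has_exact_two_even d t : divisor_chain (d :: t) -> has_exact_two t -> ~~ odd d.
Proof.
move=> ct /hasP[e et e2]; have := divisor_chain_dvd_head ct et.
by rewrite -dvdn2; apply: dvdn_trans; rewrite /dvdn; apply/eqP; lia.
Qed.

Lemma add_two_inj t u : divisor_chain t -> divisor_chain u -> add_two t = add_two u -> t = u.
Proof.
elim: t u => [|d t IH] [|e u] //.
- move=> _ /and3P[e1 _ _] /=; case: ifP => [_ [E]|_ [_]]; first by lia.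
  by move/(congr1 tprod); rewrite tprod_add_two /tprod big_nil; lia.
- move=> /and3P[d1 _ _] _ /=; case: ifP => [_ [E]|_ [_]]; first by lia.
  by move/(congr1 tprod); rewrite tprod_add_two /tprod big_nil; lia.
move=> cd ce; have /and3P[_ _ ct] := cd; have /and3P[_ _ cu] := ce => /=.
case: ifP => od; case: ifP => oe [].
- by move=> E ->; congr (_ :: _); lia.
- move=> _ E; have := add_two_has cu; rewrite -E => /(has_exact_two_even cd).
  by rewrite od.
- move=> _ E; have := add_two_has ct; rewrite E => /(has_exact_two_even ce).
  by rewrite oe.
- by move=> -> /(IH _ ct cu) ->.
Qed.

(** The last part that is 2 modulo 4 is the one that add_two produced: the parts
after it are odd. *)
Lemma add_two_onto u : divisor_chain u -> has_exact_two u ->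
  exists2 t, divisor_chain t & add_two t = u.
Proof.
elim: u => // d u IH cd; have /and3P[d1 hd cu] := cd.
have [hu _|nu] := boolP (has_exact_two u).
  have [t ct tu] := IH cu hu; exists (d :: t).
    by rewrite /= d1 ct andbT (dvdn_trans _ hd) //= -tu head_add_two.
  by rewrite /= (negbTE (has_exact_two_even cd hu)) tu.
rewrite /has_exact_two /= -/(has_exact_two u) (negbTE nu) orbF => /eqP d2.
have dE : d = (2 * (d %/ 2))%N by lia.
have oe : odd (d %/ 2) by lia.
have he : (head 1 u %| d %/ 2)%N.
  case: u hd cu nu {IH cd} => [|c u] /= hd cu nu; first by rewrite dvd1n.
  have oc : odd c.
    apply: contraNT nu => ec; apply/orP; left.
    have [c4|] := boolP (4 %| c)%N; first by have := dvdn_trans c4 hd; rewrite /dvdn d2.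
    by rewrite /dvdn => c4; lia.
  by move: hd; rewrite {1}dE Gauss_dvdr // coprimen2.
have [e1|e1] := leqP (d %/ 2) 1.
  exists [::] => //=; have e1' : (d %/ 2 = 1)%N by case: (d %/ 2)%N oe e1 => [|[|]].
  rewrite e1' in dE he; rewrite dE; case: u he cu {hd cd IH nu} => //= c u.
  by rewrite dvdn1 => /eqP -> /and3P[].
by exists (d %/ 2 :: u)%N; [rewrite /= e1 he|rewrite /= oe -dE].
Qed.

Lemma count_types_half (P : pred nat) X :
  count (fun t => P (2 * tprod t)%N) (types (X %/ 2)) =
  count (fun t => has_exact_two t && P (tprod t)) (types X).
Proof.
rewrite -2!size_filter -(size_map add_two); apply: perm_size; apply: uniq_perm.
- rewrite map_inj_in_uniq ?filter_uniq ?types_uniq // => t u.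
  rewrite !mem_filter !mem_types => /and3P[_ ct _] /and3P[_ cu _].
  exact: add_two_inj.
- by rewrite filter_uniq ?types_uniq.
move=> u; apply/mapP/idP => [[t]|].
  rewrite !mem_filter !mem_types => /and3P[Pt ct tX] ->.
  rewrite add_two_has // add_two_chain // tprod_add_two Pt /=.
  by rewrite mulnC -leq_divRL.
rewrite mem_filter mem_types => /andP[/andP[hu Pu] /andP[cu uX]].
have [t ct tu] := add_two_onto cu hu; exists t => //.
rewrite mem_filter mem_types ct /= -tprod_add_two tu Pu /=.
by rewrite leq_divRL // mulnC -tprod_add_two tu.
Qed.

(** * Densities of cyclic and of all abelian groups *)

(** The limit in terms of natural numbers: |r / n - a / b| is at most 1 / (b k) for
X large, with X the integral part of the bound x. *)
Lemma density_of_counts (R : realType) (C : group_class) (a b : nat) :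
  (forall (gT : finGroupType) (G : {group gT}), C gT G -> abelian G) -> (0 < b)%N ->
  (forall k, exists X0, forall X, (X0 <= X)%N ->
     let n := count (class_type C) (types X) in
     let r := count (class_type (realizable_in C)) (types X) in
     [/\ 0 < n, k * (b * r) <= k * (a * n) + n & k * (a * n) <= k * (b * r) + n]%N) ->
  realizable_density C (a%:R / b%:R : R).
Proof.
move=> Cab b0 H; have Crab (gT : finGroupType) (G : {group gT}) : realizable_in C G -> abelian G.
  by case=> /Cab.
apply/cvgrPdist_le => e e0.
have [k k0 ke] : exists2 k : nat, (0 < k)%N & k%:R^-1 <= e.
  exists (Num.truncn e^-1).+1 => //.
  by rewrite -[leRHS]invrK lef_pV2 ?posrE ?ltr0n ?invr_gt0 // ltW // truncnS_gt.
have [X0 HX0] := H k.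
near=> x.
have x0 : 0 <= x by near: x; exact: nbhs_pinfty_ge.
have xX0 : X0%:R <= x by near: x; exact: nbhs_pinfty_ge.
pose X := Num.truncn x.
have xX m : (m%:R <= x) = (m <= X)%N by rewrite truncn_ge_nat.
rewrite (num_iso_classes_types Cab xX) (num_iso_classes_types Crab xX).
have [] := HX0 X; first by rewrite -xX.
set n := count _ _; set r := count _ _ => n0 h1 h2.
have n0' : 0 < n%:R :> R by rewrite ltr0n.
have b0' : 0 < b%:R :> R by rewrite ltr0n.
have k0' : 0 < k%:R :> R by rewrite ltr0n.
apply: le_trans ke.
have -> : a%:R / b%:R - r%:R / n%:R = (a%:R * n%:R - b%:R * r%:R) / (b%:R * n%:R) :> R.
  by field; rewrite !gt_eqF.
rewrite normrM normfV [`|b%:R * n%:R|]gtr0_norm ?mulr_gt0 // ler_pdivrMr ?mulr_gt0 //.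
move: h1 h2; rewrite -!(ler_nat R) !natrD !natrM => h1 h2.
have b1 : 1 <= b%:R :> R by rewrite ler1n.
have bn : n%:R <= b%:R * n%:R :> R by rewrite ler_peMl // ltW.
apply: (@le_trans _ _ (n%:R / k%:R)); last first.
  by rewrite [leLHS]mulrC; apply: ler_wpM2l => //; rewrite invr_ge0 ltW.
rewrite ler_pdivlMr // -[X in _ * X]gtr0_norm // -normrM ler_norml.
have -> : (a%:R * n%:R - b%:R * r%:R) * k%:R = k%:R * (a%:R * n%:R) - k%:R * (b%:R * r%:R) :> R by ring.
apply/andP; split; first by rewrite lerNl opprB lerBlDl.
by rewrite lerBlDl.
Unshelve. all: by end_near.
Qed.

(** A chain is the type of some group, and the class only has to be tested on
groups of that type. *)
Lemma class_typeP (C : group_class) t : divisor_chain t ->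
  (forall (gT : finGroupType) (G : {group gT}), abelian G -> abelian_type G = t -> C gT G) ->
  class_type C t.
Proof.
move=> ct H; have [gT [G [cGG Gt]]] := exists_abelian_type ct.
by apply/asboolP; exists gT, G; split=> //; exact: H.
Qed.

Section RealizableTypes.
Variable C : group_class.
Hypothesis Cab : forall (gT : finGroupType) (G : {group gT}), C G -> abelian G.

Lemma realizable_type_upper t : class_type (realizable_in C) t ->
  class_type C t /\ (has_exact_two t \/ unit_orderb (tprod t)).
Proof.
move=> /asboolP[gT [G [[CG rG] <-]]]; split; first by apply/asboolP; exists gT, G.
have cGG := Cab CG; rewrite tprod_type //.
by case: (realizable_has_exact_two cGG rG) => [?|?]; [left|right; apply/asboolP].
Qed.

Lemma realizable_type_lower t : class_type C t -> has_exact_two t ->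
  class_type (realizable_in C) t.
Proof.
move=> /asboolP[gT [G [CG Gt]]] ht; apply/asboolP; exists gT, G; split=> //; split=> //.
by apply: has_exact_two_realizable; [exact: Cab|rewrite Gt].
Qed.

Lemma count_realizable_lower X :
  (count (fun t => has_exact_two t && class_type C t) (types X) <=
   count (class_type (realizable_in C)) (types X))%N.
Proof.
by apply: sub_count => t /= /andP[ht Ct]; exact: realizable_type_lower.
Qed.

Lemma count_realizable_upper X :
  (count (class_type (realizable_in C)) (types X) <=
   count (fun t => has_exact_two t && class_type C t) (types X) +
   count (fun t => class_type C t && unit_orderb (tprod t)) (types X))%N.
Proof.
rewrite -count_predUI; apply: leq_trans (leq_addr _ _); apply: sub_count => t /= rt.
by have [-> [->|->]] := realizable_type_upper rt; rewrite ?orbT.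
Qed.
End RealizableTypes.

Lemma cyclic_type (gT : finGroupType) (G : {group gT}) :
  abelian G -> cyclic G = (size (abelian_type G) <= 1)%N.
Proof. by move=> cGG; rewrite size_abelian_type // abelian_rank1_cyclic. Qed.

Lemma class_type_cyclic t : divisor_chain t ->
  class_type cyclic_groups t = (size t <= 1)%N.
Proof.
move=> ct; apply/idP/idP => [/asboolP[gT [G [cG <-]]]|t1].
  by rewrite -cyclic_type ?cyclic_abelian.
by apply: class_typeP => // gT G cGG Gt; rewrite /cyclic_groups cyclic_type // Gt.
Qed.

Lemma class_type_abelian t : divisor_chain t -> class_type abelian_groups t.
Proof. by move=> ct; apply: class_typeP. Qed.

Lemma count_cyclic_types (P : pred (seq nat)) X :
  count (fun t => class_type cyclic_groups t && P t) (types X) =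
  cnt (fun n => P (extend_type [::] n)) X.
Proof.
rewrite cntE -size_filter -(count_map (extend_type [::]) P) -size_filter.
apply: perm_size; apply: uniq_perm.
- by rewrite filter_uniq ?types_uniq.
- rewrite filter_uniq // map_inj_in_uniq ?iota_uniq // => m n; rewrite !mem_iota.
  by move=> /andP[m0 _] /andP[n0 _] /(@extend_type_inj [::] [::] m n isT isT m0 n0)[].
move=> t; rewrite !mem_filter mem_types [in RHS]andbC [in LHS]andbC.
case Pt: (P t); rewrite ?andbT ?andbF //.
apply/andP/mapP => [[/andP[ct tX]]|[n]].
  rewrite class_type_cyclic // => t1; exists (tprod t).
    by rewrite mem_iota tprod_gt0 // add1n ltnS.
  case: t t1 ct {Pt tX} => [|d [|//]] _; first by rewrite /tprod big_nil.
  by move=> /and3P[d1 _ _]; rewrite /tprod big_seq1 /extend_type muln1 gtn_eqF.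
rewrite mem_iota add1n ltnS => /andP[n0 nX] ->.
have [ce pe] := @extend_type_chain [::] n isT n0.
rewrite ce pe /tail_weight /tprod big_nil !muln1 nX; split=> //.
by rewrite class_type_cyclic // /extend_type; case: ifP.
Qed.

Lemma cnt_2mod4 X : cnt (fun n => n %% 4 == 2)%N X = ((X + 2) %/ 4)%N.
Proof.
elim: X => [|X IH]; first by rewrite /cnt big_geq.
have -> : cnt (fun n => n %% 4 == 2)%N X.+1 = (cnt (fun n => n %% 4 == 2)%N X + (X.+1 %% 4 == 2))%N.
  have e : iota 1 X.+1 = iota 1 X ++ [:: X.+1] by rewrite -[X.+1 in LHS]addn1 iotaD add1n.
  by rewrite !cntE e count_cat /= addn0.
rewrite IH; case: eqP => h /=; lia.
Qed.

Section MainDensities.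
Variable R : realType.

Lemma density_cyclic : realizable_density cyclic_groups (1 / 4 : R).
Proof.
apply: (@density_of_counts R cyclic_groups 1 4) => //.
  by move=> gT G; exact: cyclic_abelian.
move=> k; have [X0 H] := negligible_unit_order R (8 * k)%N.
exists (maxn X0 (6 * k).+1) => X; rewrite geq_max => /andP[XX0 Xk].
have nE : count (class_type cyclic_groups) (types X) = X.
  rewrite -[RHS](size_iota 1) -count_predT -cntE -(count_cyclic_types predT X).
  by apply: eq_count => t; rewrite andbT.
have Cab (gT : finGroupType) (G : {group gT}) : cyclic_groups G -> abelian G.
  exact: cyclic_abelian.
have lo := count_realizable_lower Cab X; have up := count_realizable_upper Cab X.
have E2 : count (fun t => has_exact_two t && class_type cyclic_groups t) (types X) = ((X + 2) %/ 4)%N.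
  rewrite (eq_count (a2 := fun t => class_type cyclic_groups t && has_exact_two t)); last first.
    by move=> t; rewrite andbC.
  rewrite count_cyclic_types -cnt_2mod4 /cnt; apply: eq_bigl => n.
  rewrite /extend_type muln1; case: eqP => [->//|_].
  by rewrite /has_exact_two /= orbF.
have E3 : (count (fun t => class_type cyclic_groups t && unit_orderb (tprod t)) (types X) <= cnt unit_orderb X)%N.
  rewrite count_cyclic_types; apply: sub_cnt => n /andP[n0 _].
  by rewrite (@extend_type_chain [::] n isT n0).2 /tail_weight /tprod big_nil !muln1.
rewrite E2 in lo up; have := H X XX0; rewrite nE => HX.
split; [lia| |]; nia.
Qed.

Lemma density_abelian : realizable_density abelian_groups (1 / 2 : R).
Proof.
have Cab (gT : finGroupType) (G : {group gT}) : abelian_groups G -> abelian G by [].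
apply: (@density_of_counts R abelian_groups 1 2) => //.
move=> k; have [X0 H] := negligible_types_unit_order R (2 * k)%N.
have [X1 H1] := negligible_tails R k.
exists (maxn (maxn X0 X1) 1) => X; rewrite !geq_max -andbA => /and3P[XX0 XX1 X0'].
have cl t : t \in types X -> class_type abelian_groups t.
  by rewrite mem_types => /andP[ct _]; exact: class_type_abelian.
have nE : count (class_type abelian_groups) (types X) = size (types X).
  by apply/eqP; rewrite -all_count; apply/allP.
have lo := count_realizable_lower Cab X; have up := count_realizable_upper Cab X.
have E2 : count (fun t => has_exact_two t && class_type abelian_groups t) (types X) =
    size (types (X %/ 2)).
  rewrite -count_predT (count_types_half predT); apply: eq_in_count => t /cl ->.
  by [].
have E3 : (count (fun t => class_type abelian_groups t && unit_orderb (tprod t)) (types X) <=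
    count (fun t => unit_orderb (tprod t)) (types X))%N.
  by apply: sub_count => t /= /andP[].
rewrite E2 in lo up; have := H X XX0; have := H1 X XX1; rewrite nE.
have /andP[hl hu] := size_types_half X; have := leq_size_types X.
move=> sX t1 t2; split; [lia| |]; nia.
Qed.
End MainDensities.

(** * Types of p-groups *)

Definition ptype (p : nat) : pred (seq nat) := fun t => (p.-nat (tprod t))%N.

Lemma tprod_perm t u : perm_eq t u -> tprod t = tprod u.
Proof. exact: perm_big. Qed.

Lemma tprod_cat t u : tprod (t ++ u) = (tprod t * tprod u)%N.
Proof. exact: big_cat. Qed.

Lemma tprod_nseq n d : tprod (nseq n d) = (d ^ n)%N.
Proof. by elim: n => [|n IH]; rewrite ?expn0 /= ?tprod_cons ?IH ?expnS // /tprod big_nil. Qed.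

Lemma divisor_chain_geq t : divisor_chain t -> sorted geq t.
Proof.
rewrite divisor_chainE => /andP[/allP t1]; apply: sub_in_sorted (allss t) => m n mt _.
by move=> /dvdn_leq; apply; exact/ltnW/(t1 m mt).
Qed.

Lemma divisor_chain_perm t u :
  divisor_chain t -> divisor_chain u -> perm_eq t u -> t = u.
Proof.
move=> /divisor_chain_geq st /divisor_chain_geq su; apply: sorted_eq st su.
  by move=> a b c ba ac; exact: leq_trans ac ba.
by move=> a b; rewrite andbC -eqn_leq => /eqP.
Qed.

(** Among powers of one prime, divisibility is the order, so that any list of them
can be sorted into a chain. *)
Lemma sort_ptype (p : nat) (s : seq nat) : prime p ->
  all (fun d => (1 < d) && p.-nat d)%N s ->
  [/\ divisor_chain (sort geq s), perm_eq (sort geq s) s & ptype p (sort geq s)].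
Proof.
move=> pp /allP H; have ps : perm_eq (sort geq s) s by rewrite perm_sort.
split=> //; last first.
  rewrite /ptype (tprod_perm ps) /tprod big_seq.
  by elim/big_ind : _ => // [x y px py|d /H/andP[]//]; rewrite pnatM px.
have tot : total geq by move=> a b; exact: leq_total.
rewrite divisor_chainE; apply/andP; split.
  by apply/allP => d; rewrite mem_sort => /H/andP[].
apply: sub_in_sorted (allss _) (sort_sorted tot s) => m n.
rewrite !mem_sort => /H/andP[m1 /p_natP[a ->]] /H/andP[n1 /p_natP[c ->]] /=.
by rewrite leq_exp2l ?prime_gt1 // => ca; rewrite dvdn_exp2l.
Qed.

Lemma ptype_mem p t d : divisor_chain t -> ptype p t -> d \in t -> (1 < d)%N && (p.-nat d)%N.
Proof.
move=> ct pt dt; rewrite (divisor_chain_gt1 ct dt) /=.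
exact: pnat_dvd (dvdn_tprod dt) pt.
Qed.

(** Choose freely the multiplicities, at most M, of the parts p, p ^ 2, ..., p ^ L. *)
Lemma count_ptypes_lower p L M X : prime p -> (p ^ (L * L * M) <= X)%N ->
  (M.+1 ^ L <= count (ptype p) (types X))%N.
Proof.
move=> pp pX.
pose s (m : {ffun 'I_L -> 'I_M.+1}) := flatten [seq nseq (m i) (p ^ i.+1)%N | i : 'I_L].
have sall m : all (fun d => (1 < d) && p.-nat d)%N (s m).
  apply/allP => d /flattenP[l /mapP[i _ ->]]; rewrite mem_nseq => /andP[_ /eqP ->].
  by rewrite pnatX pnat_id // -{1}(expn0 p) ltn_exp2l ?prime_gt1.
have cs m i : count_mem (p ^ (i : 'I_L).+1)%N (s m) = m i.
  rewrite /s count_flatten -map_comp sumnE big_map big_enum /= (bigD1 i) //=.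
  rewrite count_nseq /= eqxx mul1n big1 ?addn0 // => j ji.
  rewrite count_nseq /= eqn_exp2l ?prime_gt1 // eqSS.
  by rewrite (_ : (j == i :> nat) = false) //; apply/negbTE.
have ps m : tprod (s m) = (p ^ (\sum_(i < L) i.+1 * m i))%N.
  rewrite /tprod /s big_flatten big_map big_enum /= expn_sum.
  by apply: eq_bigr => i _; rewrite -/(tprod _) tprod_nseq -expnM.
have -> : (M.+1 ^ L)%N = size [seq sort geq (s m) | m : {ffun 'I_L -> 'I_M.+1}].
  by rewrite size_map -cardE card_ffun !card_ord.
rewrite -size_filter; apply: uniq_leq_size.
  rewrite map_inj_uniq ?enum_uniq // => m n E; apply/ffunP => i; apply: val_inj.
  rewrite /= -(cs m i) -(cs n i).
  have srt l : perm_eq (sort geq l) l by rewrite perm_sort.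
  by rewrite -(seq.permP (srt (s m))) E (seq.permP (srt (s n))).
move=> t /mapP[m _ ->]; have [ct pt tt] := sort_ptype pp (sall m).
rewrite mem_filter mem_types ct tt (tprod_perm pt) ps /=; apply: leq_trans pX.
rewrite leq_exp2l ?prime_gt1 //.
apply: (@leq_trans (\sum_(i < L) L * M)); last by rewrite sum_nat_const card_ord mulnA.
by apply: leq_sum => i _; apply: leq_mul => //; rewrite -ltnS.
Qed.

(** The types of 2-groups without a direct factor C_2. *)
Definition no_two_types (X : nat) : seq (seq nat) :=
  [seq t <- types X | ptype 2 t && ~~ has_exact_two t].

Lemma no_two_mem X t : t \in no_two_types X ->
  [/\ divisor_chain t, (tprod t <= X)%N, ptype 2 t & 2%N \notin t].
Proof.
rewrite mem_filter mem_types => /andP[/andP[t2 nt] /andP[ct tX]]; split=> //.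
by apply: contra nt => two; apply/hasP; exists 2%N.
Qed.

(** In a type without parts 2, replace one part d = 2 ^ a by a parts 2. The product
stays the same, and t and d can be recovered from the result, a being the number
of parts 2; so the pairs (t, d) inject into all types of 2-groups. *)
Lemma sum_distinct_parts X :
  (\sum_(t <- no_two_types X) size (undup t) <= count (ptype 2) (types X))%N.
Proof.
pose J := [seq (t, d) | t <- no_two_types X, d <- undup t].
have -> : (\sum_(t <- no_two_types X) size (undup t) = size J)%N.
  rewrite -sum1_size /J big_allpairs_dep; apply: eq_bigr => t _.
  by rewrite sum1_size.
pose g (j : seq nat * nat) := rem j.2 j.1 ++ nseq (logn 2 j.2) 2%N.
have JP t d : (t, d) \in J -> t \in no_two_types X /\ d \in t.
  by move=> /allpairsPdep[t' [d' [tV dt [-> ->]]]]; rewrite mem_undup in dt.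
have gall t d : (t, d) \in J -> all (fun d => (1 < d) && 2.-nat d)%N (g (t, d)).
  move=> /JP[/no_two_mem[ct _ t2 _] dt]; rewrite all_cat /=; apply/andP; split.
    by apply/allP => x /mem_rem; exact: ptype_mem.
  by apply/allP => x; rewrite mem_nseq => /andP[_ /eqP ->].
have cg t d : (t, d) \in J -> count_mem 2%N (g (t, d)) = logn 2 d.
  move=> /JP[/no_two_mem[_ _ _ nt] dt]; rewrite count_cat count_nseq /= mul1n.
  rewrite (_ : count_mem 2%N (rem d t) = 0%N) //; apply/eqP; rewrite -leqn0 leqNgt -has_count.
  by rewrite has_pred1; apply: contra nt; exact: mem_rem.
rewrite -(size_map (fun j => sort geq (g j))) -size_filter; apply: uniq_leq_size.
  rewrite map_inj_in_uniq.
    apply: allpairs_uniq_dep => [|t _|[t d] [u e] _ _ /= [-> ->]//].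
      by rewrite filter_uniq ?types_uniq.
    exact: undup_uniq.
  move=> [t d] [u e] tJ uJ E.
  have [tV dt] := JP _ _ tJ; have [uV eu] := JP _ _ uJ.
  have [ct _ t2 nt] := no_two_mem tV; have [cu _ u2 nu] := no_two_mem uV.
  have pe : perm_eq (g (t, d)) (g (u, e)).
    by rewrite -(perm_sort geq) E perm_sort.
  have de : d = e.
    have /andP[_ /p_natP[a da]] := ptype_mem ct t2 dt.
    have /andP[_ /p_natP[c ec]] := ptype_mem cu u2 eu.
    have := seq.permP pe (pred1 2%N); rewrite !cg // da ec !pfactorK // => ->.
    by [].
  rewrite -de in pe eu *; congr pair; apply: divisor_chain_perm => //.
  rewrite (permPl (perm_to_rem dt)) (perm_sym _ u) (permPl (perm_to_rem eu)) perm_cons perm_sym.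
  by move: pe; rewrite perm_cat2r.
move=> v /mapP[[t d] tJ ->]; have [ct pt tt] := sort_ptype (isT : prime 2) (gall _ _ tJ).
rewrite mem_filter mem_types ct tt (tprod_perm pt) /=.
have [/no_two_mem[ct' tX t2 _] dt] := JP _ _ tJ.
rewrite (leq_trans _ tX) // tprod_cat tprod_nseq (tprod_perm (perm_to_rem dt)) tprod_cons mulnC.
have /andP[_ /p_natP[a da]] := ptype_mem ct' t2 dt.
by rewrite /= da pfactorK.
Qed.

(** A type is determined by the exponents of its distinct parts and their
multiplicities, all at most lg X. *)
Lemma few_distinct_parts X K :
  (count (fun t => size (undup t) < K)%N (no_two_types X) <= ((lg X).+1 * (lg X).+1) ^ K)%N.
Proof.
pose N := lg X.
pose code (t : seq nat) : {ffun 'I_K -> 'I_N.+1 * 'I_N.+1} :=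
  [ffun i : 'I_K => (inord (logn 2 (nth 1%N (undup t) i)), inord (count_mem (nth 1%N (undup t) i) t))].
set V := [seq t <- no_two_types X | size (undup t) < K]%N.
rewrite -size_filter -/V.
have VP t : t \in V -> (size (undup t) < K)%N /\ t \in no_two_types X.
  by rewrite mem_filter => /andP[].
have logN t x : t \in V -> x \in t -> (logn 2 x <= N)%N.
  move=> /VP[_ /no_two_mem[ct tX _ _]] xt; rewrite -ltnS -(ltn_exp2l _ _ (ltnSn 1)).
  have x0 := divisor_chain_gt1 ct xt.
  have lx : (2 ^ logn 2 x <= x)%N by rewrite dvdn_leq ?pfactor_dvdnn // ltnW.
  have xX : (x <= X)%N by rewrite (leq_trans _ tX) // dvdn_leq ?tprod_gt0 ?dvdn_tprod.
  have XN := ltn_exp_lg X; rewrite (leq_ltn_trans lx) // (leq_ltn_trans xX) // (leq_trans XN) //.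
  by rewrite leq_exp2l.
have cntN t x : t \in V -> (count_mem x t <= N)%N.
  move=> /VP[_ /no_two_mem[ct tX _ _]]; apply: leq_trans (count_size _ _) _.
  rewrite -ltnS -(ltn_exp2l _ _ (ltnSn 1)).
  have tt : (2 ^ size t <= tprod t)%N.
    elim: (t) ct => [|d u IH]; first by rewrite /tprod big_nil.
    by move=> /and3P[d1 _ cu]; rewrite tprod_cons expnS leq_mul // IH.
  have XN := ltn_exp_lg X; rewrite (leq_ltn_trans tt) // (leq_ltn_trans tX) // (leq_trans XN) //.
  by rewrite leq_exp2l.
have half t u x : t \in V -> u \in V -> code t = code u -> x \in t ->
    count_mem x t = count_mem x u.
  move=> tV uV E xt; have [tK /no_two_mem[ct _ t2 _]] := VP t tV.
  have [uK /no_two_mem[cu _ u2 _]] := VP u uV.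
  have iK : (index x (undup t) < K)%N.
    by apply: leq_trans tK; rewrite ltnS ltnW // index_mem mem_undup.
  have := congr1 (fun f : {ffun _ -> _} => f (Ordinal iK)) E; rewrite !ffunE /=.
  rewrite nth_index ?mem_undup //; set y := nth _ (undup u) _ => -[/(congr1 val) /= el /(congr1 val) /= ec].
  have /andP[x1 /p_natP[a xa]] := ptype_mem ct t2 xt.
  rewrite [LHS]inordK ?ltnS ?(logN t) // in el; rewrite [LHS]inordK ?ltnS ?cntN // in ec.
  have [yu|uy] := ltnP (index x (undup t)) (size (undup u)); last first.
    move: el; rewrite /y nth_default // logn1 inordK // xa pfactorK // => a0.
    by move: x1; rewrite xa a0.
  have {}yu : y \in u by rewrite -mem_undup mem_nth.
  have /andP[y1 /p_natP[c yc]] := ptype_mem cu u2 yu.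
  rewrite [RHS]inordK ?ltnS ?(logN u) // in el; rewrite [RHS]inordK ?ltnS ?cntN // in ec.
  by move: el; rewrite {1}xa yc !pfactorK // => ac; rewrite ec yc -ac -xa.
have inj : {in V &, injective code}.
  move=> t u tV uV E; have [_ /no_two_mem[ct _ _ _]] := VP t tV.
  have [_ /no_two_mem[cu _ _ _]] := VP u uV.
  apply: divisor_chain_perm => //; apply/allP => x; rewrite mem_cat => /orP[xt|xu] /=; apply/eqP.
    exact: half tV uV E xt.
  by apply/esym; apply: half uV tV (esym E) xu.
rewrite -(size_map code); have -> : ((N.+1 * N.+1) ^ K)%N = #|{: {ffun 'I_K -> 'I_N.+1 * 'I_N.+1}}|.
  by rewrite card_ffun card_prod !card_ord.
rewrite cardE; apply: uniq_leq_size => [|x _]; last by rewrite mem_enum.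
by rewrite map_inj_in_uniq // filter_uniq // filter_uniq // types_uniq.
Qed.

(** * Densities of p-groups *)

Lemma class_type_pgroups p t : divisor_chain t -> class_type (abelian_pgroups p) t = ptype p t.
Proof.
move=> ct; apply/idP/idP => [/asboolP[gT [G [[cGG pG] <-]]]|pt].
  by rewrite /ptype tprod_type.
apply: class_typeP => // gT G cGG Gt; split=> //.
by rewrite /pgroup -tprod_type // Gt.
Qed.

Lemma count_class_pgroups p X :
  count (class_type (abelian_pgroups p)) (types X) = count (ptype p) (types X).
Proof.
by apply: eq_in_count => t; rewrite mem_types => /andP[ct _]; exact: class_type_pgroups.
Qed.

Section PGroupDensities.
Variable R : realType.

(** Few types without parts 2 have less than K distinct parts, a power of log X
with an exponent below that of the lower bound for the number of all types; and
by sum_distinct_parts those with at least K distinct parts are at most 1 / K of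
all types. *)
Lemma density_2groups : realizable_density (abelian_pgroups 2) (1 : R).
Proof.
rewrite -[1](@divr1 R); apply: (@density_of_counts R _ 1 1) => //.
  by move=> gT G [].
move=> k; pose K := (2 * k)%N; pose L := (2 * K).+1; pose c := (K * (2 * (L * L)) ^ (2 * K))%N.
exists (2 ^ (L * L * c).+1)%N => X Xc.
have X0 : (0 < X)%N by apply: leq_trans Xc; rewrite expn_gt0.
have Cab (gT : finGroupType) (G : {group gT}) : abelian_pgroups 2 G -> abelian G by case.
have lo := count_realizable_lower Cab X.
have up : (count (class_type (realizable_in (abelian_pgroups 2))) (types X) <=
    count (class_type (abelian_pgroups 2)) (types X))%N.
  by apply: sub_count => t /realizable_type_upper[].
rewrite count_class_pgroups in up *.
have E : (count (ptype 2) (types X) =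
    count (fun t => has_exact_two t && class_type (abelian_pgroups 2) t) (types X) +
    size (no_two_types X))%N.
  rewrite size_filter -(count_predUI) [X in (_ + X)%N](_ : _ = 0%N) ?addn0.
    apply: eq_in_count => t; rewrite mem_types => /andP[ct _] /=.
    by rewrite class_type_pgroups //; case: (has_exact_two t); rewrite /= ?andbT ?andbF ?orbF.
  apply/eqP; rewrite -leqn0 leqNgt -has_count; apply/hasPn => t _ /=.
  by case: (has_exact_two t); rewrite ?andbF.
pose M := ((lg X).-1 %/ (L * L))%N.
have nM : (M.+1 ^ L <= count (ptype 2) (types X))%N.
  apply: count_ptypes_lower => //; apply: leq_trans (leq_exp_lg X0).
  by rewrite leq_exp2l // mulnC leq_trunc_div.
have lgX : (L * L * c < (lg X).-1)%N.
  by have := leq_ltn_trans Xc (ltn_exp_lg X); rewrite ltn_exp2l.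
have cM : (c <= M)%N by rewrite /M leq_divRL // mulnC ltnW.
have NM : ((lg X).+1 <= 2 * (L * L) * M.+1)%N.
  have := ltn_ceil (lg X).-1 (isT : (0 < L * L)%N); rewrite -/M.
  move: (lg X) lgX => N; case: N => // N _ /= h; rewrite -mulnA (mulnC _ M.+1); lia.
have big : (K * count (fun t => K <= size (undup t))%N (no_two_types X) <=
    count (ptype 2) (types X))%N.
  apply: leq_trans (sum_distinct_parts X); rewrite -sum1_count big_distrr /= big_mkcond.
  by apply: leq_sum => t _; case: ifP; rewrite ?muln1.
have small : (K * count (fun t => size (undup t) < K)%N (no_two_types X) <=
    count (ptype 2) (types X))%N.
  apply: leq_trans nM; apply: leq_trans (_ : K * ((2 * (L * L)) ^ (2 * K) * M.+1 ^ (2 * K)) <= _)%N.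
    rewrite leq_mul2l (leq_trans (few_distinct_parts X K)) ?orbT //.
    rewrite -expnMn -[((lg X).+1 * _)%N]/((lg X).+1 ^ 2)%N -expnM.
    by have [->|K0] := posnP K; rewrite ?muln0 // leq_exp2r // muln_gt0.
  by rewrite mulnA -/c expnS leq_mul2r (leq_trans cM) ?orbT.
have split : (size (no_two_types X) =
    count (fun t => K <= size (undup t))%N (no_two_types X) +
    count (fun t => size (undup t) < K)%N (no_two_types X))%N.
  rewrite -(count_predC (fun t => K <= size (undup t))%N); congr (_ + _)%N.
  by apply: eq_count => t /=; rewrite -ltnNge.
split; first by apply: leq_trans nM; rewrite expn_gt0.
  by rewrite !mul1n (leq_trans _ (leq_addr _ _)) // leq_mul2l up orbT.
rewrite !mul1n; move: small big; rewrite /K split in E *.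
move: (count _ _) (count _ _) (count _ _) (count _ _) (count _ _) E lo => n u v w r E lo sm bg.
have := leq_mul (leqnn k) lo; lia.
Qed.

(** The group has exponent p, so it is elementary abelian. *)
Lemma odd_realizable_type p t : prime p -> odd p ->
  class_type (realizable_in (abelian_pgroups p)) t -> t = nseq (size t) p.
Proof.
move=> pp op /asboolP[gT [G [[[cGG pG] rG] <-]]].
have [H _] := odd_realizable_pgroup pp op cGG pG rG.
have ab : (p.-abelem G)%g by rewrite abelemE // cGG; apply/exponentP.
by rewrite (abelian_type_abelem ab) size_nseq.
Qed.

(** One elementary abelian group for each rank, so about log X realizable groups,
against at least a multiple of (log X) ^ 2 groups with parts p and p ^ 2. *)
Lemma density_odd_pgroups p : prime p -> odd p ->
  realizable_density (abelian_pgroups p) (0 : R).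
Proof.
move=> pp op; rewrite -[0](@mul0r R 1^-1); apply: (@density_of_counts R _ 0 1) => //.
  by move=> gT G [].
move=> k; pose c := (k * (4 * p).+1)%N.
exists (p ^ (4 * c))%N => X Xc.
have p1 := prime_gt1 pp; have p0 := prime_gt0 pp.
have X0 : (0 < X)%N by apply: leq_trans Xc; rewrite expn_gt0 p0.
pose T := trunc_log p X; pose M := (T %/ 4)%N.
have nM : (M.+1 ^ 2 <= count (ptype p) (types X))%N.
  apply: count_ptypes_lower => //; apply: leq_trans (trunc_logP p1 X0).
  by rewrite leq_exp2l // mulnC leq_trunc_div.
have cM : (c <= M)%N by rewrite /M leq_divRL // mulnC trunc_log_max.
have lgX : (lg X <= 4 * p * M.+1)%N.
  apply: lg_leq; first by rewrite !muln_gt0 p0.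
  apply: leq_trans (trunc_log_ltn X p1) _.
  apply: leq_trans (_ : (2 ^ p) ^ T.+1 <= _)%N.
    by rewrite leq_exp2r // ltnW // ltn_expl.
  rewrite -expnM leq_exp2l // (mulnC 4%N) -mulnA leq_mul2l; apply/orP; right.
  by rewrite mulnC; exact: ltn_ceil.
have rX : (count (class_type (realizable_in (abelian_pgroups p))) (types X) <= (lg X).+1)%N.
  rewrite -size_filter -[(lg X).+1](size_iota 0) -(size_map (fun i => nseq i p)).
  apply: uniq_leq_size; first by rewrite filter_uniq ?types_uniq.
  move=> t; rewrite mem_filter mem_types => /andP[/(odd_realizable_type pp op) E /andP[_ tX]].
  apply/mapP; exists (size t) => //; rewrite mem_iota add0n leq0n /= ltnS ltnW //.
  rewrite -(ltn_exp2l _ _ (ltnSn 1)); apply: leq_ltn_trans (ltn_exp_lg X).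
  apply: leq_trans tX; rewrite E tprod_nseq size_nseq.
  by case: (size t) => // n; rewrite leq_exp2r.
rewrite count_class_pgroups; split; [by apply: leq_trans nM; rewrite expn_gt0| |by rewrite mul0n muln0].
rewrite mul0n muln0 add0n mul1n; apply: leq_trans nM.
apply: leq_trans (_ : k * (lg X).+1 <= _)%N; first by rewrite leq_mul2l rX orbT.
apply: leq_trans (_ : c * M.+1 <= _)%N.
  rewrite /c -mulnA leq_mul2l; apply/orP; right; rewrite mulSn; lia.
by rewrite expnS expn1 leq_mul2r (leq_trans cM).
Qed.
End PGroupDensities.

(** * Indecomposable groups *)

(** C(2m, m) is the product of the (2m - i) / (m - i), each of which is at least 2. *)
Lemma leq_exp2_bin m : (2 ^ m <= 'C(2 * m, m))%N.
Proof.
rewrite -(leq_pmul2r (fact_gt0 m)) bin_ffact -ffactnn !ffact_prod.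
have -> : (2 ^ m = \prod_(i < m) 2)%N by rewrite prod_nat_const card_ord.
by rewrite -big_split /=; apply: leq_prod => i _; lia.
Qed.

Lemma logn_fact_widen p n B : prime p -> (n <= B)%N ->
  logn p n`! = (\sum_(1 <= k < B.+1) n %/ p ^ k)%N.
Proof.
move=> pp nB; rewrite logn_fact // [RHS](big_cat_nat (n := n.+1)) //=.
rewrite [X in (_ + X)%N]big_nat_cond [X in (_ + X)%N]big1 ?addn0 // => k /andP[/andP[nk _] _].
by rewrite divn_small // (leq_trans nk) // ltnW // ltn_expl ?prime_gt1.
Qed.

(** By Legendre's formula the valuation is the sum over k of
floor (2m / p ^ k) - 2 floor (m / p ^ k), which is at most 1, and 0 as soon as
p ^ k > 2m. *)
Lemma central_bin_prime_power p m : prime p -> (0 < m)%N ->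
  (p ^ logn p 'C(2 * m, m) <= 2 * m)%N.
Proof.
move=> pp m0; have p1 := prime_gt1 pp; have m20 : (0 < 2 * m)%N by rewrite muln_gt0.
apply: leq_trans (trunc_logP p1 m20); rewrite leq_exp2l //.
have m2 : (m <= 2 * m)%N by rewrite leq_pmull.
have E : (logn p 'C(2 * m, m) + 2 * (\sum_(1 <= k < (2 * m).+1) m %/ p ^ k) =
    \sum_(1 <= k < (2 * m).+1) (2 * m) %/ p ^ k)%N.
  rewrite -!logn_fact_widen // -(bin_fact m2) (_ : (2 * m - m = m)%N); last by lia.
  rewrite lognM ?bin_gt0 ?muln_gt0 ?fact_gt0 ?m2 //.
  by rewrite lognM ?fact_gt0 // addnn -mul2n.
have le : (\sum_(1 <= k < (2 * m).+1) (2 * m) %/ p ^ k <=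
    2 * (\sum_(1 <= k < (2 * m).+1) m %/ p ^ k) + cnt (fun k => p ^ k <= 2 * m) (2 * m))%N.
  rewrite /cnt [X in (_ + X)%N]big_mkcond /= big_distrr -big_split /=; apply: leq_sum => k _.
  case: (leqP (p ^ k) (2 * m)) => h; last by rewrite divn_small.
  have pk : (0 < p ^ k)%N by rewrite expn_gt0 prime_gt0.
  rewrite -ltnS ltn_divLR //.
  by have := ltn_ceil m pk; move: (m %/ p ^ k)%N => q; nia.
apply: leq_trans (_ : cnt (fun k => p ^ k <= 2 * m) (2 * m) <= _)%N; first by lia.
rewrite cntE -size_filter -[X in (_ <= X)%N](size_iota 1); apply: uniq_leq_size.
  by rewrite filter_uniq ?iota_uniq.
move=> k; rewrite mem_filter !mem_iota => /andP[h /andP[-> _]].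
by rewrite add1n ltnS trunc_log_max.
Qed.

(** Chebyshev's lower bound: C(2m, m) is at least 2 ^ m, and a product of prime
powers each at most 2m. *)
Lemma cnt_prime_lower m : (0 < m)%N -> (m <= cnt prime (2 * m) * lg (2 * m))%N.
Proof.
move=> m0; have b0 : (0 < 'C(2 * m, m))%N by rewrite bin_gt0 leq_pmull.
rewrite -(leq_exp2l _ _ (ltnSn 1)); apply: leq_trans (leq_exp2_bin m) _.
rewrite (mulnC (cnt _ _)) expnM; apply: leq_trans (_ : (2 * m) ^ size (primes 'C(2 * m, m)) <= _)%N; last first.
  apply: (@leq_trans ((2 ^ lg (2 * m)) ^ size (primes 'C(2 * m, m)))).
    by case: (size _) => // n; rewrite leq_exp2r // ltnW // ltn_exp_lg.
  rewrite leq_pexp2l ?expn_gt0 //; apply: cnt_size; first exact: primes_uniq.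
  move=> p; rewrite mem_primes => /and3P[pp _ pC]; rewrite pp prime_gt0 //; split=> //.
  rewrite -prime_dvd_fact //; apply: dvdn_trans pC _.
  by rewrite -(bin_fact (leq_pmull m (isT : 0 < 2)%N)) dvdn_mulr.
rewrite [X in (X <= _)%N](prod_prime_decomp b0) prime_decompE big_map /=.
have -> : ((2 * m) ^ size (primes 'C(2 * m, m)) = \prod_(p <- primes 'C(2 * m, m)) (2 * m))%N.
  by rewrite big_const_seq count_predT iter_muln_1.
rewrite !big_seq; apply: leq_prod => p; rewrite mem_primes => /and3P[pp _ _].
exact: central_bin_prime_power.
Qed.

Lemma class_type_prime q : prime q -> class_type abelian_indecomposable_groups [:: q].
Proof.
move=> pq; apply: class_typeP; first by rewrite /= dvd1n prime_gt1.
move=> gT G cGG Gt; split=> //.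
have Gq : #|G| = q by rewrite -tprod_type // Gt /tprod big_seq1.
split; first by rewrite -cardG_gt1 Gq prime_gt1.
move=> H K defG; have := dprod_card defG; rewrite Gq => E.
have /primeP[_ /(_ #|H|)] := pq; rewrite -{1}E dvdn_mulr // => /(_ isT).
case/pred2P => h; first by left; apply: card1_trivg.
right; apply: card1_trivg; apply/eqP.
by rewrite -(eqn_pmul2l (prime_gt0 pq)) muln1 -{1}h E.
Qed.

(** The first invariant factor splits off, so the group is cyclic; so does its
p-part for p a prime divisor of the order, so it is a p-group. *)
Lemma indecomposable_type (gT : finGroupType) (G : {group gT}) :
  abelian G -> indecomposable G ->
  exists p, [/\ prime p, (p.-group G)%g & abelian_type G = [:: #|G|]].
Proof.
move=> cGG [nG dec]; have cG : cyclic G.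
  have [[|x b] defG bt] := abelian_structure cGG.
    by move: nG; rewrite -defG big_nil eqxx.
  move: defG; rewrite big_cons => defG.
  have [[_ H _ defH] _ _ _] := dprodP defG; rewrite defH in defG.
  case: (dec _ _ defG) => h.
    have := divisor_chain_type G; rewrite -bt => /and3P[].
    by rewrite /order h cards1.
  by move: defG; rewrite h dprodg1 => <-; exact: cycle_cyclic.
have G1 : (1 < #|G|)%N by rewrite cardG_gt1.
exists (pdiv #|G|); split; first exact: pdiv_prime.
  have := nilpotent_pcoreC (pdiv #|G|) (abelian_nil cGG) => /[dup] defG /dec[h|h]; last first.
    by have := pcore_pgroup (pdiv #|G|) G; move: defG; rewrite h dprodg1 => ->.
  have : ((pdiv #|G|)^'.-group G)%g 
    by have := pcore_pgroup (pdiv #|G|)^' G; move: defG; rewrite h dprod1g => ->.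
  rewrite /pgroup p'natE ?pdiv_prime // => /negP[]; exact: pdiv_dvd.
rewrite -tprod_type //; move: cG; rewrite cyclic_type //.
have := tprod_type cGG; case: (abelian_type G) => [|d [|//]]; last by rewrite /tprod big_seq1.
by rewrite /tprod big_nil => E; move: G1; rewrite -E.
Qed.

Lemma realizable_indecomposable_type X t : t \in types X ->
  class_type (realizable_in abelian_indecomposable_groups) t ->
  exists2 k, (k <= lg X)%N & t = [:: 2 ^ k]%N \/ t = [:: (2 ^ k).-1]%N.
Proof.
rewrite mem_types => /andP[_ tX] /asboolP[gT [G [[[cGG iG] rG] tE]]].
have [p [pp pG Gt]] := indecomposable_type cGG iG; have [nG _] := iG.
have GX : (#|G| <= X)%N by rewrite -tprod_type // tE.
have [op|ep] := boolP (odd p).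
  have [H []] := odd_realizable_pgroup pp op cGG pG rG; first by move/eqP; rewrite (negbTE nG).
  case=> k pk; have ab : (p.-abelem G)%g by rewrite abelemE // cGG; apply/exponentP.
  have Gp : #|G| = p.
    by move: Gt; rewrite (abelian_type_abelem ab); case: ('r(G))%g => [|[|//]] // [].
  exists k; last by right; rewrite -tE Gt -pk -Gp.
  rewrite -(leq_exp2l _ _ (ltnSn 1)) -pk -Gp (leq_trans _ (ltn_exp_lg X)) //.
have p2 : p = 2%N by case: (even_prime pp) => // h; rewrite h in ep.
move: pG; rewrite p2 => /p_natP[k Gk]; exists k; last by left; rewrite -tE Gt Gk.
rewrite ltnW // -(ltn_exp2l _ _ (ltnSn 1)) -Gk; exact: leq_ltn_trans GX (ltn_exp_lg X).
Qed.

(** At most 2 (lg X + 1) realizable types, against the groups of prime order, at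
least a multiple of X / lg X of them. *)
Lemma density_indecomposable (R : realType) :
  realizable_density abelian_indecomposable_groups (0 : R).
Proof.
rewrite -[0](@mul0r R 1^-1); apply: (@density_of_counts R _ 0 1) => //.
  by move=> gT G [].
move=> k; have [m0 H] := poly_lt_exp 2 (24 * k).+1.
exists (maxn (2 ^ m0) 2) => X; rewrite geq_max => /andP[Xm X2].
pose m := (X %/ 2)%N; have m1 : (0 < m)%N by rewrite divn_gt0.
have Xlt : (X < m.+1 * 2)%N by exact: ltn_ceil.
have mX : (2 * m <= X)%N by rewrite mulnC leq_trunc_div.
have nX : (m <= count (class_type abelian_indecomposable_groups) (types X) * lg X)%N.
  apply: leq_trans (cnt_prime_lower m1) _; apply: leq_mul (leq_lg mX).
  apply: leq_trans (leq_cnt prime mX) _.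
  rewrite cntE -!size_filter -(size_map (fun q => [:: q])).
  apply: uniq_leq_size; first by rewrite map_inj_uniq ?filter_uniq ?iota_uniq // => x y [].
  move=> t /mapP[q]; rewrite !mem_filter mem_iota add1n ltnS => /andP[pq /andP[_ qX]] ->.
  by rewrite class_type_prime // mem_types /= dvd1n prime_gt1 // /tprod big_seq1.
have rX : (count (class_type (realizable_in abelian_indecomposable_groups)) (types X) <=
    (lg X).+1 + (lg X).+1)%N.
  pose s := [seq [:: 2 ^ i]%N | i <- iota 0 (lg X).+1] ++ [seq [:: (2 ^ i).-1]%N | i <- iota 0 (lg X).+1].
  have -> : ((lg X).+1 + (lg X).+1 = size s)%N by rewrite size_cat !size_map size_iota.
  rewrite -size_filter; apply: uniq_leq_size; first by rewrite filter_uniq ?types_uniq.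
  move=> t; rewrite mem_filter => /andP[rt tX].
  have [i iX E] := realizable_indecomposable_type tX rt.
  rewrite mem_cat; apply/orP; case: E => ->; [left|right]; apply/mapP; exists i => //;
    by rewrite mem_iota ltnS.
have lX : (m0 <= lg X)%N.
  by rewrite ltnW // -(ltn_exp2l _ _ (ltnSn 1)); apply: leq_ltn_trans Xm (ltn_exp_lg X).
have hX := H _ lX.
have h2 : (2 ^ lg X <= 2 * X)%N.
  by have := leq_exp_lg (ltnW X2); rewrite /lg /= expnS leq_mul2l.
have l1 : (0 < lg X)%N by [].
move: nX rX hX h2 l1; move: (count _ _) (count _ _) (lg X) (2 ^ _)%N => r n l e nX rX hX h2 l1.
rewrite /= mul0n muln0 mul1n add0n; split=> //; first by nia.
rewrite -(leq_pmul2r l1); apply: leq_trans nX.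
have : (k * r * l <= 4 * k * l ^ 2)%N.
  apply: leq_trans (_ : k * (l.+1 + l.+1) * l <= _)%N; first by rewrite leq_mul2r leq_mul2l rX !orbT.
  by rewrite expnS expn1 (_ : 4 * k * (l * l) = k * (4 * l) * l)%N; [rewrite leq_mul2r leq_mul2l; lia|ring].
move: (l ^ 2)%N hX => q hX h; nia.
Qed.

Theorem theorem1p1 (R : realType) :
  [/\ realizable_density cyclic_groups (1 / 4 : R),
      forall p : nat, prime p ->
        realizable_density (abelian_pgroups p) (if odd p then 0 else 1 : R),
      realizable_density abelian_indecomposable_groups (0 : R) &
      realizable_density abelian_groups (1 / 2 : R)].
Proof.
split.
- exact: density_cyclic.
- move=> p pp; case: ifP => op; first exact: density_odd_pgroups.
  have [->|] := even_prime pp; first exact: density_2groups.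
  by rewrite op.
- exact: density_indecomposable.
- exact: density_abelian.
Qed.
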